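(* Let $d\ge2$, $s\ge 1$, and let $\{E_r\}_{r>0}\subset\mathfrak{C}$ be such that $E_r\to E$ in $\mathfrak{C}$ as $r\to0^+$ for some $E\in\mathfrak{C}$. Then for every $x\in\partial E\cap\partial E_r$ for all $r>0$, $$\lim_{r\to0^+}\frac{\mathcal K^s_r(x,E_r)}{\sigma^s(r)}=\omega_{d-1}\mathcal K^1(x,E).$$
   Context: $\mathfrak{C}$ is the class of subsets of $\mathbb{R}^d$ which are closures of open sets with compact $C^2$ boundary; $E_r\to E$ in $\mathfrak{C}$ means there are diffeomorphisms $\Phi_r$ converging to the identity in $C^2$ with $\Phi_r(E)=E_r$. $k^s_r(t)=r^{-d-s}$ for $0\le t\le r$ and $k^s_r(t)=t^{-d-s}$ for $t>r$; $\mathcal K^s_r(x,E):=\int_{\mathbb{R}^d}(\chi_{\mathbb{R}^d\setminus E}(y)-\chi_E(y))k^s_r(|x-y|)\,dy$. $\sigma^s(r):=|\log r|$ if $s=1$, $\sigma^s(r):=\frac{d+s}{d+1}\frac{r^{1-s}}{s-1}$ if $s>1$. $\omega_{d-1}$ is the measure of the unit ball of $\mathbb{R}^{d-1}$. $\mathcal K^1(x,E)$ is the classical scalar mean curvature (sum of principal curvatures) of $\partial E$ at $x$, with the convention that if $E$ is locally $\{y_d\le f(y')\}$ with outer normal $e_d$ at $x$ and $Df(x')=0$, then $\mathcal K^1(x,E)=-\Delta f(x')$. *)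

(* Defs.v *)
From mathcomp Require Import all_boot all_order all_algebra.
From mathcomp Require Import all_classical all_reals all_analysis.
Set Implicit Arguments. Unset Strict Implicit. Unset Printing Implicit Defensive.
Import Order.TTheory GRing.Theory Num.Theory.
Import numFieldNormedType.Exports.
Local Open Scope classical_set_scope.
Local Open Scope ring_scope.

Section Defs.
Variable R : realType.

Definition enorm n (y : 'rV[R]_n) : R := Num.sqrt (\sum_(i < n) y 0 i ^+ 2).

(* k-th coordinate (0-based), 0 if out of range *)
Definition coord n (y : 'rV[R]_n) (k : nat) : R :=
  oapp (fun i : 'I_n => y 0 i) 0 (insub k).
Definition yprime n (y : 'rV[R]_n) : 'rV[R]_n.-1 := \row_(i < n.-1) coord y i.
Definition ylast n (y : 'rV[R]_n) : R := coord y n.-1.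

Definition ebasis n (i : 'I_n) : 'rV[R]_n := delta_mx 0 i.
Definition pd n (i : 'I_n) (f : 'rV[R]_n -> R) : 'rV[R]_n -> R :=
  fun y => 'D_(ebasis i) f y.

Definition C2fun n (f : 'rV[R]_n -> R) : Prop :=
  continuous f /\
  (forall i y, derivable f y (ebasis i)) /\
  (forall i, continuous (pd i f)) /\
  (forall i j y, derivable (pd i f) y (ebasis j)) /\
  (forall i j, continuous (pd j (pd i f))).

Definition C2map n (F : 'rV[R]_n -> 'rV[R]_n) : Prop :=
  forall k : 'I_n, C2fun (fun y => F y 0 k).

Definition C2diffeo n (F : 'rV[R]_n -> 'rV[R]_n) : Prop :=
  exists G : 'rV[R]_n -> 'rV[R]_n,
    cancel F G /\ cancel G F /\ C2map F /\ C2map G.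

Definition orthogonal_mx n (Q : 'M[R]_n) : Prop := Q^T *m Q = 1%:M.

Definition bdry n (E : set 'rV[R]_n) : set 'rV[R]_n := closure E `\` interior E.

(* E has C^2 boundary near each of its boundary points: after a rigid motion
   centred at x, E is locally the subgraph {y_n <= f(y')} of a C^2 function f *)
Definition C2_boundary n (E : set 'rV[R]_n) : Prop :=
  forall x, bdry E x ->
    exists (Q : 'M[R]_n) (f : 'rV[R]_n.-1 -> R) (rho : R),
      orthogonal_mx Q /\ C2fun f /\ f 0 = 0 /\ 0 < rho /\
      forall y : 'rV[R]_n, enorm y < rho ->
        (E (x + y *m Q) <-> ylast y <= f (yprime y)).

Definition classCfrak n (E : set 'rV[R]_n) : Prop :=
  (exists O : set 'rV[R]_n, open O /\ E = closure O) /\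
  compact (bdry E) /\ C2_boundary E.

(* E_r -> E in \mathfrak{C} as r -> 0^+ : diffeomorphisms Phi_r with
   Phi_r(E) = E_r, converging to the identity in C^2 (uniformly on R^n) *)
Definition convCfrak n (Er : R -> set 'rV[R]_n) (E : set 'rV[R]_n) : Prop :=
  exists Phi : R -> 'rV[R]_n -> 'rV[R]_n,
    (forall r, 0 < r -> C2diffeo (Phi r) /\ Phi r @` E = Er r) /\
    forall eps : R, 0 < eps -> \forall r \near 0^'+,
      forall y : 'rV[R]_n,
        (forall k : 'I_n, `|Phi r y 0 k - y 0 k| <= eps) /\
        (forall i k : 'I_n,
           `|pd i (fun z => Phi r z 0 k) y - (i == k)%:R| <= eps) /\
        (forall i j k : 'I_n,
           `|pd j (pd i (fun z => Phi r z 0 k)) y| <= eps).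

(* Lebesgue integral over R^n, computed as an iterated integral of
   one-dimensional Lebesgue integrals (Fubini) *)
Fixpoint iint (n : nat) : ('rV[R]_n -> \bar R) -> \bar R :=
  match n return ('rV[R]_n -> \bar R) -> \bar R with
  | 0 => fun F => F 0
  | m.+1 => fun F =>
      (\int[@lebesgue_measure R]_t iint (fun y : 'rV[R]_m =>
           F (row_mx (const_mx t : 'rV[R]_1) y)))%E
  end.

Definition omega (n : nat) : R :=
  fine (iint (fun y : 'rV[R]_n => (\1_[set z | enorm z < 1] y : R)%:E)).

Definition kker (d : nat) (s r t : R) : R :=
  if t <= r then r `^ (- (d%:R + s)) else t `^ (- (d%:R + s)).

Definition Kr d (s r : R) (x : 'rV[R]_d) (E : set 'rV[R]_d) : \bar R :=
  iint (fun y : 'rV[R]_d =>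
    ((\1_(~` E) y - \1_E y) * kker d s r (enorm (x - y)))%:E).

Definition sigma (d : nat) (s r : R) : R :=
  if s == 1 then `|ln r|
  else (d%:R + s) / (d%:R + 1) * (r `^ (1 - s) / (s - 1)).

(* scalar mean curvature K^1(x,E): E locally {y_d <= f(y')} around x (after
   a rigid motion) with Df(0) = 0, and K^1 = - Laplacian f (0) *)
Definition is_mean_curv n (E : set 'rV[R]_n) (x : 'rV[R]_n) (k : R) : Prop :=
  exists (Q : 'M[R]_n) (f : 'rV[R]_n.-1 -> R) (rho : R),
    orthogonal_mx Q /\ C2fun f /\ f 0 = 0 /\ (forall i, pd i f 0 = 0) /\
    0 < rho /\
    (forall y : 'rV[R]_n, enorm y < rho ->
        (E (x + y *m Q) <-> ylast y <= f (yprime y))) /\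
    k = - \sum_(i < n.-1) pd i (pd i f) 0.

Definition mean_curv n (E : set 'rV[R]_n) (x : 'rV[R]_n) : R :=
  xget 0 [set k | is_mean_curv E x k].

End Defs.

(* Main.v *)
(** In graph coordinates at [x] the set [E] is [{y_d <= f(y')}] with [Df(0) = 0],
    and a C2-small diffeomorphism whose image still has [x] on its boundary turns
    it, near [x], into a set squeezed between the two regions
    [{y_d + a.y' <= q(y') -+ eps |y'|^2}], where [q] is the second-order Taylor
    polynomial of [f] and [a] is small.  By monotonicity of the integral it then
    suffices to integrate the kernel over these model regions; the images
    themselves are never integrated over.  Up to a bounded tail, the central symmetry
    of the kernel reduces that integral to [-2 \int (q -+ eps |y'|^2) k(|y'|) dy']
    over a ball of [R^(d-1)], with a factor tending to [1] that accounts for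
    replacing [k(|y|)] by [k(|y'|)].  Reflections kill the off-diagonal part of
    [q], and the second moment of [k] over the ball is
    [(d-1) omega_(d-1) sigma(r) + O(1)].  Hence the limit is
    [-omega_(d-1) \Delta f(0)] up to an error that is linear in [eps]. *)
Require Import Defs.
From HB Require Import structures.
From mathcomp Require Import all_boot all_order all_algebra.
From mathcomp Require Import fingroup perm.
From mathcomp Require Import all_classical all_reals all_analysis.
From mathcomp Require Import measurable_realfun ring lra.
Import Order.TTheory GRing.Theory Num.Theory.
Import numFieldNormedType.Exports.
Set Implicit Arguments. Unset Strict Implicit. Unset Printing Implicit Defensive.
Local Open Scope classical_set_scope.
Local Open Scope ring_scope.

(** * Lebesgue measure on row vectors *)

(** The point [x] stays on every boundary but the normal there may turn, hence the tilt [a]. It is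
    not rotated away: on each vertical line a translation by [a.y'] straightens the strip, and the
    central symmetry survives. The second moment of the kernel grows like [sigma], so an error
    proportional to it must carry a small factor, whereas bounded errors vanish in the quotient.
    This is why the C2-closeness has to yield an error [eps |y'|^2] and not merely O(|y'|^2). Two
    features of the definitions shape the rest. [Kr] is an iterated one-dimensional integral, whose
    rotation invariance is not visible; the measure [leb] is built along the same recursion to
    obtain it. And [C2_boundary] gives graphs whose gradient at 0 may be nonzero, while
    [is_mean_curv] demands a globally C2 function with vanishing gradient; a rotation, a cutoff and
    a global implicit function theorem show that such a function exists. The limit is then proved
    for every value allowed by [is_mean_curv], so the choice made by [xget] does not matter. *)

Section measurable_rV.
Context {R : realType} (n : nat).

Let coors : 'I_n -> 'rV[R]_n -> R := fun i y => y 0 i.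

Let rV_set0 : g_sigma_preimage coors set0.
Proof. exact: sigma_algebra0. Qed.

Let rV_setC A : g_sigma_preimage coors A -> g_sigma_preimage coors (~` A).
Proof. exact: sigma_algebraC. Qed.

Let rV_bigcup (F : _^nat) : (forall i, g_sigma_preimage coors (F i)) ->
  g_sigma_preimage coors (\bigcup_i (F i)).
Proof. exact: sigma_algebra_bigcup. Qed.

Definition rV_display : measure_display. Proof. exact. Qed.

HB.instance Definition _ := @isMeasurable.Build rV_display
  'rV[R]_n (g_sigma_preimage coors) rV_set0 rV_setC rV_bigcup.

Lemma measurable_coor (i : 'I_n) : measurable_fun setT (fun y : 'rV[R]_n => y 0 i).
Proof.
move=> _ Y mY; rewrite setTI; apply: sub_sigma_algebra => /=.
rewrite -bigcup_seq/=; exists i => /=; first by rewrite mem_index_enum.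
by exists Y => //; rewrite setTI.
Qed.

Lemma measurable_rVP d (T : measurableType d) (f : T -> 'rV[R]_n) :
  (forall i, measurable_fun setT (fun x => f x 0 i)) -> measurable_fun setT f.
Proof.
move=> mf _ A mA; rewrite setTI.
suff : g_sigma_preimage (fun i => coors i \o f) `<=` measurable.
  by apply; rewrite g_sigma_preimage_comp; exists A => //; rewrite setTI.
apply: smallest_sub; first exact: sigma_algebra_measurable.
rewrite -bigcup_seq; apply: bigcup_sub => i _ B [C mC <-].
exact: mf.
Qed.

End measurable_rV.

Section consrv.
Context {R : realType}.

(** The term is the one in the recursion of [iint], so unfolding an iterated integral produces
    [consrv] by conversion. *)
Definition consrv n (t : R) (y : 'rV[R]_n) : 'rV[R]_n.+1 :=
  row_mx (const_mx t : 'rV[R]_1) y.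

Lemma consrv0 n t (y : 'rV[R]_n) : consrv t y 0 ord0 = t.
Proof.
rewrite /consrv; have -> : (ord0 : 'I_n.+1) = lshift n (ord0 : 'I_1) by exact: val_inj.
by rewrite (row_mxEl (const_mx t : 'rV[R]_1) y) mxE.
Qed.

Lemma consrvS n t (y : 'rV[R]_n) i : consrv t y 0 (lift ord0 i) = y 0 i.
Proof.
rewrite /consrv; have -> : lift ord0 i = rshift 1 i by exact: val_inj.
by rewrite (row_mxEr (const_mx t : 'rV[R]_1) y).
Qed.

Definition tailrv n (y : 'rV[R]_n.+1) : 'rV[R]_n := \row_i y 0 (lift ord0 i).

Lemma consrv_eta n (y : 'rV[R]_n.+1) : consrv (y 0 ord0) (tailrv y) = y.
Proof.
apply/rowP => i; case: (unliftP ord0 i) => [j|] ->; last by rewrite consrv0.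
by rewrite consrvS mxE.
Qed.

Lemma tail_consrv n t (y : 'rV[R]_n) : tailrv (consrv t y) = y.
Proof. by apply/rowP => i; rewrite mxE consrvS. Qed.

Lemma measurable_consrv d (T : measurableType d) n (f : T -> R) (g : T -> 'rV[R]_n) :
  measurable_fun setT f -> measurable_fun setT g ->
  measurable_fun setT (fun x => consrv (f x) (g x)).
Proof.
move=> mf mg; apply: measurable_rVP => i; case: (unliftP ord0 i) => [j|] ->.
  under eq_fun do rewrite consrvS.
  exact: measurableT_comp (measurable_coor j) mg.
by under eq_fun do rewrite consrv0.
Qed.

Definition consp n (x : R * 'rV[R]_n) := consrv x.1 x.2.

Lemma measurable_consp n : measurable_fun setT (@consp n).
Proof. by apply: measurable_consrv. Qed.

End consrv.

Section leb_step.
Context {R : realType} (n : nat).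
Variable m : {sigma_finite_measure set 'rV[R]_n -> \bar R}.

Definition leb_step : set 'rV[R]_n.+1 -> \bar R :=
  pushforward (@lebesgue_measure R \x m)%E (@consp R n).

Let leb_step0 : leb_step set0 = 0%E.
Proof. by rewrite /leb_step /pushforward preimage_set0 measure0. Qed.

Let leb_step_ge0 A : (0 <= leb_step A)%E.
Proof. by rewrite /leb_step /pushforward; exact: measure_ge0. Qed.

Let leb_step_sigma_additive : semi_sigma_additive leb_step.
Proof.
move=> F mF tF mUF.
have mp A : measurable A -> measurable (@consp R n @^-1` A).
  by move=> mA; rewrite -[X in measurable X]setTI; exact: measurable_consp.
rewrite /leb_step /pushforward preimage_bigcup.
apply: measure_semi_sigma_additive.
- by move=> i; exact: mp.
- apply/trivIsetP => /= i j _ _ ij; rewrite -preimage_setI.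
  by move/trivIsetP : tF => /(_ _ _ _ _ ij) ->//; rewrite preimage_set0.
- by rewrite -preimage_bigcup; exact: mp.
Qed.

HB.instance Definition _ := isMeasure.Build _ _ _
  leb_step leb_step0 leb_step_ge0 leb_step_sigma_additive.

Let leb_step_sigma_finite : sigma_finite setT leb_step.
Proof.
have /sigma_finiteP[F [TF ndF Foo]] := sigma_finiteT (@lebesgue_measure R).
have /sigma_finiteP[G [TG ndG Goo]] := sigma_finiteT m.
(* [psi] inverts [consp], so the preimage of a rectangle has the measure of that rectangle. Both
   sequences are nondecreasing, which lets one index serve the two factors. *)
pose psi (y : 'rV[R]_n.+1) : R * 'rV[R]_n := (y 0 ord0, tailrv y).
have mpsi : measurable_fun setT psi.
  apply: measurable_fun_pair; first exact: measurable_coor.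
  apply: measurable_rVP => i; under eq_fun do rewrite mxE.
  exact: measurable_coor.
exists (fun k => psi @^-1` (F k `*` G k)).
  apply/esym; rewrite -preimage_bigcup; apply/seteqP; split=> // y _.
  have [k _ Fk] : (\bigcup_k F k) (psi y).1 by rewrite -TF.
  have [l _ Gl] : (\bigcup_k G k) (psi y).2 by rewrite -TG.
  exists (maxn k l) => //; split.
  - by move: Fk; exact/subsetPset/ndF/leq_maxl.
  - by move: Gl; exact/subsetPset/ndG/leq_maxr.
move=> k; have [mFk Fk] := Foo k; have [mGk Gk] := Goo k; split.
  by rewrite -[X in measurable X]setTI; apply: mpsi => //; exact: measurableX.
rewrite /leb_step /pushforward -comp_preimage.
have -> : psi \o @consp R n = id.
  by apply/funext => -[t y] /=; rewrite /psi /consp /= consrv0 tail_consrv.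
by rewrite product_measure1E// lte_mul_pinfty// ge0_fin_numE.
Qed.

HB.instance Definition _ :=
  Measure_isSigmaFinite.Build _ _ _ leb_step leb_step_sigma_finite.

Lemma integral_leb_step (F : 'rV[R]_n.+1 -> \bar R) :
  measurable_fun setT F -> (forall y, 0 <= F y)%E ->
  (\int[leb_step]_y F y = \int[@lebesgue_measure R]_t \int[m]_y F (consrv t y))%E.
Proof.
move=> mF F0.
rewrite ge0_integral_pushforward//; last exact: measurable_consp.
rewrite preimage_setT fubini_tonelli1//.
- by apply: measurableT_comp => //; exact: measurable_consp.
- by move=> x; exact: F0.
Qed.

Lemma integrable_leb_step (F : 'rV[R]_n.+1 -> \bar R) :
  leb_step.-integrable setT F ->
  (@lebesgue_measure R \x m)%E.-integrable setT (F \o @consp R n).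
Proof.
move=> /integrableP[mF iF]; apply/integrableP; split.
  by apply: measurableT_comp => //; exact: measurable_consp.
move: iF; rewrite ge0_integral_pushforward//.
- exact: measurable_consp.
- exact: measurableT_comp.
Qed.

Lemma integral_leb_step_int (F : 'rV[R]_n.+1 -> \bar R) :
  leb_step.-integrable setT F ->
  (\int[leb_step]_y F y = \int[@lebesgue_measure R]_t \int[m]_y F (consrv t y))%E.
Proof.
move=> iF; have iFc := integrable_leb_step iF.
have mF : measurable_fun setT F := measurable_int _ iF.
have := @integral_pushforward _ _ (measurableTypeR R * 'rV[R]_n)%type _ R
  (@consp R n) (@measurable_consp R n)
  (@lebesgue_measure R \x m)%E setT F mF.
rewrite preimage_setT => /(_ iFc measurableT) ->.
by rewrite -integral12_prod_meas1.
Qed.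

End leb_step.

(** Follows the recursion of [iint]; in dimension 0 the space is a point, and the Dirac mass returns
    the value of the integrand there. *)
Fixpoint leb {R : realType} n : {sigma_finite_measure set 'rV[R]_n -> \bar R} :=
  match n return {sigma_finite_measure set 'rV[R]_n -> \bar R} with
  | 0 => \d_(0 : 'rV[R]_0)
  | m.+1 => leb_step (leb m)
  end.


(** * The iterated integral as an integral against [leb] *)

Section iint_leb.
Context {R : realType}.

(* Both parts of the integral are suprema over simple functions below (or above)
   the integrand, so monotonicity requires no measurability. *)
Lemma le_integral_nomeas d (T : measurableType d) (mu : {measure set T -> \bar R})
    (f g : T -> \bar R) : (forall x, f x <= g x)%E ->
  (\int[mu]_x f x <= \int[mu]_x g x)%E.
Proof.
move=> fg; rewrite /integral !patch_setT; apply: leeB; apply: le_ereal_sup.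
- move=> _ [h hf <-]; exists h => // x; apply: (le_trans (hf x)).
  by rewrite !funeposE ge_max !le_max fg lexx orbT.
- move=> _ [h hf <-]; exists h => // x; apply: (le_trans (hf x)).
  by rewrite !funenegE ge_max !le_max leeN2 fg lexx orbT.
Qed.

Lemma le_iint n (F G : 'rV[R]_n -> \bar R) :
  (forall y, F y <= G y)%E -> (iint F <= iint G)%E.
Proof.
elim: n F G => [|n IH] F G FG; first exact: FG.
by apply: le_integral_nomeas => t; apply: IH => y; exact: FG.
Qed.

Lemma measurable_integral_param d (T : measurableType d)
    (H : T * measurableTypeR R -> \bar R) : measurable_fun setT H ->
  measurable_fun setT (fun t => \int[@lebesgue_measure R]_u H (t, u))%E.
Proof.
move=> mH; under eq_fun do rewrite integralE.
apply: emeasurable_funB.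
- rewrite [X in measurable_fun _ X](_ : _ = fubini_F (@lebesgue_measure R) (H^\+)%E).
    by apply: measurable_fun_fubini_tonelli_F => //; exact: measurable_funepos.
  by apply/funext => t; apply: eq_integral => u _; rewrite !funeposE.
- rewrite [X in measurable_fun _ X](_ : _ = fubini_F (@lebesgue_measure R) (H^\-)%E).
    by apply: measurable_fun_fubini_tonelli_F => //; exact: measurable_funeneg.
  by apply/funext => t; apply: eq_integral => u _; rewrite !funenegE.
Qed.

(** The parameter space [T] is arbitrary because the induction moves the first coordinate into
    it. *)
Lemma measurable_iint n d (T : measurableType d) (F : T * 'rV[R]_n -> \bar R) :
  measurable_fun setT F -> measurable_fun setT (fun t => iint (fun y => F (t, y))).
Proof.
elim: n d T F => [|n IH] d T F mF.
  by apply: (measurableT_comp mF); exact: measurable_fun_pair.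
pose F' (p : (T * measurableTypeR R) * 'rV[R]_n) := F (p.1.1, consrv p.1.2 p.2).
have /IH/measurable_integral_param : measurable_fun setT F'.
  apply: (measurableT_comp mF); apply: measurable_fun_pair.
    by apply: measurableT_comp.
  by apply: measurable_consrv => //; apply: measurableT_comp.
exact.
Qed.

Lemma iintE_ge0 n (F : 'rV[R]_n -> \bar R) :
  measurable_fun setT F -> (forall y, 0 <= F y)%E ->
  iint F = (\int[leb n]_y F y)%E.
Proof.
elim: n F => [|n IH] F mF F0.
  by rewrite /= integral_dirac// diracT mul1e.
rewrite /= integral_leb_step//; apply: eq_integral => t _; apply: IH => //.
by apply: (measurableT_comp mF); exact: measurable_consrv.
Qed.

(** For a signed integrand the sections are integrable only for almost every first coordinate. The
    induction hypothesis therefore gives an almost everywhere equality, and [measurable_iint]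
    supplies the measurability needed to integrate it. *)
Lemma iintE n (F : 'rV[R]_n -> \bar R) :
  (leb n).-integrable setT F -> iint F = (\int[leb n]_y F y)%E.
Proof.
elim: n F => [|n IH] F iF.
  by rewrite /= integral_dirac// ?diracT ?mul1e//; exact: measurable_int iF.
have mF : measurable_fun setT F := measurable_int _ iF.
have iFc := integrable_leb_step iF.
rewrite [RHS](integral_leb_step_int iF) /=.
apply: ae_eq_integral => //.
- apply: (measurable_iint (F := fun p : measurableTypeR R * 'rV[R]_n => F (consp p))).
  by apply: (measurableT_comp mF); exact: measurable_consp.
- exact: (measurable_fubini_F iFc).
- have ai := ae_integrable1 iFc.
  apply: (@filterS _ _ (ae_filter_ringOfSetsType (@lebesgue_measure R)) _ _ _ ai) => t it _.
  exact: (IH (fun y => F (consrv t y))).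
Qed.

End iint_leb.

(** * Invariance of the iterated integral under affine and orthogonal maps *)

Section invariance.
Context {R : realType}.

Lemma integral_affine (a b : R) (F : R -> \bar R) : 0 < a ->
  measurable_fun setT F -> (forall t, 0 <= F t)%E ->
  (\int[@lebesgue_measure R]_t F t
   = a%:E * \int[@lebesgue_measure R]_t F (a * t + b)%R)%E.
Proof.
move=> a0 mF F0.
pose phi (t : measurableTypeR R) : measurableTypeR R := a * t + b.
have mphi : measurable_fun setT phi.
  by apply: measurable_funD => //; exact: measurable_funM.
(* Lebesgue measure scaled by [a] and pushed along [phi] agrees with Lebesgue measure on half-open
   intervals, hence everywhere by uniqueness. *)
pose ma : {measure set (measurableTypeR R) -> \bar R} :=
  mscale (NngNum (ltW a0)) (@lebesgue_measure R).
have muE A : measurable A -> pushforward ma phi A = @lebesgue_measure R A.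
  move=> mA; apply/esym/lebesgue_measure_unique => //= _ [[x y]] _ <-.
  rewrite /pushforward /ma /= /mscale /=.
  have -> : phi @^-1` `]x, y]%classic = `](x - b) / a, (y - b) / a]%classic.
    apply/seteqP; split=> t /=; rewrite !in_itv /= /phi ltr_pdivrMr// ler_pdivlMr//;
    by rewrite ltrBlDr lerBrDr (mulrC t).
  rewrite !lebesgue_measure_itv/= !lte_fin ltr_pM2r ?invr_gt0// ltrD2r.
  case: ifP => _; last by rewrite mule0.
  by rewrite -!EFinD -EFinM; congr EFin; rewrite -mulrBl mulrC divfK ?gt_eqF//; ring.
rewrite -ge0_integralZl//; first last.
- by rewrite lee_fin ltW.
- exact: (measurableT_comp mF mphi).
transitivity (\int[pushforward ma phi]_t F t)%E.
  by apply: eq_measure_integral => A mA _; exact/esym/muE.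
rewrite ge0_integral_pushforward// preimage_setT ge0_integral_mscale//=.
  by rewrite ge0_integralZl// ?lee_fin ?ltW//; exact: (measurableT_comp mF mphi).
exact: (measurableT_comp mF mphi).
Qed.

Lemma integral_shift (b : R) (F : R -> \bar R) :
  measurable_fun setT F -> (forall t, 0 <= F t)%E ->
  (\int[@lebesgue_measure R]_t F (t + b)%R = \int[@lebesgue_measure R]_t F t)%E.
Proof.
move=> mF F0; rewrite [RHS](@integral_affine 1 b)// mul1e.
by apply: eq_integral => t _; rewrite mul1r.
Qed.

Lemma consrvD n s t (y z : 'rV[R]_n) :
  consrv s y + consrv t z = consrv (s + t) (y + z).
Proof.
apply/rowP => i; case: (unliftP ord0 i) => [j|] ->; rewrite mxE ?consrv0//.
by rewrite !consrvS mxE.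
Qed.

Lemma consrvZ n a t (y : 'rV[R]_n) : a *: consrv t y = consrv (a * t) (a *: y).
Proof.
apply/rowP => i; case: (unliftP ord0 i) => [j|] ->; rewrite mxE ?consrv0//.
by rewrite !consrvS mxE.
Qed.

Lemma measurable_addrV d (T : measurableType d) n (f g : T -> 'rV[R]_n) :
  measurable_fun setT f -> measurable_fun setT g ->
  measurable_fun setT (fun x => f x + g x).
Proof.
move=> mf mg; apply: measurable_rVP => i; under eq_fun do rewrite mxE.
by apply: measurable_funD; exact: (measurableT_comp (measurable_coor i)).
Qed.

Lemma measurable_scalerV d (T : measurableType d) n (c : R) (f : T -> 'rV[R]_n) :
  measurable_fun setT f -> measurable_fun setT (fun x => c *: f x).
Proof.
move=> mf; apply: measurable_rVP => i; under eq_fun do rewrite mxE.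
by apply: measurable_funM => //; exact: (measurableT_comp (measurable_coor i)).
Qed.

Lemma measurable_mulrV d (T : measurableType d) n m (Q : 'M[R]_(n, m)) (f : T -> 'rV[R]_n) :
  measurable_fun setT f -> measurable_fun setT (fun x => f x *m Q).
Proof.
move=> mf; apply: measurable_rVP => i; under eq_fun do rewrite mxE.
apply: measurable_sum => j; apply: measurable_funM => //.
exact: (measurableT_comp (measurable_coor j)).
Qed.

Lemma measurable_leb_cons n (F : 'rV[R]_n.+1 -> \bar R) :
  measurable_fun setT F -> (forall y, 0 <= F y)%E ->
  measurable_fun setT (fun t : R => \int[leb n]_y F (consrv t y))%E.
Proof.
move=> mF F0.
apply: (measurable_fun_fubini_tonelli_F (T1 := R) (F \o @consp R n)) => //.
- by apply: (measurableT_comp mF); exact: measurable_consp.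
- by move=> x; exact: F0.
Qed.

Lemma leb_shift n c (F : 'rV[R]_n -> \bar R) :
  measurable_fun setT F -> (forall y, 0 <= F y)%E ->
  (\int[leb n]_y F (y + c)%R = \int[leb n]_y F y)%E.
Proof.
elim: n c F => [|n IH] c F mF F0.
  by apply: eq_integral => y _; congr F; apply/rowP => -[].
have mFc : measurable_fun setT (fun y : 'rV[R]_n.+1 => F (y + c)).
  by apply: (measurableT_comp mF); exact: measurable_addrV.
rewrite [RHS](integral_leb_step (leb n) mF F0) (integral_leb_step (leb n) mFc (fun y => F0 _)).
have mI := measurable_leb_cons mF F0.
have I0 t : (0 <= \int[leb n]_y F (consrv t y))%E by exact: integral_ge0.
rewrite -[RHS](integral_shift (c 0 ord0) mI I0).
apply: eq_integral => t _.
rewrite -[RHS](IH (tailrv c))//; last by apply: (measurableT_comp mF); exact: measurable_consrv.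
by apply: eq_integral => y _; rewrite -consrvD consrv_eta.
Qed.

Lemma leb_scale n a (F : 'rV[R]_n -> \bar R) : 0 < a ->
  measurable_fun setT F -> (forall y, 0 <= F y)%E ->
  (\int[leb n]_y F y = (a ^+ n)%:E * \int[leb n]_y F (a *: y)%R)%E.
Proof.
move=> a0; elim: n F => [|n IH] F mF F0.
  by rewrite mul1e; apply: eq_integral => y _; congr F; apply/rowP => -[].
have mFa : measurable_fun setT (fun y : 'rV[R]_n.+1 => F (a *: y)).
  by apply: (measurableT_comp mF); exact: measurable_scalerV.
rewrite [LHS](integral_leb_step (leb n) mF F0) (integral_leb_step (leb n) mFa (fun y => F0 _)).
have mI := measurable_leb_cons mF F0.
have I0 t : (0 <= \int[leb n]_y F (consrv t y))%E by exact: integral_ge0.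
rewrite [LHS](integral_affine 0 a0 mI I0).
rewrite exprS EFinM -muleA; congr (_ * _)%E.
rewrite -ge0_integralZl//; first last.
- by rewrite lee_fin exprn_ge0// ltW.
- by move=> t _; exact: integral_ge0.
- exact: (measurable_leb_cons mFa (fun y => F0 _)).
apply: eq_integral => t _.
rewrite [LHS]IH//; last by apply: (measurableT_comp mF); exact: measurable_consrv.
by congr (_ * _)%E; apply: eq_integral => y _; rewrite consrvZ addr0.
Qed.

(** A weight that is both rotation invariant and a product over the coordinates, with positive
    finite integral. It yields the rotation invariance of [leb] and the finiteness of the unit
    ball. *)
Definition gaussrv n (y : 'rV[R]_n) : R := expR (- \sum_i y 0 i ^+ 2).

Lemma gaussrv_cons n t (y : 'rV[R]_n) : gaussrv (consrv t y) = gauss_fun t * gaussrv y.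
Proof.
rewrite /gaussrv /gauss_fun -expRD big_ord_recl opprD consrv0.
by under eq_bigr do rewrite consrvS.
Qed.

Lemma measurable_sumsq n : measurable_fun setT (fun y : 'rV[R]_n => \sum_i y 0 i ^+ 2).
Proof.
apply: measurable_sum => i; apply: measurable_funX; exact: measurable_coor.
Qed.

Lemma measurable_gaussrv n : measurable_fun setT (@gaussrv n).
Proof.
apply: (measurableT_comp (f := @expR R)); first exact: measurable_expR.
by apply: measurableT_comp => //; exact: measurable_sumsq.
Qed.

Lemma integral_gaussrv n :
  (\int[leb n]_y (gaussrv y)%:E = (Num.sqrt pi ^+ n)%:E)%E.
Proof.
elim: n => [|n IH].
  rewrite integral_dirac ?diracT ?mul1e//.
    by rewrite /gaussrv big_ord0 oppr0 expR0.
  by apply/measurable_EFinP; exact: measurable_gaussrv.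
rewrite integral_leb_step//; first last.
- by move=> y; rewrite lee_fin expR_ge0.
- by apply/measurable_EFinP; exact: measurable_gaussrv.
under eq_integral => t _.
  under eq_integral do rewrite gaussrv_cons EFinM.
  rewrite ge0_integralZl//; first last.
  - by rewrite lee_fin gauss_fun_ge0.
  - by move=> y _; rewrite lee_fin expR_ge0.
  - by apply/measurable_EFinP; exact: measurable_gaussrv.
  rewrite IH muleC.
  over.
rewrite ge0_integralZl//; first last.
- by move=> t _; rewrite lee_fin gauss_fun_ge0.
- by apply/measurable_EFinP; exact: measurable_gauss_fun.
by rewrite integralT_gauss -EFinM exprSr.
Qed.

Lemma sumsqE n (y : 'rV[R]_n) : \sum_i y 0 i ^+ 2 = (y *m y^T) 0 0.
Proof. by rewrite mxE; apply: eq_bigr => i _; rewrite mxE expr2. Qed.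

Lemma sumsq_orth n (Q : 'M[R]_n) (y : 'rV[R]_n) : orthogonal_mx Q ->
  \sum_i (y *m Q) 0 i ^+ 2 = \sum_i y 0 i ^+ 2.
Proof.
move=> /mulmx1C oQ; rewrite !sumsqE trmx_mul mulmxA -(mulmxA y) oQ.
by rewrite mulmx1.
Qed.

(* Weighting with the Gaussian [g] and shifting inside a double integral gives
   [int F(x Q) dx * int g = int F * int g]: besides Fubini, this only uses
   translation invariance and [g (y Q) = g y = g (- y)]. *)
Lemma leb_orth n (Q : 'M[R]_n) (F : 'rV[R]_n -> \bar R) : orthogonal_mx Q ->
  measurable_fun setT F -> (forall y, 0 <= F y)%E ->
  (\int[leb n]_y F (y *m Q) = \int[leb n]_y F y)%E.
Proof.
move=> oQ mF F0.
have QQ : Q *m Q^T = 1%:M by exact: mulmx1C.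
pose g (y : 'rV[R]_n) := (gaussrv y)%:E.
have g0 y : (0 <= g y)%E by rewrite lee_fin expR_ge0.
have mg : measurable_fun setT g by apply/measurable_EFinP; exact: measurable_gaussrv.
have Ig : (\int[leb n]_y g y)%E = (Num.sqrt pi ^+ n)%:E := integral_gaussrv n.
have mFQ : measurable_fun setT (fun y => F (y *m Q)).
  by apply: (measurableT_comp mF); exact: measurable_mulrV.
have Ipos : 0 < Num.sqrt (pi : R) ^+ n by rewrite exprn_gt0// sqrtr_gt0 pi_gt0.
suff : ((\int[leb n]_y F (y *m Q)) * (Num.sqrt pi ^+ n)%:E
        = (\int[leb n]_y F y) * (Num.sqrt pi ^+ n)%:E)%E.
  move=> /(congr1 (fun z => (z * ((Num.sqrt pi ^+ n)^-1)%:E)%E)).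
  by rewrite -!muleA -!EFinM divff ?gt_eqF// !mule1.
have mFg2 : measurable_fun setT
    (fun p : 'rV[R]_n * 'rV[R]_n => F (p.1 *m Q + p.2)%R * g p.2)%E.
  apply: emeasurable_funM; last exact: (measurableT_comp mg).
  apply: (measurableT_comp mF); apply: measurable_addrV => //.
  exact: measurable_mulrV.
have mFg3 : measurable_fun setT
    (fun p : 'rV[R]_n * 'rV[R]_n => F p.2 * g (p.2 - p.1 *m Q)%R)%E.
  apply: emeasurable_funM; first exact: (measurableT_comp mF).
  apply: (measurableT_comp mg); apply: measurable_addrV => //.
  under eq_fun do rewrite -scaleN1r.
  by apply: measurable_scalerV; exact: measurable_mulrV.
transitivity (\int[leb n]_y \int[leb n]_x (F (x *m Q + y)%R * g y))%E.
  rewrite -Ig -ge0_integralZl//; last exact: integral_ge0.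
  apply: eq_integral => y _; rewrite ge0_integralZr//; last first.
    by apply: (measurableT_comp mF); apply: measurable_addrV => //; exact: measurable_mulrV.
  congr (_ * _)%E; rewrite -(leb_shift (y *m Q^T) mFQ)//.
  by apply: eq_integral => x _; rewrite mulmxDl -mulmxA (oQ : Q^T *m Q = _) mulmx1.
transitivity (\int[leb n]_x \int[leb n]_y (F (x *m Q + y)%R * g y))%E.
  apply/esym; apply: (fubini_tonelli
    (fun p : 'rV[R]_n * 'rV[R]_n => F (p.1 *m Q + p.2)%R * g p.2)%E) => //.
  by move=> x; rewrite mule_ge0.
transitivity (\int[leb n]_x \int[leb n]_y (F y * g (y - x *m Q)%R))%E.
  apply: eq_integral => x _.
  have mh : measurable_fun setT (fun y => F y * g (y - x *m Q)%R)%E.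
    apply: emeasurable_funM => //; apply: (measurableT_comp mg).
    exact: measurable_addrV.
  have h0 y : (0 <= F y * g (y - x *m Q)%R)%E by rewrite mule_ge0.
  apply: eq_trans (leb_shift (x *m Q) mh h0).
  by apply: eq_integral => y _; rewrite addrK addrC.
transitivity (\int[leb n]_y \int[leb n]_x (F y * g (y - x *m Q)%R))%E.
  apply: (fubini_tonelli
    (fun p : 'rV[R]_n * 'rV[R]_n => F p.2 * g (p.2 - p.1 *m Q)%R)%E) => //.
  by move=> x; rewrite mule_ge0.
rewrite -Ig -ge0_integralZr//; last exact: integral_ge0.
apply: eq_integral => y _.
rewrite ge0_integralZl; [|exact: measurableT| |by move=> x _; exact: g0|exact: F0]; last first.
  apply: (measurableT_comp mg); apply: measurable_addrV => //.
  under eq_fun do rewrite -scaleN1r.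
  by apply: measurable_scalerV; exact: measurable_mulrV.
(* Orthogonality turns [g (y - x Q)] into [g (x - y Q^T)], a translate of [g] in the variable [x],
   so the inner integral is the total mass of [g]. *)
congr (_ * _)%E; apply: eq_trans (leb_shift (- (y *m Q^T)) mg g0).
apply: eq_integral => x _; rewrite /g; congr EFin; rewrite /gaussrv.
congr (expR (- _)); rewrite -(sumsq_orth (x - y *m Q^T) oQ).
apply: eq_bigr => i _; rewrite mulmxBl -mulmxA (oQ : Q^T *m Q = _) mulmx1.
by rewrite -sqrrN !mxE opprB.
Qed.

End invariance.

(** * Radial integrals *)

Definition ind (R : realType) (b : bool) : R := b%:R.

Lemma ind_ge0 (R : realType) b : 0 <= ind R b.
Proof. exact: ler0n. Qed.

Lemma eind_ge0 (R : realType) b : (0 <= (ind R b)%:E)%E.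
Proof. by rewrite lee_fin ind_ge0. Qed.

#[global] Hint Resolve ind_ge0 eind_ge0 : core.

Section enorm_theory.
Context {R : realType}.

Lemma enorm_ge0 n (y : 'rV[R]_n) : 0 <= enorm y.
Proof. exact: sqrtr_ge0. Qed.

Lemma sumsq_ge0 n (y : 'rV[R]_n) : 0 <= \sum_i y 0 i ^+ 2.
Proof. by apply: sumr_ge0 => i _; exact: sqr_ge0. Qed.

Lemma enorm_sqr n (y : 'rV[R]_n) : enorm y ^+ 2 = \sum_i y 0 i ^+ 2.
Proof. by rewrite sqr_sqrtr// sumsq_ge0. Qed.

Lemma enormZ n (a : R) (y : 'rV[R]_n) : 0 <= a -> enorm (a *: y) = a * enorm y.
Proof.
move=> a0; rewrite /enorm; under eq_bigr do rewrite mxE exprMn.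
by rewrite -mulr_sumr sqrtrM ?sqr_ge0// sqrtr_sqr ger0_norm.
Qed.

Lemma enormN n (y : 'rV[R]_n) : enorm (- y) = enorm y.
Proof. by rewrite /enorm; under eq_bigr do rewrite mxE sqrrN. Qed.

Lemma enorm_orth n (Q : 'M[R]_n) (y : 'rV[R]_n) : orthogonal_mx Q ->
  enorm (y *m Q) = enorm y.
Proof. by move=> oQ; rewrite /enorm sumsq_orth. Qed.

Lemma coord_le_enorm n (y : 'rV[R]_n) i : `|y 0 i| <= enorm y.
Proof.
rewrite -sqrtr_sqr ler_wsqrtr//.
by rewrite (bigD1 i)//= lerDl sumr_ge0// => j _; exact: sqr_ge0.
Qed.

Lemma measurable_enorm n : measurable_fun setT (@enorm R n).
Proof.
apply: (measurableT_comp (f := @Num.sqrt R)); last exact: measurable_sumsq.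
by apply: continuous_measurable_fun; exact: sqrt_continuous.
Qed.

Lemma measurable_boolR d (T : measurableType d) (p : T -> bool) :
  measurable_fun setT p -> measurable_fun setT (fun x => ind R (p x)).
Proof. by move=> mp; apply: (measurableT_comp (f := ind R)). Qed.

End enorm_theory.

Section balls.
Context {R : realType}.

Lemma le_pow_diff (n : nat) (b : R) : 0 <= b -> exists2 K, 0 <= K &
  forall u v, 0 <= u -> u <= v -> v <= b -> v ^+ n - u ^+ n <= K * (v - u).
Proof.
move=> b0; elim: n => [|n [K K0 IH]].
  by exists 0 => // u v *; rewrite subrr mul0r.
exists (b * K + b ^+ n) => [|u v u0 uv vb].
  by rewrite addr_ge0// ?mulr_ge0// exprn_ge0.
have -> : v ^+ n.+1 - u ^+ n.+1 = v * (v ^+ n - u ^+ n) + u ^+ n * (v - u).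
  by rewrite !exprS; ring.
have v0 : 0 <= v by exact: le_trans uv.
rewrite mulrDl lerD//.
  apply: (le_trans (ler_wpM2l v0 (IH _ _ u0 uv vb))).
  by rewrite -mulrA ler_wpM2r// mulr_ge0// subr_ge0.
rewrite ler_wpM2r ?subr_ge0//.
by rewrite lerXn2r ?nnegrE// (le_trans uv vb).
Qed.

(** Cut [[a, b]] into N+1 equal pieces. The increments of [h] telescope while each carries the step
    width, so the total variation of [D] is at most [C (h a - h b) (b - a) / (N+1)] for every N. *)
Lemma telescope_const (D h : R -> R) (a b C : R) : a <= b ->
  (forall u v, a <= u -> u <= v -> v <= b ->
    `|D v - D u| <= C * ((h u - h v) * (v - u))) -> D b = D a.
Proof.
move=> ab H; apply/eqP; rewrite -subr_eq0 -normr_le0 leNgt; apply/negP => pos.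
have HN (N : nat) : `|D b - D a| * N.+1%:R <= C * ((h a - h b) * (b - a)).
  pose w := (b - a) / N.+1%:R; pose t (i : nat) := a + w * i%:R.
  have N0 : (0 : R) < N.+1%:R by rewrite ltr0n.
  have w0 : 0 <= w by rewrite divr_ge0 ?subr_ge0// ltW.
  have tN : t N.+1 = b by rewrite /t /w divfK ?gt_eqF//; ring.
  have tS i : t i.+1 - t i = w by rewrite /t -natr1; ring.
  have ta i : a <= t i by rewrite /t lerDl mulr_ge0.
  have tb i : (i <= N.+1)%N -> t i <= b.
    by move=> iN; rewrite -tN /t lerD2l ler_wpM2l// ler_nat.
  have claim i : (i <= N.+1)%N -> `|D (t i) - D a| <= C * ((h a - h (t i)) * w).
    elim: i => [_|i IH iN].
      by rewrite /t mulr0 addr0 !subrr normr0 mul0r mulr0.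
    have -> : D (t i.+1) - D a = (D (t i.+1) - D (t i)) + (D (t i) - D a) by ring.
    apply: (le_trans (ler_normD _ _)).
    have := H (t i) (t i.+1) (ta i); rewrite -subr_ge0 tS => /(_ w0 (tb _ iN)).
    have := IH (ltnW iN); nra.
  have := claim _ (leqnn _); rewrite tN => /(ler_wpM2r (ltW N0)).
  by move/le_trans; apply; rewrite /w le_eqVlt; apply/orP; left; apply/eqP; field; rewrite gt_eqF.
have [/archi_boundP|] := lerP 0 (C * ((h a - h b) * (b - a)) / `|D b - D a|); last first.
  move=> neg; have := HN 0%N; rewrite mulr1 => /le_lt_trans/(_ _)/=.
  move: neg; rewrite pmulr_llt0 ?invr_gt0// => neg /(_ _ neg); by rewrite ltNge normr_ge0.
set N := Num.Def.archi_bound _; rewrite ltr_pdivrMr// => lt1.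
have := HN N; rewrite leNgt => /negP; apply; apply: (lt_le_trans lt1).
by rewrite mulrC ler_pM2l// ler_nat.
Qed.

Lemma bool_lt_split (x u v : R) : u <= v ->
  ind R (x < v) = ind R (x < u) + ind R (u <= x < v).
Proof.
rewrite /ind => uv; case: (ltP x u) => ux /=; last by rewrite add0r.
by rewrite addr0 (lt_le_trans ux uv).
Qed.

Lemma measurable_shell n (u v : R) :
  measurable_fun setT (fun y : 'rV[R]_n => ind R (u <= enorm y < v)).
Proof.
apply: measurable_boolR; apply: measurable_and.
  by apply: measurable_fun_ler => //; exact: measurable_enorm.
by apply: measurable_fun_ltr => //; exact: measurable_enorm.
Qed.

Lemma measurable_eball n (v : R) :
  measurable_fun setT (fun y : 'rV[R]_n => ind R (enorm y < v)).
Proof.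
by apply: measurable_boolR; apply: measurable_fun_ltr => //; exact: measurable_enorm.
Qed.

(** On the unit ball the Gaussian is at least [exp (-1)]. *)
Lemma unit_ball_lty n : (\int[leb n]_y (ind R (enorm (y : 'rV[R]_n) < 1))%:E < +oo)%E.
Proof.
apply: (@le_lt_trans _ _ (\int[leb n]_y ((expR 1)%:E * (gaussrv y)%:E))%E).
  apply: ge0_le_integral => //.
  - by apply/measurable_EFinP; exact: measurable_eball.
  - by apply/measurable_EFinP/measurable_funM => //; exact: measurable_gaussrv.
  - move=> y _; rewrite -EFinM lee_fin.
    case: ltP => [y1|_]; last by rewrite mulr_ge0// expR_ge0.
    have -> : ind R true = expR 0 by rewrite expR0.
    rewrite /gaussrv -expRD ler_expR -enorm_sqr.
    by rewrite subr_ge0 -(expr1n _ 2) lerXn2r ?nnegrE ?enorm_ge0 ?ltW.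
rewrite ge0_integralZl//.
- by rewrite integral_gaussrv -EFinM ltry.
- by apply/measurable_EFinP; exact: measurable_gaussrv.
- by move=> y _; rewrite lee_fin expR_ge0.
Qed.

Lemma omegaE n : (\int[leb n]_y (ind R (enorm (y : 'rV[R]_n) < 1))%:E = (omega R n)%:E)%E.
Proof.
have eqi : (fun y : 'rV[R]_n => (\1_[set z : 'rV[R]_n | enorm z < 1] y : R)%:E) =
    (fun y => (ind R (enorm y < 1))%:E).
  apply/funext => y; rewrite indicE /ind.
  by have -> : (y \in [set z | enorm z < 1]) = (enorm y < 1) by apply/idP/idP; rewrite inE.
rewrite /omega eqi iintE_ge0//; last by apply/measurable_EFinP; exact: measurable_eball.
rewrite fineK// ge0_fin_numE; first exact: unit_ball_lty.
exact: integral_ge0.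
Qed.

Lemma omega_ge0 n : 0 <= omega R n.
Proof. by rewrite -lee_fin -omegaE; exact: integral_ge0. Qed.

Lemma ball_vol n (v : R) : (0 < n)%N -> 0 <= v ->
  (\int[leb n]_y (ind R (enorm (y : 'rV[R]_n) < v))%:E = (omega R n * v ^+ n)%:E)%E.
Proof.
move=> n0; rewrite le_eqVlt => /predU1P[<-|v0].
  rewrite expr0n gtn_eqF// mulr0 (eq_integral (fun=> 0%E)) ?integral0//.
  by move=> y _; rewrite ltNge enorm_ge0.
rewrite (leb_scale v0)//; last by apply/measurable_EFinP; exact: measurable_eball.
rewrite mulrC EFinM; congr (_ * _)%E; rewrite -omegaE.
apply: eq_integral => y _; rewrite enormZ ?ltW//.
by rewrite -{2}(mulr1 v) ltr_pM2l.
Qed.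

Lemma shell_vol n (u v : R) : (0 < n)%N -> 0 <= u -> u <= v ->
  (\int[leb n]_y (ind R (u <= enorm (y : 'rV[R]_n) < v))%:E
   = (omega R n * (v ^+ n - u ^+ n))%:E)%E.
Proof.
move=> n0 u0 uv; have := ball_vol n0 (le_trans u0 uv).
under eq_integral do rewrite (bool_lt_split _ uv) EFinD.
rewrite ge0_integralD//; first last.
- by apply/measurable_EFinP; exact: measurable_shell.
- by apply/measurable_EFinP; exact: measurable_eball.
rewrite ball_vol// => /(congr1 (fun z => (- (omega R n * u ^+ n)%:E + z)%E)).
by rewrite addeA -EFinN -EFinD addNr add0e => ->; rewrite -EFinD; congr EFin; ring.
Qed.

Lemma is_derive_pow n (r : R) :
  is_derive r 1 (fun t : R => t ^+ n) (n%:R * r ^+ n.-1).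
Proof.
apply: DeriveDef; first exact: exprn_derivable.
by rewrite exp_derive /GRing.scale /= mulr1.
Qed.

(** The mean value theorem for [W t - c t^n], with [c] taken to be [h v] and then [h u]:
    monotonicity of [h] fixes the sign of the derivative. *)
Lemma derive_bounds n (W h : R -> R) (a b : R) : 0 <= a ->
  (forall u v, a <= u -> u <= v -> v <= b -> h v <= h u) ->
  (forall r, a <= r -> r <= b -> is_derive r 1 W (n%:R * r ^+ n.-1 * h r)) ->
  forall u v, a <= u -> u <= v -> v <= b ->
  h v * (v ^+ n - u ^+ n) <= W v - W u <= h u * (v ^+ n - u ^+ n).
Proof.
move=> a0 hmon dW u v au uv vb.
have key c : exists2 r, u <= r <= v & (W v - c * v ^+ n) - (W u - c * u ^+ n) =
    n%:R * r ^+ n.-1 * (h r - c) * (v - u).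
  have dr r : u <= r -> r <= v ->
      is_derive r 1 (fun t => W t - c * t ^+ n) (n%:R * r ^+ n.-1 * (h r - c)).
    move=> ur rv; have dWr := dW r (le_trans au ur) (le_trans rv vb).
    have -> : n%:R * r ^+ n.-1 * (h r - c) =
      n%:R * r ^+ n.-1 * h r - c * (n%:R * r ^+ n.-1) by ring.
    apply: is_deriveB; apply: is_deriveZ.
    exact: is_derive_pow.
  have [] := @MVT_segment R (fun t => W t - c * t ^+ n)
     (fun r => n%:R * r ^+ n.-1 * (h r - c)) u v uv.
  - by move=> r; rewrite in_itv /= => /andP[ur rv]; apply: dr; exact: ltW.
  - apply: derivable_within_continuous => r; rewrite in_itv /= => /andP[ur rv].
    by have [] := dr r ur rv.
  - by move=> r; rewrite in_itv /= => ruv rE; exists r.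
have pos r : u <= r -> 0 <= n%:R * r ^+ n.-1 * (v - u).
  move=> ur; rewrite mulr_ge0 ?subr_ge0// mulr_ge0 ?ler0n// exprn_ge0//.
  by rewrite (le_trans a0)// (le_trans au).
apply/andP; split.
- have [r /andP[ur rv] E] := key (h v).
  have : 0 <= h r - h v by rewrite subr_ge0 hmon// (le_trans au).
  move/(mulr_ge0 (pos _ ur)); move: E; nra.
- have [r /andP[ur rv] E] := key (h u).
  have : 0 <= h u - h r by rewrite subr_ge0 hmon// (le_trans rv).
  move/(mulr_ge0 (pos _ ur)); move: E; nra.
Qed.

(** Integration in polar coordinates without a surface measure. On a thin shell both the integral
    and [omega (W v - W u)] lie between the volume of the shell times [h v] and times [h u]. Their
    difference is thus at most a constant times [(h u - h v) (v - u)], and [telescope_const] removes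
    it. *)
Lemma radial_integral n (W h : R -> R) (a b : R) : (0 < n)%N -> 0 <= a -> a <= b ->
  (forall u v, a <= u -> u <= v -> v <= b -> h v <= h u) ->
  (forall u, a <= u -> u <= b -> 0 <= h u) -> measurable_fun setT h ->
  (forall r, a <= r -> r <= b -> is_derive r 1 W (n%:R * r ^+ n.-1 * h r)) ->
  (\int[leb n]_y (ind R (a <= enorm (y : 'rV[R]_n) < b) * h (enorm y))%:E
   = (omega R n * (W b - W a))%:E)%E.
Proof.
move=> n0 a0 ab hmon h0 mh dW.
pose F u v := (\int[leb n]_y (ind R (u <= enorm (y : 'rV[R]_n) < v) * h (enorm y))%:E)%E.
have mF u v : measurable_fun setT
    (fun y : 'rV[R]_n => (ind R (u <= enorm y < v) * h (enorm y))%:E).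
  apply/measurable_EFinP/measurable_funM; first exact: measurable_shell.
  by apply: (measurableT_comp mh); exact: measurable_enorm.
have F0 u v : a <= u -> v <= b -> forall y : 'rV[R]_n,
    (0 <= (ind R (u <= enorm y < v) * h (enorm y))%:E)%E.
  move=> au vb y; rewrite lee_fin /ind; case: andP => [[uy yv]|_]; last by rewrite mul0r.
  by rewrite mul1r h0// ?(le_trans au)// (le_trans (ltW yv)).
have Fb u v : a <= u -> u <= v -> v <= b ->
    ((h v * (omega R n * (v ^+ n - u ^+ n)))%:E <= F u v)%E /\
    (F u v <= (h u * (omega R n * (v ^+ n - u ^+ n)))%:E)%E.
  move=> au uv vb; have hv0 := h0 _ (le_trans au uv) vb.
  have hu0 := h0 _ au (le_trans uv vb).
  rewrite !(EFinM (h _)) -!(shell_vol n0 (le_trans a0 au) uv).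
  have ms : measurable_fun setT
      (fun y : 'rV[R]_n => (ind R (u <= enorm y < v))%:E).
    by apply/measurable_EFinP; exact: measurable_shell.
  rewrite -!ge0_integralZl//; split; apply: ge0_le_integral => //.
  - by move=> y _; rewrite -EFinM lee_fin mulr_ge0.
  - by apply: emeasurable_funM.
  - move=> y _; rewrite -EFinM lee_fin mulrC /ind; case: andP => [[uy yv]|_].
      by rewrite !mul1r; apply: hmon => //; [exact: le_trans uy|exact: ltW].
    by rewrite !mul0r.
  - by move=> y _; exact: F0.
  - by apply: emeasurable_funM.
  - move=> y _; rewrite -EFinM lee_fin mulrC /ind; case: andP => [[uy yv]|_].
      by rewrite !mulr1; apply: hmon => //; exact: le_trans (ltW yv) vb.
    by rewrite !mulr0.
have Ffin u v : a <= u -> u <= v -> v <= b -> F u v \is a fin_num.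
  move=> au uv vb; rewrite ge0_fin_numE; last by apply: integral_ge0 => y _; exact: F0.
  by have [_] := Fb _ _ au uv vb; move=> /le_lt_trans; apply; rewrite ltry.
have Fadd u v : a <= u -> u <= v -> v <= b -> F a v = (F a u + F u v)%E.
  move=> au uv vb; rewrite /F -ge0_integralD//; first last.
  - by move=> y _; exact: F0.
  - by move=> y _; apply: F0 => //; exact: le_trans vb.
  apply: eq_integral => y _; rewrite -EFinD -mulrDl; congr (_ * _)%:E.
  rewrite /ind; case: (leP a (enorm y)) => ay /=; last first.
    by rewrite leNgt (lt_le_trans ay au)/= addr0.
  exact: bool_lt_split.
have [K K0 HK] := le_pow_diff n (le_trans a0 ab).
pose f v := fine (F a v).
have dWb := derive_bounds a0 hmon dW.
have E : f b - omega R n * W b = f a - omega R n * W a.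
  apply: (@telescope_const (fun v => f v - omega R n * W v) h a b (omega R n * K) ab).
  move=> u v au uv vb.
  have /andP[W1 W2] := dWb u v au uv vb.
  have [] := Fb u v au uv vb.
  rewrite -(fineK (Ffin _ _ au uv vb)) !lee_fin => F1 F2.
  have fE : f v = f u + fine (F u v).
    by rewrite /f (Fadd u v)// fineD// Ffin// (le_trans uv).
  have hh : 0 <= h u - h v by rewrite subr_ge0 hmon.
  have vu := HK u v (le_trans a0 au) uv vb.
  have o0 := omega_ge0 n.
  have : (h u - h v) * (omega R n * (v ^+ n - u ^+ n)) <=
     omega R n * K * ((h u - h v) * (v - u)).
    have -> : omega R n * K * ((h u - h v) * (v - u)) =
      (h u - h v) * (omega R n * (K * (v - u))) by ring.
    by rewrite ler_wpM2l// ler_wpM2l.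
  move: W1 W2 => /(ler_wpM2l o0) W1 /(ler_wpM2l o0) W2 B.
  rewrite ler_norml fE; apply/andP; split; nra.
rewrite -/(F a b) -(fineK (Ffin a b (lexx _) ab (lexx _))); congr EFin.
have fa : f a = 0.
  have [] := Fb a a (lexx _) (lexx _) ab.
  rewrite !subrr !mulr0 => A B; rewrite /f.
  by have -> : F a a = 0%E by apply/eqP; rewrite eq_le A B.
by move: E; rewrite fa /f; lra.
Qed.

End balls.

(** * The truncated kernel and its second moment *)

Section kernel.
Context {R : realType}.

Lemma powRN_le (p u v : R) : 0 <= p -> 0 < u -> u <= v -> v `^ (- p) <= u `^ (- p).
Proof.
move=> p0 u0 uv; have v0 := lt_le_trans u0 uv.
rewrite !powRN lef_pV2 ?posrE ?powR_gt0//.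
by rewrite ge0_ler_powR// nnegrE ltW.
Qed.

Lemma kkerE d (s r t : R) : kker d s r t = (Num.max t r) `^ (- (d%:R + s)).
Proof. by rewrite /kker; case: leP. Qed.

Lemma kker_ge0 d (s r t : R) : 0 <= kker d s r t.
Proof. by rewrite kkerE powR_ge0. Qed.

Lemma kker_le d (s r t u : R) : 0 <= s -> 0 < r -> t <= u -> kker d s r u <= kker d s r t.
Proof.
move=> s0 r0 tu; rewrite !kkerE powRN_le//.
- by rewrite addr_ge0.
- by rewrite lt_max r0 orbT.
- by rewrite ge_max !le_max tu lexx orbT.
Qed.

(** Truncation only helps, since [max (l t) r <= l max t r]. The bound controls the loss when [|y|]
    is replaced by [|y'|] on a strip where [|y| <= l |y'|]. *)
Lemma kker_scale d (s r t l : R) : 0 <= s -> 0 < r -> 0 <= t -> 1 <= l ->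
  l `^ (- (d%:R + s)) * kker d s r t <= kker d s r (l * t).
Proof.
move=> s0 r0 t0 l1; have l0 := lt_le_trans ltr01 l1; rewrite !kkerE -powRM; first last.
- by rewrite le_max (ltW r0) orbT.
- exact: ltW.
apply: powRN_le; first by rewrite addr_ge0.
  by rewrite lt_max r0 orbT.
rewrite ge_max; apply/andP; split; first by rewrite ler_wpM2l ?(ltW l0)// le_max lexx.
rewrite -[leLHS]mul1r; apply: ler_pM => //; first exact: ltW.
by rewrite le_max lexx orbT.
Qed.

Lemma kker_outer d (s r t : R) : r <= t -> kker d s r t = t `^ (- (d%:R + s)).
Proof. by move=> rt; rewrite kkerE; congr (_ `^ _); exact/max_idPl. Qed.

Lemma kker_inner d (s r t : R) : t <= r -> kker d s r t = r `^ (- (d%:R + s)).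
Proof. by rewrite /kker => ->. Qed.

Lemma measurable_kker d (s r : R) : measurable_fun setT (kker d s r).
Proof.
rewrite (_ : kker d s r = (@powR R ^~ (- (d%:R + s))) \o (fun t => Num.max t r)).
  apply: (measurableT_comp (f := @powR R ^~ (- (d%:R + s)))) => //.
  by apply: measurable_maxr.
by apply/funext => t /=; rewrite kkerE.
Qed.

Lemma measurable_kker_enorm n d (s r : R) :
  measurable_fun setT (fun y : 'rV[R]_n => kker d s r (enorm y)).
Proof.
by apply: (measurableT_comp (measurable_kker d s r)); exact: measurable_enorm.
Qed.

(** [radial_integral] wants a decreasing profile, so it is applied to [r^2 - t^2] and the result is
    subtracted from [r^2] times the volume of the ball. *)
Lemma second_moment_ball n (r : R) : (0 < n)%N -> 0 <= r ->
  (\int[leb n]_y (ind R (enorm (y : 'rV[R]_n) < r) * enorm y ^+ 2)%:E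
   = (omega R n * (n%:R / n.+2%:R * r ^+ n.+2))%:E)%E.
Proof.
move=> n0 r0.
pose W (t : R) := r ^+ 2 * t ^+ n - n%:R / n.+2%:R * t ^+ n.+2.
have A : (\int[leb n]_y (ind R (0 <= enorm (y : 'rV[R]_n) < r) * (r ^+ 2 - enorm y ^+ 2))%:E
   = (omega R n * (W r - W 0))%:E)%E.
  apply: (radial_integral (h := fun t => r ^+ 2 - t ^+ 2)) => //.
  - by move=> u v u0 uv vr; rewrite lerD2l lerN2 lerXn2r// nnegrE// (le_trans u0).
  - by move=> u u0 ur; rewrite subr_ge0 lerXn2r// nnegrE.
  - by apply: measurable_funB => //; exact: measurable_funX.
  - move=> t t0 tr.
    have -> : n%:R * t ^+ n.-1 * (r ^+ 2 - t ^+ 2) =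
        r ^+ 2 * (n%:R * t ^+ n.-1) - n%:R / n.+2%:R * (n.+2%:R * t ^+ n.+1).
      rewrite [n%:R / _ * _]mulrA divfK ?pnatr_eq0//; case: n n0 {W} => // m _ /=.
      by rewrite !exprS; ring.
    by apply: is_deriveB; apply: is_deriveZ; exact: is_derive_pow.
have mb := @measurable_eball R n r.
have ms : measurable_fun setT (fun y : 'rV[R]_n => enorm y ^+ 2).
  by apply: measurable_funX; exact: measurable_enorm.
have V := ball_vol n0 r0.
have : (\int[leb n]_y (ind R (enorm (y : 'rV[R]_n) < r) * enorm y ^+ 2)%:E +
  \int[leb n]_y (ind R (0 <= enorm (y : 'rV[R]_n) < r) * (r ^+ 2 - enorm y ^+ 2))%:E
  = (r ^+ 2)%:E * (omega R n * r ^+ n)%:E)%E.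
  rewrite -V -ge0_integralZl//; first last.
  - by rewrite lee_fin sqr_ge0.
  - exact/measurable_EFinP.
  rewrite -ge0_integralD//; first last.
  - apply/measurable_EFinP/measurable_funM; first exact: measurable_shell.
    exact: measurable_funB.
  - move=> y _; rewrite lee_fin /ind enorm_ge0/=; case: ltP => yr; rewrite ?mul0r//.
    by rewrite mul1r subr_ge0 lerXn2r// ?nnegrE ?enorm_ge0// ltW.
  - by apply/measurable_EFinP/measurable_funM.
  - by move=> y _; rewrite lee_fin mulr_ge0// sqr_ge0.
  by apply: eq_integral => y _; rewrite -EFinD enorm_ge0/= -EFinM; congr EFin; ring.
rewrite A => /(congr1 (fun z => (z - (omega R n * (W r - W 0))%:E)%E)).
rewrite addeK// => ->; rewrite -EFinM -EFinB; congr EFin.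
rewrite /W !expr0n gtn_eqF//= !mulr0 subr0 !exprS.
by field; rewrite -natr1 -natr1 -?addrA; apply: lt0r_neq0; rewrite ltr_wpDl.
Qed.

Lemma integral_annulus n (s r b : R) : (0 < n)%N -> 1 <= s -> 0 < r -> r <= b ->
  (\int[leb n]_y (ind R (r <= enorm (y : 'rV[R]_n) < b) * enorm y `^ (1 - n%:R - s))%:E
   = (omega R n * (n%:R * (if s == 1 then ln b - ln r
       else (r `^ (1 - s) - b `^ (1 - s)) / (s - 1))))%:E)%E.
Proof.
move=> n0 s1 r0 rb.
pose W (t : R) := n%:R * (if s == 1 then ln t else t `^ (1 - s) / (1 - s)).
have n1 : (1 : R) <= n%:R by rewrite ler1n.
have -> : n%:R * (if s == 1 then ln b - ln r
       else (r `^ (1 - s) - b `^ (1 - s)) / (s - 1)) = W b - W r.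
  rewrite /W; case: eqP => [_|/eqP s1']; first by ring.
  by field; apply/andP; split; rewrite subr_eq0// eq_sym.
apply: (radial_integral (h := fun t => t `^ (1 - n%:R - s))) => //.
- exact: ltW.
- move=> u v ru uv vb.
  have -> : 1 - n%:R - s = - (n%:R + s - 1) by ring.
  by apply: powRN_le => //; lra.
- by move=> u _ _; exact: powR_ge0.
move=> t rt tb; have t0 : 0 < t := lt_le_trans r0 rt.
have -> : n%:R * t ^+ n.-1 * t `^ (1 - n%:R - s) = n%:R * t `^ (- s).
  rewrite -mulrA -powR_mulrn ?ltW// -powRD; last by apply/implyP => _; rewrite gt_eqF.
  by rewrite -subn1 natrB//; congr (_ * _ `^ _); ring.
apply: is_deriveZ; case: eqP => [->|/eqP s1'].
  by rewrite powRN powRr1 ?ltW//; exact: is_derive1_ln.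
have -> : t `^ (- s) = (1 - s)^-1 *: ((1 - s) * t `^ (1 - s - 1)).
  rewrite /GRing.scale/= mulKf; first by congr (_ `^ _); ring.
  by rewrite subr_eq0 eq_sym.
rewrite (_ : (fun t => _) = (1 - s)^-1 \*: (@powR R ^~ (1 - s))).
  by apply: is_deriveZ; exact: is_derive1_powR.
by apply/funext => z /=; rewrite mulrC.
Qed.

(** With d = n+1, this is where the factor [(d + s) / (d + 1)] of [sigma] comes from. For s > 1 the
    ball of radius [r] contributes [r^(1-s) / (n+2)] and the annulus [r^(1-s) / (s-1)], up to the
    common factor [n omega], and the two fractions add up to it. *)
Lemma moment_sigma n (s b : R) : (0 < n)%N -> 1 <= s -> 0 < b ->
  exists c : R, forall r, 0 < r -> r < b -> r < 1 ->
  (\int[leb n]_y (ind R (enorm (y : 'rV[R]_n) < b) *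
      (enorm y ^+ 2 * kker n.+1 s r (enorm y)))%:E
   = (n%:R * omega R n * (sigma n.+1 s r + c))%:E)%E.
Proof.
move=> n0 s1 b0.
(* The part independent of [r]: the outer endpoint of the annulus and, for s = 1, also the whole
   contribution of the inner ball. *)
exists (if s == 1 then n.+2%:R^-1 + ln b else - b `^ (1 - s) / (s - 1)) => r r0 rb r1.
have mk := @measurable_kker_enorm n n.+1 s r.
have ms : measurable_fun setT (fun y : 'rV[R]_n => enorm y ^+ 2).
  by apply: measurable_funX; exact: measurable_enorm.
transitivity ((r `^ (- (n.+1%:R + s)))%:E *
    \int[leb n]_y (ind R (enorm (y : 'rV[R]_n) < r) * enorm y ^+ 2)%:E +
    \int[leb n]_y (ind R (r <= enorm (y : 'rV[R]_n) < b) * enorm y `^ (1 - n%:R - s))%:E)%E.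
  rewrite -ge0_integralZl//; first last.
  - by rewrite lee_fin powR_ge0.
  - by move=> y _; rewrite lee_fin mulr_ge0// sqr_ge0.
  - by apply/measurable_EFinP/measurable_funM => //; exact: measurable_eball.
  rewrite -ge0_integralD//; first last.
  - apply/measurable_EFinP/measurable_funM; first exact: measurable_shell.
    by apply: (measurableT_comp (measurable_powR _)); exact: measurable_enorm.
  - by move=> y _; rewrite lee_fin mulr_ge0// powR_ge0.
  - apply: emeasurable_funM => //.
    by apply/measurable_EFinP/measurable_funM => //; exact: measurable_eball.
  - by move=> y _; rewrite -EFinM lee_fin mulr_ge0 ?powR_ge0// mulr_ge0// sqr_ge0.
  apply: eq_integral => y _; rewrite -EFinM -EFinD; congr EFin.
  rewrite (bool_lt_split _ (ltW rb)) /ind; case: (ltP (enorm y) r) => yr /=.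
    by rewrite !mul1r !mul0r kker_inner ?ltW//; ring.
  rewrite mul0r mulr0 !add0r kker_outer//; congr (_ * _).
  have y0 := lt_le_trans r0 yr.
  rewrite -powR_mulrn ?ltW// -powRD; last by apply/implyP => _; rewrite gt_eqF.
  by congr (_ `^ _); rewrite -natr1; ring.
rewrite (second_moment_ball n0 (ltW r0)) (integral_annulus n0 s1 r0 (ltW rb)).
rewrite -EFinM -EFinD; congr EFin.
have -> : r `^ (- (n.+1%:R + s)) * (omega R n * (n%:R / n.+2%:R * r ^+ n.+2)) =
    omega R n * (n%:R / n.+2%:R * r `^ (1 - s)).
  have -> : r `^ (1 - s) = r `^ (- (n.+1%:R + s)) * r ^+ n.+2.
    rewrite -powR_mulrn ?ltW// -powRD; last by apply/implyP => _; rewrite gt_eqF.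
    by congr (_ `^ _); rewrite -!natr1; ring.
  by ring.
have n20 : n.+2%:R != 0 :> R by rewrite pnatr_eq0.
rewrite /sigma; case: eqP => [->|/eqP s1'].
  rewrite subrr powRr0 ltr0_norm ?ln_lt0 ?r0//.
  by field.
have n2E : (n.+2%:R : R) = n.+1%:R + 1 by rewrite natr1.
have n2E' : (n.+2%:R : R) = n%:R + 2 by rewrite -!natr1; ring.
have n1E : (n.+1%:R : R) = n%:R + 1 by rewrite natr1.
rewrite -n2E n1E n2E'.
field; rewrite -n2E' n20 subr_eq0 s1'//.
Qed.

End kernel.

(** * Tails of the kernel and quadratic moments *)

Section tail.
Context {R : realType}.

(** Beyond [b > r] the kernel is the pure power, so the bound does not depend on [r]. The primitive
    [-(d/s) t^(-s)] bounds the integrals over the shells from [b] to [b + k] uniformly in k, and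
    monotone convergence passes to the exterior. *)
Lemma tail_bound d (s b : R) : (0 < d)%N -> 1 <= s -> 0 < b ->
  exists2 C : R, 0 <= C & forall r, 0 < r -> r < b ->
  (\int[leb d]_y (ind R (b <= enorm (y : 'rV[R]_d)) * kker d s r (enorm y))%:E <= C%:E)%E.
Proof.
move=> d0 s1 b0; have s0 : 0 < s := lt_le_trans ltr01 s1.
pose h (t : R) := t `^ (- (d%:R + s)).
pose C := omega R d * (d%:R / s * b `^ (- s)).
have C0 : 0 <= C.
  by rewrite mulr_ge0 ?omega_ge0// mulr_ge0 ?powR_ge0// divr_ge0// ltW.
exists C => // r r0 rb.
pose g (k : nat) (y : 'rV[R]_d) := (ind R (b <= enorm y < b + k%:R) * h (enorm y))%:E.
have bk (k : nat) : b <= b + k%:R by rewrite lerDl.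
have Ig k : (\int[leb d]_y g k y <= C%:E)%E.
  pose W (t : R) := - (d%:R / s) * t `^ (- s).
  have -> : (\int[leb d]_y g k y = (omega R d * (W (b + k%:R) - W b))%:E)%E.
    apply: (radial_integral (h := h) d0).
    - exact: ltW.
    - by rewrite lerDl.
    - by move=> u v bu uv _; apply: powRN_le => //; [rewrite addr_ge0// ltW|exact: lt_le_trans bu].
    - by move=> u _ _; exact: powR_ge0.
    - exact: (measurable_powR (- (d%:R + s))).
    - move=> t bt _; have t0 := lt_le_trans b0 bt.
      have -> : d%:R * t ^+ d.-1 * h t = (- (d%:R / s)) *: (- s * t `^ (- s - 1)).
        rewrite /GRing.scale/= mulrA mulrN -mulNr opprK divfK ?gt_eqF// -mulrA; congr (_ * _).
        rewrite -powR_mulrn ?ltW// -powRD; last by apply/implyP => _; rewrite gt_eqF.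
        by rewrite -subn1 natrB//; congr (_ `^ _); ring.
      by apply: is_deriveZ; exact: is_derive1_powR.
  rewrite lee_fin ler_wpM2l ?omega_ge0// /W mulNr mulNr opprK addrC gerBl.
  by rewrite mulr_ge0 ?powR_ge0// divr_ge0// ltW.
have mg k : measurable_fun setT (g k).
  apply/measurable_EFinP/measurable_funM; first exact: measurable_shell.
  by apply: (measurableT_comp (measurable_powR _)); exact: measurable_enorm.
have g0 k y : (0 <= g k y)%E by rewrite lee_fin mulr_ge0// powR_ge0.
have gnd y : {homo g^~ y : n m / (n <= m)%N >-> (n <= m)%E}.
  move=> k m km; rewrite /g lee_fin ler_wpM2r ?powR_ge0// /ind.
  case: (leP b (enorm y)) => //= by'; case: (ltP (enorm y)) => //= yk.
  by rewrite (lt_le_trans yk)// lerD2l ler_nat.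
have := @cvg_monotone_convergence _ _ _ (leb d) setT measurableT g mg
  (fun k y _ => g0 k y) (fun y _ => gnd y).
rewrite (_ : (fun y => limn _) =
  fun y => (ind R (b <= enorm y) * kker d s r (enorm y))%:E); last first.
  apply/funext => y; apply: lim_near_cst => //=.
  have [N _ HN] : \forall k \near \oo, enorm y - b < k%:R.
    exact: nbhs_infty_gtr.
  exists N => // k /HN /= yk; rewrite /g /ind.
  case: (leP b (enorm y)) => by'; last by rewrite !mul0r.
  rewrite kker_outer ?(le_trans (ltW rb))//.
  by rewrite -ltrBlDl yk.
move=> cv; rewrite -(cvg_lim _ cv)//; apply: lime_le; first by apply/cvg_ex; eexists; exact: cv.
by apply: nearW => k; exact: Ig.
Qed.

Lemma kker_lty d (s r : R) : (0 < d)%N -> 1 <= s -> 0 < r ->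
  (\int[leb d]_y (kker d s r (enorm (y : 'rV[R]_d)))%:E < +oo)%E.
Proof.
move=> d0 s1 r0; have b0 : 0 < r + 1 by rewrite addr_gt0.
have rb : r < r + 1 by rewrite ltrDl.
have [C C0 HC] := tail_bound d0 s1 b0.
apply: (@le_lt_trans _ _ (\int[leb d]_y ((r `^ (- (d%:R + s)))%:E *
    (ind R (enorm (y : 'rV[R]_d) < r + 1))%:E) +
  \int[leb d]_y (ind R (r + 1 <= enorm (y : 'rV[R]_d)) * kker d s r (enorm y))%:E)%E).
  rewrite -ge0_integralD//; first last.
  - apply/measurable_EFinP/measurable_funM; last exact: measurable_kker_enorm.
    by apply: measurable_boolR; apply: measurable_fun_ler => //; exact: measurable_enorm.
  - by move=> y _; rewrite lee_fin mulr_ge0// kker_ge0.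
  - by apply: emeasurable_funM => //; apply/measurable_EFinP; exact: measurable_eball.
  - by move=> y _; rewrite -EFinM lee_fin mulr_ge0// powR_ge0.
  apply: ge0_le_integral => //.
  - by move=> y _; rewrite lee_fin kker_ge0.
  - by apply/measurable_EFinP; exact: measurable_kker_enorm.
  - apply: emeasurable_funD.
      by apply: emeasurable_funM => //; apply/measurable_EFinP; exact: measurable_eball.
    apply/measurable_EFinP/measurable_funM; last exact: measurable_kker_enorm.
    by apply: measurable_boolR; apply: measurable_fun_ler => //; exact: measurable_enorm.
  - move=> y _; rewrite -EFinM -EFinD lee_fin /ind; case: ltP => yr /=.
      rewrite mulr1 mul0r addr0 kkerE; apply: powRN_le => //.
        by rewrite addr_ge0// (le_trans _ s1).
      by rewrite le_max lexx orbT.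
    by rewrite mulr0 mul1r add0r.
rewrite ge0_integralZl//; first last.
- by rewrite lee_fin powR_ge0.
- by apply/measurable_EFinP; exact: measurable_eball.
rewrite ball_vol ?ltW// -EFinM; apply: (@le_lt_trans _ _ (_%:E + C%:E)%E).
  by apply: leeD; [exact: lexx|exact: HC].
by rewrite -EFinD ltry.
Qed.

End tail.

Section quadratic.
Context {R : realType}.

Definition qform n (B : 'M[R]_n) (y : 'rV[R]_n) : R :=
  \sum_i \sum_j B i j * (y 0 i * y 0 j).

Lemma integral_orth n (Q : 'M[R]_n) (f : 'rV[R]_n -> R) : orthogonal_mx Q ->
  (leb n).-integrable setT (EFin \o f) ->
  (\int[leb n]_y (f (y *m Q))%:E = \int[leb n]_y (f y)%:E)%E.
Proof.
move=> oQ /measurable_int mf; rewrite integralE [RHS]integralE.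
rewrite -(leb_orth oQ (measurable_funepos mf))// -(leb_orth oQ (measurable_funeneg mf))//.
congr (_ - _)%E; apply: eq_integral => y _.
- by rewrite !funeposE.
- by rewrite !funenegE.
Qed.

Definition flip_mx n (i : 'I_n) : 'M[R]_n :=
  diag_mx (\row_k (if k == i then -1 else 1)).

Lemma flip_mx_orth n (i : 'I_n) : orthogonal_mx (flip_mx i).
Proof.
rewrite /orthogonal_mx /flip_mx tr_diag_mx mulmx_diag -diag_const_mx; congr diag_mx.
apply/rowP => k; rewrite !mxE; case: eqP => _; rewrite ?mulrNN mulr1//.
Qed.

Lemma mul_flip_mx n (i k : 'I_n) (y : 'rV[R]_n) :
  (y *m flip_mx i) 0 k = (if k == i then - y 0 k else y 0 k).
Proof. by rewrite mul_mx_diag !mxE; case: eqP => _; rewrite ?mulrN mulr1. Qed.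

Lemma perm_mx_orth n (s : 'S_n) : orthogonal_mx (perm_mx s : 'M[R]_n).
Proof. by rewrite /orthogonal_mx tr_perm_mx -perm_mxM mulVg perm_mx1. Qed.

Lemma mul_tperm_mx n (i j k : 'I_n) (y : 'rV[R]_n) :
  (y *m (tperm_mx i j)) 0 k = y 0 (tperm i j k).
Proof. by rewrite /tperm_mx -{1}(tpermV i j) -col_permE mxE. Qed.

Lemma abs_coordM n (i j : 'I_n) (y : 'rV[R]_n) : `|y 0 i * y 0 j| <= enorm y ^+ 2.
Proof. by rewrite normrM expr2 ler_pM// coord_le_enorm. Qed.

Variables (n : nat) (phi : 'rV[R]_n -> R) (M : R).
Hypothesis phi0 : forall y, 0 <= phi y.
Hypothesis mphi : measurable_fun setT phi.
Hypothesis phi_orth : forall Q y, orthogonal_mx Q -> phi (y *m Q) = phi y.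
Hypothesis phiM : (\int[leb n]_y (enorm y ^+ 2 * phi y)%:E = M%:E)%E.

Lemma measurable_monom (i j : 'I_n) :
  measurable_fun setT (fun y : 'rV[R]_n => y 0 i * y 0 j).
Proof. by apply: measurable_funM; exact: measurable_coor. Qed.

Lemma integrable_moment : (leb n).-integrable setT (fun y => (enorm y ^+ 2 * phi y)%:E).
Proof.
apply/integrableP; split.
  apply/measurable_EFinP/measurable_funM => //.
  by apply: measurable_funX; exact: measurable_enorm.
rewrite (eq_integral (fun y => (enorm y ^+ 2 * phi y)%:E)); first by rewrite phiM ltry.
by move=> y _; rewrite abse_EFin ger0_norm// mulr_ge0// sqr_ge0.
Qed.

Lemma integrable_monom (i j : 'I_n) :
  (leb n).-integrable setT (EFin \o (fun y : 'rV[R]_n => y 0 i * y 0 j * phi y)).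
Proof.
apply: (le_integrable measurableT _ _ integrable_moment).
  by apply/measurable_EFinP/measurable_funM => //; exact: measurable_monom.
move=> y _ /=; rewrite lee_fin normrM [leRHS]ger0_norm; last first.
  by rewrite mulr_ge0// sqr_ge0.
by rewrite (ger0_norm (phi0 y)) ler_wpM2r// abs_coordM.
Qed.

Lemma Rintegral_monom_neq (i j : 'I_n) : i != j ->
  \int[leb n]_y ((y : 'rV[R]_n) 0 i * (y : 'rV[R]_n) 0 j * phi y) = 0.
Proof.
move=> ij; set I := Rintegral _ _ _.
suff : I = - I by lra.
rewrite {1}/I /Rintegral -(integral_orth (flip_mx_orth i) (integrable_monom i j)).
rewrite -mulN1r -RintegralZl//; last exact: integrable_monom.
rewrite /Rintegral; congr fine; apply: eq_integral => y _; congr EFin.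
rewrite phi_orth; last exact: flip_mx_orth.
by rewrite !mul_flip_mx eqxx (eq_sym j) (negbTE ij); ring.
Qed.

(** Exchanging two coordinates is an orthogonal map, hence leaves the weight unchanged. *)
Lemma Rintegral_monom_eq (i j : 'I_n) :
  \int[leb n]_y ((y : 'rV[R]_n) 0 i * (y : 'rV[R]_n) 0 i * phi y) =
    \int[leb n]_y ((y : 'rV[R]_n) 0 j * (y : 'rV[R]_n) 0 j * phi y).
Proof.
have oP : orthogonal_mx (tperm_mx i j : 'M[R]_n) by exact: perm_mx_orth.
rewrite /Rintegral -(integral_orth oP (integrable_monom j j)).
congr fine; apply: eq_integral => y _; congr EFin.
by rewrite phi_orth// !mul_tperm_mx tpermR.
Qed.

Lemma Rintegral_sum_monom (B : 'M[R]_n) :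
  (leb n).-integrable setT (EFin \o (fun y => qform B y * phi y)) /\
  \int[leb n]_y (qform B y * phi y) =
    \sum_i \sum_j B i j * \int[leb n]_y ((y : 'rV[R]_n) 0 i * (y : 'rV[R]_n) 0 j * phi y).
Proof.
have E : EFin \o (fun y => qform B y * phi y) =
    (fun y : 'rV[R]_n => \sum_i \sum_j (B i j)%:E * (y 0 i * y 0 j * phi y)%:E)%E.
  apply/funext => y /=; rewrite /qform mulr_suml -sumEFin; apply: eq_bigr => i _.
  rewrite mulr_suml -sumEFin; apply: eq_bigr => j _.
  by rewrite -EFinM; congr EFin; ring.
have iB i j : (leb n).-integrable setT
    (fun y : 'rV[R]_n => (B i j)%:E * (y 0 i * y 0 j * phi y)%:E)%E.
  by apply: integrableZl => //; exact: integrable_monom.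
have iS i : (leb n).-integrable setT
    (fun y : 'rV[R]_n => \sum_j (B i j)%:E * (y 0 i * y 0 j * phi y)%:E)%E.
  by apply: integrable_sum.
split; first by rewrite E; exact: integrable_sum.
rewrite /Rintegral.
have -> : (\int[leb n]_y (qform B y * phi y)%:E =
    \int[leb n]_y (EFin \o (fun y : 'rV[R]_n => qform B y * phi y)%R) y)%E by [].
rewrite E integral_sum//.
under eq_bigr => i _.
  rewrite integral_sum//.
  under eq_bigr => j _.
    rewrite integralZl//; last exact: integrable_monom.
    rewrite -(fineK (integrable_fin_num measurableT (integrable_monom i j))) -EFinM.
    over.
  rewrite sumEFin.
  over.
by rewrite sumEFin.
Qed.

(** All diagonal moments coincide and add up to [M], as the case of the identity matrix shows. So
    each is [M / n] and only the trace of [B] survives. *)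
Lemma Rintegral_qform (B : 'M[R]_n) :
  n%:R * \int[leb n]_y (qform B y * phi y) = \tr B * M.
Proof.
have [_ ->] := Rintegral_sum_monom B.
pose J i := \int[leb n]_y ((y : 'rV[R]_n) 0 i * (y : 'rV[R]_n) 0 i * phi y).
have -> : \sum_i \sum_j B i j * \int[leb n]_y ((y : 'rV[R]_n) 0 i * (y : 'rV[R]_n) 0 j * phi y) =
    \sum_i B i i * J i.
  apply: eq_bigr => i _; rewrite (bigD1 i)//= big1 ?addr0// => j ji.
  by rewrite Rintegral_monom_neq ?mulr0// eq_sym.
have JM : \sum_i J i = M.
  have := Rintegral_sum_monom 1%:M; case=> _.
  under eq_Rintegral => y _.
    have -> : qform 1%:M y = enorm y ^+ 2.
      rewrite enorm_sqr; apply: eq_bigr => i _; rewrite (bigD1 i)//= big1 ?addr0.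
        by rewrite !mxE eqxx mul1r expr2.
      by move=> j ji; rewrite !mxE eq_sym (negbTE ji) mul0r.
    over.
  rewrite {1}/Rintegral phiM /= => ->; apply: eq_bigr => i _.
  rewrite (bigD1 i)//= big1 ?addr0; first by rewrite !mxE eqxx mul1r.
  by move=> j ji; rewrite !mxE eq_sym (negbTE ji) mul0r.
rewrite /mxtrace mulr_suml mulr_sumr; apply: eq_bigr => i _.
rewrite mulrCA; congr (_ * _); rewrite -JM.
under [RHS]eq_bigr => j _ do rewrite -/(J j) /J -(Rintegral_monom_eq i j).
by rewrite sumr_const card_ord -[RHS]mulr_natl.
Qed.

End quadratic.

(** * Curved strips under the kernel *)

Section last_coordinate.
Context {R : realType}.

Lemma coordE n (y : 'rV[R]_n) (i : 'I_n) : Defs.coord y i = y 0 i.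
Proof. by rewrite /Defs.coord valK. Qed.

Lemma coord_consrv0 n t (y : 'rV[R]_n) : Defs.coord (consrv t y) 0 = t.
Proof. by rewrite (coordE _ (ord0 : 'I_n.+1)) consrv0. Qed.

Lemma coord_consrvS n t (y : 'rV[R]_n) k : Defs.coord (consrv t y) k.+1 = Defs.coord y k.
Proof.
have [kn|nk] := ltnP k n.
  have := coordE (consrv t y) (lift ord0 (Ordinal kn)); rewrite /bump/= => ->.
  by rewrite consrvS (coordE _ (Ordinal kn)).
by rewrite /Defs.coord !insubF// ltnNge ?nk// ltnS nk.
Qed.

Lemma yprime_consrv n t (y : 'rV[R]_n.+1) : yprime (consrv t y) = consrv t (yprime y).
Proof.
apply/rowP => i; rewrite mxE; case: (unliftP ord0 i) => [j|] ->.
  by rewrite consrvS mxE /= coord_consrvS.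
by rewrite consrv0 coord_consrv0.
Qed.

Lemma ylast_consrv n t (y : 'rV[R]_n.+1) : ylast (consrv t y) = ylast y.
Proof. by rewrite /ylast /= coord_consrvS. Qed.

Lemma yprimeE n (y : 'rV[R]_n.+1) (i : 'I_n) :
  yprime y 0 i = y 0 (widen_ord (leqnSn n) i).
Proof. by rewrite mxE (coordE _ (widen_ord (leqnSn n) i)). Qed.

Lemma ylastE n (y : 'rV[R]_n.+1) : ylast y = y 0 ord_max.
Proof. by rewrite /ylast (coordE _ (ord_max : 'I_n.+1)). Qed.

Lemma enorm_last n (y : 'rV[R]_n.+1) :
  enorm y = Num.sqrt (enorm (yprime y) ^+ 2 + ylast y ^+ 2).
Proof.
rewrite enorm_sqr /enorm big_ord_recr ylastE; congr (Num.sqrt (_ + _)).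
by apply: eq_bigr => i _; rewrite yprimeE.
Qed.

Lemma iintS n (F : 'rV[R]_n.+1 -> \bar R) :
  iint F = (\int[@lebesgue_measure R]_t iint (fun y => F (consrv t y)))%E.
Proof. by []. Qed.

(** [iint] peels coordinates off from the front, whereas the graph variable is the last one; after
    all others are peeled it is the innermost integral. *)
Lemma iint_last n (G : 'rV[R]_n -> R -> \bar R) :
  iint (fun y : 'rV[R]_n.+1 => G (yprime y) (ylast y)) =
  iint (fun y => \int[@lebesgue_measure R]_t G y t)%E.
Proof.
elim: n G => [|n IH] G.
  apply: eq_integral => t _; congr G; first by apply/rowP => -[].
  by rewrite /ylast coord_consrv0.
rewrite iintS [RHS]iintS; apply: eq_integral => t _.
apply: eq_trans (IH (fun y u => G (consrv t y) u)); congr iint.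
by apply/funext => y; rewrite yprime_consrv ylast_consrv.
Qed.

Lemma measurable_yprime n : measurable_fun setT (@yprime R n.+1).
Proof.
apply: measurable_rVP => i; under eq_fun do rewrite yprimeE; exact: measurable_coor.
Qed.

Lemma measurable_ylast n : measurable_fun setT (@ylast R n.+1).
Proof.
have -> : @ylast R n.+1 = fun y => y 0 ord_max by apply/funext => y; rewrite ylastE.
exact: measurable_coor.
Qed.

Lemma leb_last n (G : 'rV[R]_n -> R -> \bar R) :
  measurable_fun setT (fun p : 'rV[R]_n * measurableTypeR R => G p.1 p.2) ->
  (forall y t, 0 <= G y t)%E ->
  (\int[leb n.+1]_y G (yprime y) (ylast y) =
   \int[leb n]_y \int[@lebesgue_measure R]_t G y t)%E.
Proof.
move=> mG G0; rewrite -iintE_ge0//; last first.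
  have mp : measurable_fun setT (fun y : 'rV[R]_n.+1 => (yprime y, ylast y)).
    by apply: measurable_fun_pair; [exact: measurable_yprime|exact: measurable_ylast].
  exact: (measurableT_comp mG mp).
rewrite iint_last iintE_ge0//; last by move=> y; exact: integral_ge0.
apply: (measurable_fun_fubini_tonelli_F (m2 := @lebesgue_measure R)
  (fun p : 'rV[R]_n * measurableTypeR R => G p.1 p.2)) => //.
Qed.

Definition dotrv n (a y : 'rV[R]_n) : R := \sum_i a 0 i * y 0 i.

Lemma measurable_dotrv n (a : 'rV[R]_n) : measurable_fun setT (dotrv a).
Proof.
apply: measurable_sum => i; apply: measurable_funM => //; exact: measurable_coor.
Qed.

Lemma dotrvN n (a y : 'rV[R]_n) : dotrv a (- y) = - dotrv a y.
Proof. by rewrite /dotrv -sumrN; apply: eq_bigr => i _; rewrite mxE mulrN. Qed.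

Lemma yprimeN n (y : 'rV[R]_n.+1) : yprime (- y) = - yprime y.
Proof. by apply/rowP => i; rewrite yprimeE [RHS]mxE yprimeE mxE. Qed.

Lemma ylastN n (y : 'rV[R]_n.+1) : ylast (- y) = - ylast y.
Proof. by rewrite !ylastE mxE. Qed.

End last_coordinate.

(** * Integrals over thin strips around a tilted hyperplane *)

Section strip.
Context {R : realType}.

(** Adding a half-line to its mirror image covers the line once, twice on [|u| <= c] if [c] is
    nonnegative, and misses [|u| < -c] if [c] is negative. A signed region thus reduces to symmetric
    strips. *)
Lemma ind_split_abs (u c : R) :
  ind R (u <= c) + ind R (- u <= c) = 1 + ind R (`|u| <= c) - ind R (`|u| < - c).
Proof.
rewrite /ind ler_norml ltr_norml opprK.
by case: (leP u c) => h1; case: (leP (- u) c) => h2; case: (leP (- c) u) => h3;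
  case: (ltP c u) => h4; case: (ltP u (- c)) => h5 //=; lra.
Qed.

Lemma max_sub_maxN (u : R) : Num.max u 0 - Num.max (- u) 0 = u.
Proof. by case: (leP u 0) => h; case: (leP (- u) 0) => h'; lra. Qed.

Lemma integral_ind_le (c : R) :
  (\int[@lebesgue_measure R]_w (ind R (`|w| <= c))%:E = (2 * Num.max c 0)%:E)%E.
Proof.
transitivity (\int[@lebesgue_measure R]_w (\1_(`[- c, c]%classic : set R) w)%:E)%E.
  apply: eq_integral => w _; rewrite indicE /ind; congr (_%:R%:E); congr nat_of_bool.
  by apply/idP/idP; rewrite inE /= in_itv /= ler_norml.
rewrite integral_indic//= setIT lebesgue_measure_itv/= lte_fin.
case: ltP => cc; last by congr EFin; rewrite (max_idPr _) ?mulr0//; lra.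
by rewrite -EFinD; congr EFin; rewrite (max_idPl _); lra.
Qed.

Lemma integral_ind_lt (c : R) :
  (\int[@lebesgue_measure R]_w (ind R (`|w| < c))%:E = (2 * Num.max c 0)%:E)%E.
Proof.
transitivity (\int[@lebesgue_measure R]_w (\1_(`]- c, c[%classic : set R) w)%:E)%E.
  apply: eq_integral => w _; rewrite indicE /ind; congr (_%:R%:E); congr nat_of_bool.
  by apply/idP/idP; rewrite inE /= in_itv /= ltr_norml.
rewrite integral_indic//= setIT lebesgue_measure_itv/= lte_fin.
case: ltP => cc; last by congr EFin; rewrite (max_idPr _) ?mulr0//; lra.
by rewrite -EFinD; congr EFin; rewrite (max_idPl _); lra.
Qed.

Variables (n : nat) (s r b alpha C l : R) (a : 'rV[R]_n).
Hypothesis s1 : 1 <= s.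
Hypothesis r0 : 0 < r.
Hypothesis b0 : 0 < b.
Hypothesis C0 : 0 <= C.
Hypothesis Cb : C * b < 1.
Hypothesis l1 : 1 <= l.
Hypothesis lE : 1 + (C * b + alpha) ^+ 2 <= l ^+ 2.
Hypothesis ha : forall y, `|dotrv a y| <= alpha * enorm y.

Let k (t : R) := kker n.+1 s r t.
Let th := l `^ (- (n.+1%:R + s)).
Let phi (y : 'rV[R]_n) := ind R (enorm y < b) * k (enorm y).
Let w (y : 'rV[R]_n.+1) := ylast y + dotrv a (yprime y).
(** The cylinder is sheared along the last coordinate: it is centrally symmetric, and a vertical
    translation undoes the tilt on each fibre. *)
Definition cyl (y : 'rV[R]_n.+1) :=
  (enorm (yprime y) < b) && (`|ylast y + dotrv a (yprime y)| < b).

Let s0 : 0 <= s. Proof. exact: le_trans s1. Qed.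
Let k0 t : 0 <= k t. Proof. exact: kker_ge0. Qed.

Let mphi : measurable_fun setT phi.
Proof.
by apply: measurable_funM; [exact: measurable_eball|exact: measurable_kker_enorm].
Qed.

Let mw : measurable_fun setT w.
Proof.
apply: measurable_funD; first exact: measurable_ylast.
by apply: (measurableT_comp (measurable_dotrv a)); exact: measurable_yprime.
Qed.

Let mey : measurable_fun setT (fun y : 'rV[R]_n.+1 => enorm (yprime y)).
Proof. by apply: (measurableT_comp (@measurable_enorm R n)); exact: measurable_yprime. Qed.

Lemma measurable_cyl : measurable_fun setT cyl.
Proof.
apply: measurable_and; first exact: measurable_fun_ltr.
by apply: measurable_fun_ltr => //; exact: measurableT_comp.
Qed.

Section one_side.
Variables (p : R -> R -> bool) (psi : 'rV[R]_n -> R).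
Hypothesis mp : forall d (T : measurableType d) (f g : T -> R),
  measurable_fun setT f -> measurable_fun setT g ->
  measurable_fun setT (fun x => p (f x) (g x)).
Hypothesis pint : forall c,
  (\int[@lebesgue_measure R]_w (ind R (p w c))%:E = (2 * Num.max c 0)%:E)%E.
Hypothesis pabs : forall u c, p u c -> `|u| <= c.
Hypothesis mpsi : measurable_fun setT psi.
Hypothesis psi_le : forall y, psi y <= C * enorm y ^+ 2.

(** After the vertical translation the fibre over [y'] is an interval of length [2 max (psi y') 0].
    It stays in the cylinder because [C b < 1]. On it [|y_d| <= (C b + alpha) |y'|], hence
    [|y'| <= |y| <= l |y'|], which puts the kernel between [th k(|y'|)] and [k(|y'|)]. The relation
    [p] covers both the closed and the open strip. *)
Lemma one_side :
  let N := (\int[leb n.+1]_y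
    (ind R (cyl y) * ind R (p (w y) (psi (yprime y))) * k (enorm y))%:E)%E in
  let A := (\int[leb n]_y (2 * Num.max (psi y) 0 * phi y)%:E)%E in
  (th%:E * A <= N)%E /\ (N <= A)%E.
Proof.
move=> N A.
pose G (y : 'rV[R]_n) (t : R) := (ind R ((enorm y < b) && (`|t + dotrv a y| < b)) *
  ind R (p (t + dotrv a y) (psi y)) * k (Num.sqrt (enorm y ^+ 2 + t ^+ 2)))%:E.
have mG : measurable_fun setT (fun q : 'rV[R]_n * measurableTypeR R => G q.1 q.2).
  have m1 : measurable_fun setT (fun q : 'rV[R]_n * measurableTypeR R => enorm q.1).
    by apply: (measurableT_comp (@measurable_enorm R n)).
  have m2 : measurable_fun setT (fun q : 'rV[R]_n * measurableTypeR R => q.2 + dotrv a q.1).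
    apply: measurable_funD => //.
    by apply: (measurableT_comp (measurable_dotrv a)).
  have m3 : measurable_fun setT (fun q : 'rV[R]_n * measurableTypeR R => psi q.1).
    by apply: (measurableT_comp mpsi).
  apply/measurable_EFinP; apply: measurable_funM; first apply: measurable_funM.
  - apply: measurable_boolR; apply: measurable_and; first exact: measurable_fun_ltr.
    by apply: measurable_fun_ltr => //; exact: measurableT_comp.
  - by apply: measurable_boolR; exact: mp.
  - apply: (measurableT_comp (measurable_kker n.+1 s r)).
    apply: (measurableT_comp (f := @Num.sqrt R)).
      by apply: continuous_measurable_fun; exact: sqrt_continuous.
    by apply: measurable_funD; exact: measurable_funX.
have G0 y t : (0 <= G y t)%E by rewrite lee_fin !mulr_ge0.
have NE : N = (\int[leb n]_y \int[@lebesgue_measure R]_t G y t)%E.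
  rewrite -(leb_last mG G0); apply: eq_integral => y _.
  by rewrite /G -enorm_last.
have mA : measurable_fun setT (fun y => (2 * Num.max (psi y) 0 * phi y)%:E).
  apply/measurable_EFinP/measurable_funM => //; apply: measurable_funM => //.
  exact: measurable_maxr.
have th0 : 0 <= th by exact: powR_ge0.
have phi0 y : 0 <= phi y by rewrite mulr_ge0.
have A0 y : (0 <= (2 * Num.max (psi y) 0 * phi y)%:E)%E.
  by rewrite lee_fin mulr_ge0// mulr_ge0// le_max lexx orbT.
have mGi : measurable_fun setT (fun y => \int[@lebesgue_measure R]_t G y t)%E.
  apply: (measurable_fun_fubini_tonelli_F (m2 := @lebesgue_measure R)
    (fun q : 'rV[R]_n * measurableTypeR R => G q.1 q.2)) => //.
have key y : ((th * (2 * Num.max (psi y) 0 * phi y))%:E <=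
      \int[@lebesgue_measure R]_t G y t)%E /\
    (\int[@lebesgue_measure R]_t G y t <= (2 * Num.max (psi y) 0 * phi y)%:E)%E.
  have mGy : measurable_fun setT (G y).
    have my : measurable_fun setT (fun t : measurableTypeR R => (y, t)).
      by apply: measurable_fun_pair.
    exact: (measurableT_comp mG my).
  rewrite -(integral_shift (- dotrv a y) mGy)//.
  have mGs : measurable_fun setT (fun t : R => G y (t - dotrv a y)).
    apply: (measurableT_comp mGy); exact: measurable_funB.
  have mpw : measurable_fun setT (fun t : R => (ind R (p t (psi y)))%:E).
    by apply/measurable_EFinP; apply: measurable_boolR; exact: mp.
  have AE c : 0 <= c -> ((c * (2 * Num.max (psi y) 0 * phi y))%:E =
      \int[@lebesgue_measure R]_t ((c * phi y)%:E * (ind R (p t (psi y)))%:E))%E.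
    move=> c0; rewrite ge0_integralZl//; last by rewrite lee_fin mulr_ge0.
    by rewrite pint -EFinM; congr EFin; ring.
  have := AE 1 ler01; rewrite mul1r => ->; rewrite (AE _ th0).
  have GE t : G y (t - dotrv a y) = (ind R ((enorm y < b) && (`|t| < b)) *
      ind R (p t (psi y)) * k (Num.sqrt (enorm y ^+ 2 + (t - dotrv a y) ^+ 2)))%:E.
    by rewrite /G subrK.
  have kk t : enorm y < b -> p t (psi y) -> [/\ `|t| < b,
      k (Num.sqrt (enorm y ^+ 2 + (t - dotrv a y) ^+ 2)) <= k (enorm y) &
      th * k (enorm y) <= k (Num.sqrt (enorm y ^+ 2 + (t - dotrv a y) ^+ 2))].
    move=> yb /pabs tp; have y0 := enorm_ge0 y.
    have tC : `|t| <= C * b * enorm y.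
      rewrite (le_trans tp)// (le_trans (psi_le y))// expr2 mulrA ler_wpM2r//.
      by rewrite ler_wpM2l// ltW.
    split.
    - rewrite (le_lt_trans tC)// (le_lt_trans _ yb)//.
      by rewrite ler_piMl// ltW.
    - apply: kker_le => //.
      by rewrite -[leLHS]ger0_norm// -sqrtr_sqr ler_wsqrtr// lerDl sqr_ge0.
    (* The remaining inequality is [|y| <= l |y'|], which after squaring is [lE]. *)
    - apply: le_trans (kker_scale _ s0 r0 y0 l1) _; apply: kker_le => //.
      rewrite -[leRHS]ger0_norm ?mulr_ge0 ?(le_trans ler01 l1)// -sqrtr_sqr ler_wsqrtr//.
      rewrite exprMn; apply: le_trans (ler_wpM2r (sqr_ge0 _) lE).
      rewrite mulrDl mul1r lerD2l -exprMn -real_normK ?num_real//.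
      rewrite lerXn2r ?nnegrE//.
        rewrite mulrDl addr_ge0//; last exact: le_trans (normr_ge0 _) (ha y).
        by rewrite mulr_ge0// mulr_ge0// ltW.
      rewrite (le_trans (ler_normB _ _))// mulrDl lerD//.
  split; apply: ge0_le_integral => //.
  - by move=> t _; rewrite -EFinM lee_fin mulr_ge0// mulr_ge0.
  - exact: emeasurable_funM.
  - move=> t _; rewrite GE -EFinM lee_fin /phi /ind; case: ltP => /= yb; last first.
      by rewrite !(mul0r, mulr0).
    case pt : (p t (psi y)); last by rewrite !(mul0r, mulr0).
    by have [-> _] := kk t yb pt; rewrite !mul1r mulr1.
  - exact: emeasurable_funM.
  - move=> t _; rewrite GE -EFinM lee_fin /phi /ind; case: ltP => /= yb; last first.
      by rewrite !(mul0r, mulr0).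
    case pt : (p t (psi y)); last by rewrite !(mul0r, mulr0).
    by have [-> ? _] := kk t yb pt; rewrite !mul1r mulr1.
rewrite NE /A; split.
  rewrite -ge0_integralZl//; apply: ge0_le_integral => //.
  - by move=> y _; rewrite mule_ge0.
  - exact: emeasurable_funM.
  - by move=> y _; rewrite -EFinM; have [] := key y.
apply: ge0_le_integral => //.
- by move=> y _; exact: integral_ge0.
- by move=> y _; have [] := key y.
Qed.

End one_side.

Let integrable_mulk (f : 'rV[R]_n.+1 -> R) : measurable_fun setT f ->
  (forall y, `|f y| <= 1) ->
  (leb n.+1).-integrable setT (EFin \o (fun y => f y * k (enorm y))).
Proof.
move=> mf f1.
have ik : (leb n.+1).-integrable setT (fun y => (k (enorm y))%:E).
  apply/integrableP; split; first by apply/measurable_EFinP; exact: measurable_kker_enorm.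
  rewrite (eq_integral (fun y => (k (enorm y))%:E)); first exact: kker_lty.
  by move=> y _; rewrite abse_EFin ger0_norm.
apply: (le_integrable measurableT _ _ ik).
  by apply/measurable_EFinP/measurable_funM => //; exact: measurable_kker_enorm.
by move=> y _ /=; rewrite lee_fin normrM (ger0_norm (k0 _)) ler_piMl.
Qed.

Let norm_ind c : `|ind R c| <= 1.
Proof. by rewrite /ind; case: c; rewrite ?normr1 ?normr0. Qed.

Let norm_indM c d : `|ind R c * ind R d| <= 1.
Proof. by rewrite /ind; case: c; case: d; rewrite ?(mulr0, mul0r, mulr1, normr1, normr0). Qed.

Variables (P : 'rV[R]_n -> R) (M : R).
Hypothesis mP : measurable_fun setT P.
Hypothesis P_even : forall y, P (- y) = P y.
Hypothesis P_le : forall y, `|P y| <= C * enorm y ^+ 2.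
Hypothesis phiM : (\int[leb n]_y (enorm y ^+ 2 * phi y)%:E = M%:E)%E.

Let phi0 y : 0 <= phi y. Proof. by rewrite mulr_ge0. Qed.

Let iM := integrable_moment phi0 mphi phiM.

Let integrable_mulphi (f : 'rV[R]_n -> R) (c : R) : measurable_fun setT f -> 0 <= c ->
  (forall y, `|f y| <= c * enorm y ^+ 2) ->
  (leb n).-integrable setT (EFin \o (fun y => f y * phi y)).
Proof.
move=> mf c0 fc.
apply: (le_integrable measurableT _ _ (integrableZl measurableT c iM)).
  by apply/measurable_EFinP/measurable_funM.
move=> y _ /=; rewrite lee_fin normrM (ger0_norm (phi0 _)) [leRHS]ger0_norm; last first.
  by rewrite mulr_ge0// mulr_ge0// sqr_ge0.
by rewrite (mulrA c) ler_wpM2r.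
Qed.

Let orthN : orthogonal_mx (- 1%:M : 'M[R]_n.+1).
Proof.
rewrite /orthogonal_mx; have -> : (- 1%:M : 'M[R]_n.+1)^T = - 1%:M.
  by apply/matrixP => i j; rewrite !mxE eq_sym.
by rewrite mulNmx mul1mx opprK.
Qed.

Let mulN (y : 'rV[R]_n.+1) : y *m (- 1%:M) = - y.
Proof. by rewrite mulmxN mulmx1. Qed.

Let cylN (y : 'rV[R]_n.+1) : cyl (- y) = cyl y.
Proof. by rewrite /cyl yprimeN ylastN enormN dotrvN -opprD normrN. Qed.

Let wN y : w (- y) = - w y.
Proof. by rewrite /w yprimeN ylastN dotrvN opprD. Qed.

Let mPw : measurable_fun setT (fun y : 'rV[R]_n.+1 => P (yprime y)).
Proof. by apply: (measurableT_comp mP); exact: measurable_yprime. Qed.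

(** Symmetrizing turns the integral into [N2 - N1], where [N1] and [N2] are the masses of the strips
    on which [P] is nonnegative and negative. Replacing the kernel by its value at [|y'|] turns
    these into [A1] and [A2], whose difference is exactly twice the integral of [P phi]. *)
Lemma strip_estimate :
  (leb n.+1).-integrable setT (EFin \o (fun y =>
     ind R (cyl y) * (1 - 2 * ind R (w y <= P (yprime y))) * k (enorm y))) /\
  `| \int[leb n.+1]_y (ind R (cyl y) * (1 - 2 * ind R (w y <= P (yprime y))) * k (enorm y))
     + 2 * \int[leb n]_y (P y * phi y) | <= (1 - th) * (2 * C * M).
Proof.
have mc : measurable_fun setT (fun y => ind R (cyl y)).
  by apply: measurable_boolR; exact: measurable_cyl.
have mS : measurable_fun setT (fun y => ind R (w y <= P (yprime y))).
  by apply: measurable_boolR; exact: measurable_fun_ler.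
have mS' : measurable_fun setT (fun y => ind R (- w y <= P (yprime y))).
  by apply: measurable_boolR; apply: measurable_fun_ler => //; exact: measurableT_comp.
have mNw : measurable_fun setT (fun y : 'rV[R]_n.+1 => - P (yprime y)) by exact: measurableT_comp.
have mA1 : measurable_fun setT (fun y => ind R (`|w y| <= P (yprime y))).
  by apply: measurable_boolR; apply: measurable_fun_ler => //; exact: measurableT_comp.
have mA2 : measurable_fun setT (fun y => ind R (`|w y| < - P (yprime y))).
  by apply: measurable_boolR; apply: measurable_fun_ltr => //; exact: measurableT_comp.
have i0 := integrable_mulk mc (fun y => norm_ind _).
have iS := integrable_mulk (measurable_funM mc mS) (fun y => norm_indM _ _).
have iS' := integrable_mulk (measurable_funM mc mS') (fun y => norm_indM _ _).
have iA1 := integrable_mulk (measurable_funM mc mA1) (fun y => norm_indM _ _).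
have iA2 := integrable_mulk (measurable_funM mc mA2) (fun y => norm_indM _ _).
have ZS : (leb n.+1).-integrable setT (EFin \o (fun y =>
    2 * (ind R (cyl y) * ind R (w y <= P (yprime y)) * k (enorm y)))).
  exact: (integrableZl measurableT 2 iS).
pose f0 y := ind R (cyl y) * k (enorm y).
pose fS y := ind R (cyl y) * ind R (w y <= P (yprime y)) * k (enorm y).
pose fS' y := ind R (cyl y) * ind R (- w y <= P (yprime y)) * k (enorm y).
pose f1 y := ind R (cyl y) * ind R (`|w y| <= P (yprime y)) * k (enorm y).
pose f2 y := ind R (cyl y) * ind R (`|w y| < - P (yprime y)) * k (enorm y).
have TE : (fun y => ind R (cyl y) * (1 - 2 * ind R (w y <= P (yprime y))) * k (enorm y))
    = (fun y => f0 y - 2 * fS y).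
  by apply/funext => y; rewrite /f0 /fS; ring.
rewrite TE; split; first exact: (integrableB measurableT i0 ZS).
rewrite RintegralB// RintegralZl//.
have SS' : \int[leb n.+1]_y fS y = \int[leb n.+1]_y fS' y.
  rewrite /Rintegral.
  transitivity (fine (\int[leb n.+1]_y (fS (y *m (- 1%:M)))%:E)%E).
    exact/esym/(congr1 fine (integral_orth orthN iS)).
  have fSN y : fS (y *m (- 1%:M)) = fS' y.
    by rewrite mulN /fS /fS' cylN wN yprimeN P_even enormN.
  apply: (congr1 fine).
  apply: eq_integral => y _.
  by rewrite fSN.
have E2 : \int[leb n.+1]_y fS y + \int[leb n.+1]_y fS' y =
    \int[leb n.+1]_y f0 y + \int[leb n.+1]_y f1 y - \int[leb n.+1]_y f2 y.
  rewrite -RintegralD// -RintegralD// -RintegralB//; last first.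
    exact: (integrableD measurableT i0 iA1).
  apply: eq_Rintegral => y _; rewrite /fS /fS' /f0 /f1 /f2.
  set W := w y; set PP := P _.
  suff : ind R (W <= PP) + ind R (- W <= PP) = 1 + ind R (`|W| <= PP) - ind R (`|W| < - PP).
    by move=> E; rewrite -!mulrDl -!mulrBl -mulrDr E; ring.
  exact: ind_split_abs.
have pP y : P y <= C * enorm y ^+ 2 by exact: le_trans (ler_norm _) (P_le y).
have pN y : - P y <= C * enorm y ^+ 2.
  by rewrite (le_trans _ (P_le y))// -normrN ler_norm.
have mpos : measurable_fun setT (fun y => 2 * Num.max (P y) 0).
  by apply: measurable_funM => //; exact: measurable_maxr.
have mneg : measurable_fun setT (fun y => 2 * Num.max (- P y) 0).
  by apply: measurable_funM => //; apply: measurable_maxr => //; exact: measurableT_comp.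
have C20 : 0 <= 2 * C by rewrite mulr_ge0.
have bpos y : `|2 * Num.max (P y) 0| <= 2 * C * enorm y ^+ 2.
  rewrite ger0_norm ?mulr_ge0// ?le_max ?lexx ?orbT// -mulrA ler_wpM2l//.
  by rewrite ge_max pP mulr_ge0// sqr_ge0.
have bneg y : `|2 * Num.max (- P y) 0| <= 2 * C * enorm y ^+ 2.
  rewrite ger0_norm ?mulr_ge0// ?le_max ?lexx ?orbT// -mulrA ler_wpM2l//.
  by rewrite ge_max pN mulr_ge0// sqr_ge0.
have ipos := integrable_mulphi mpos C20 bpos.
have ineg := integrable_mulphi mneg C20 bneg.
have [l1' u1] := @one_side (fun u c => `|u| <= c) P
  (fun d T f g mf mg => measurable_fun_ler (measurableT_comp (@normr_measurable R setT) mf) mg)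
  integral_ind_le (fun u c h => h) mP pP.
have [l2' u2] := @one_side (fun u c => `|u| < c) (fun y => - P y)
  (fun d T f g mf mg => measurable_fun_ltr (measurableT_comp (@normr_measurable R setT) mf) mg)
  integral_ind_lt (fun u c h => ltW h) (measurableT_comp (@oppr_measurable R setT) mP) pN.
pose A1 := \int[leb n]_y (2 * Num.max (P y) 0 * phi y).
pose A2 := \int[leb n]_y (2 * Num.max (- P y) 0 * phi y).
pose N1 := \int[leb n.+1]_y f1 y; pose N2 := \int[leb n.+1]_y f2 y.
have fR (d : nat) (f : 'rV[R]_d -> R) : (leb d).-integrable setT (EFin \o f) ->
    (\int[leb d]_y (f y)%:E = (\int[leb d]_y f y)%:E)%E.
  by move=> If; rewrite /Rintegral fineK//; exact: (integrable_fin_num measurableT If).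
move: l1' u1 l2' u2; rewrite !(fR _ _ iA1) !(fR _ _ iA2) !(fR _ _ ipos) !(fR _ _ ineg).
rewrite -!EFinM !lee_fin -/A1 -/A2 -/N1 -/N2 => l1' u1 l2' u2.
have AP : A1 - A2 = 2 * \int[leb n]_y (P y * phi y).
  rewrite -RintegralB// -RintegralZl//; last exact: (integrable_mulphi mP C0 P_le).
  apply: eq_Rintegral => y _; rewrite -mulrBl mulrA -mulrBr; congr (_ * _ * _).
  exact: max_sub_maxN.
have AM f : (leb n).-integrable setT (EFin \o (fun y => f y * phi y)) ->
    (forall y, `|f y| <= 2 * C * enorm y ^+ 2) ->
    \int[leb n]_y (f y * phi y) <= 2 * C * M.
  move=> If fb; have -> : M = \int[leb n]_y (enorm y ^+ 2 * phi y).
    by rewrite /Rintegral phiM.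
  rewrite -RintegralZl//; apply: le_Rintegral => //.
    exact: (integrableZl measurableT (2 * C) iM).
  by move=> y _; rewrite (mulrA (2 * C)) ler_wpM2r// (le_trans (ler_norm _)).
have A1M : A1 <= 2 * C * M by exact: AM.
have A2M : A2 <= 2 * C * M by exact: AM.
have th1 : th <= 1.
  have := @powRN_le R (n.+1%:R + s) 1 l; rewrite powR1; apply=> //.
  by rewrite addr_ge0.
rewrite -AP -/N1 -/N2.
(* Both differences on the right are nonnegative and at most [(1 - th)] times [A1] or [A2], so they
   do not add up in absolute value. *)
have -> : \int[leb n.+1]_y f0 y - 2 * \int[leb n.+1]_y fS y + (A1 - A2) =
    (A1 - N1) - (A2 - N2).
  by move: E2; rewrite -SS' -/N1 -/N2; lra.
have B1 : (1 - th) * A1 <= (1 - th) * (2 * C * M) by rewrite ler_wpM2l// subr_ge0.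
have B2 : (1 - th) * A2 <= (1 - th) * (2 * C * M) by rewrite ler_wpM2l// subr_ge0.
by rewrite ler_norml; apply/andP; split; lra.
Qed.

End strip.

(** * Taylor expansion from coordinate derivatives *)

Section calculus.
Context {R : realType}.

(** Rescaling to the unit interval covers [t] of either sign. *)
Lemma mvt01 (h dh : R -> R) (t : R) : (forall u : R, is_derive u 1 h (dh u)) ->
  exists2 th, 0 <= th <= 1 & h t - h 0 = t * dh (th * t).
Proof.
move=> dhE; pose k u := h (u * t).
have dk (u : R) : is_derive u 1 k (t * dh (u * t)).
  have -> : t * dh (u * t) = dh (u * t) * (t * 1) by rewrite mulr1 mulrC.
  apply: (is_derive1_comp (f := h) (g := fun u => u * t)).
  rewrite (_ : (fun u => u * t) = t \*: (@id R)).
    by apply: is_deriveZ.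
  by apply/funext => v /=; rewrite mulrC.
have kc : {within `[0, 1], continuous k}.
  by apply: derivable_within_continuous => u _; have [] := dk u.
have [th] := MVT_segment ler01 (fun u (_ : u \in `]0, 1[) => dk u) kc.
rewrite in_itv /= => th01; rewrite /k mul1r mul0r subr0 mulr1 => E.
by exists th.
Qed.

Lemma is_derive_line n (f : 'rV[R]_n -> R) (y v : 'rV[R]_n) (t : R) :
  derivable f (y + t *: v) v ->
  is_derive t 1 (fun u => f (y + u *: v)) ('D_v f (y + t *: v)).
Proof.
have E : (fun h : R => h^-1 *: (f (y + (h *: 1 + t) *: v) - f (y + t *: v))) =
    (fun h : R => h^-1 *: (f (h *: v + (y + t *: v)) - f (y + t *: v))).
  apply/funext => h; congr (_ *: (f _ - _)).
  by rewrite scalerDl [h *: 1]mulr1 addrCA.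
move=> df; apply: DeriveDef.
  by rewrite /derivable /= E; exact: df.
by rewrite /derive /= E.
Qed.

Lemma derivable_lineP n (f : 'rV[R]_n -> R) (y v : 'rV[R]_n) (l : R) :
  is_derive (0 : R) 1 (fun u => f (y + u *: v)) l -> derivable f y v /\ 'D_v f y = l.
Proof.
have E : (fun h : R => h^-1 *: (f (y + (h *: 1 + 0) *: v) - f (y + 0 *: v))) =
    (fun h : R => h^-1 *: (f (h *: v + y) - f y)).
  apply/funext => h; congr (_ *: (f _ - f _)).
    by rewrite addr0 [h *: 1]mulr1 addrC.
  by rewrite scale0r addr0.
by move=> [+ <-]; rewrite /derivable /derive /= E.
Qed.

(** The vertices of a path from 0 to [D] that moves along one coordinate at a time; along its edges
    the partial derivatives of [C2fun] are all that is needed. *)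
Definition truncrv n (k : nat) (D : 'rV[R]_n) : 'rV[R]_n :=
  \row_j (if (j < k)%N then D 0 j else 0).

Lemma truncrv0 n (D : 'rV[R]_n) : truncrv 0 D = 0.
Proof. by apply/rowP => j; rewrite !mxE. Qed.

Lemma truncrvn n (D : 'rV[R]_n) : truncrv n D = D.
Proof. by apply/rowP => j; rewrite !mxE ltn_ord. Qed.

Lemma ebasisE n (i j : 'I_n) : ebasis R i 0 j = (i == j)%:R.
Proof. by rewrite mxE eqxx /= eq_sym. Qed.

Lemma truncrvDE n (D : 'rV[R]_n) (k : nat) (t : R) (i j : 'I_n) :
  (truncrv k D + t *: ebasis R i) 0 j =
  (if (j < k)%N then D 0 j else 0) + t * (i == j)%:R.
Proof. by rewrite !mxE eqxx /= (eq_sym j). Qed.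

Lemma truncrvS n (D : 'rV[R]_n) (k : 'I_n) :
  truncrv k.+1 D = truncrv k D + D 0 k *: ebasis R k.
Proof.
apply/rowP => j; rewrite truncrvDE mxE ltnS leq_eqVlt.
case: (eqVneq k j) => [->|kj]; first by rewrite eqxx /= ltnn add0r mulr1.
have -> : (j == k :> nat) = false by apply/negbTE; rewrite eq_sym.
by rewrite mulr0 addr0.
Qed.

Lemma telescope_path n (f : 'rV[R]_n -> R) (y D : 'rV[R]_n) :
  f (y + D) - f y = \sum_(i < n) (f (y + truncrv i D + D 0 i *: ebasis R i) - f (y + truncrv i D)).
Proof.
rewrite -{1}(truncrvn D) -{2}(addr0 y) -(truncrv0 D).
rewrite -(telescope_sumr (fun k => f (y + truncrv k D)) (leq0n n)) big_mkord.
by apply: eq_bigr => i _; rewrite truncrvS addrA.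
Qed.

(** One mean value theorem per edge. The intermediate points differ from edge to edge but all stay
    in the box spanned by [D], so continuity of the partials controls them together. *)
Lemma mv_path n (f : 'rV[R]_n -> R) (y D : 'rV[R]_n) :
  (forall i z, derivable f z (ebasis R i)) ->
  exists2 xi : 'I_n -> 'rV[R]_n, (forall i j, `|xi i 0 j| <= `|D 0 j|) &
    f (y + D) - f y = \sum_i D 0 i * pd i f (y + xi i).
Proof.
move=> df.
have H (i : 'I_n) : exists xi : 'rV[R]_n, (forall j, `|xi 0 j| <= `|D 0 j|) /\
    f (y + truncrv i D + D 0 i *: ebasis R i) - f (y + truncrv i D) =
    D 0 i * pd i f (y + xi).
  have [th /andP[th0 th1]] := @mvt01 (fun u => f (y + truncrv i D + u *: ebasis R i))
    (fun u => pd i f (y + truncrv i D + u *: ebasis R i)) (D 0 i)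
    (fun u => is_derive_line (df i _)).
  rewrite scale0r addr0 => E.
  exists (truncrv i D + (th * D 0 i) *: ebasis R i); split; last by rewrite addrA.
  move=> j; rewrite truncrvDE; case: (eqVneq i j) => [<-|ij].
    by rewrite ltnn add0r mulr1 normrM ler_piMl// ger0_norm.
  by rewrite mulr0 addr0; case: ifP => //; rewrite normr0.
have [xi Hxi] := choice H.
exists xi; first by move=> i; have [] := Hxi i.
rewrite telescope_path; apply: eq_bigr => i _; by have [_ ->] := Hxi i.
Qed.

Definition nrm1 n (v : 'rV[R]_n) : R := \sum_j `|v 0 j|.

Lemma nrm1_ge0 n (v : 'rV[R]_n) : 0 <= nrm1 v.
Proof. exact: sumr_ge0. Qed.

Lemma mv_path_le n (f : 'rV[R]_n -> R) (y D c : 'rV[R]_n) (eta : R) :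
  (forall i z, derivable f z (ebasis R i)) ->
  (forall xi : 'rV[R]_n, (forall j, `|xi 0 j| <= `|D 0 j|) ->
    forall i, `|pd i f (y + xi) - c 0 i| <= eta) ->
  `|f (y + D) - f y - \sum_i D 0 i * c 0 i| <= eta * nrm1 D.
Proof.
move=> df H; have [xi xiD ->] := mv_path y D df.
rewrite -sumrB mulr_sumr (le_trans (ler_norm_sum _ _ _))// ler_sum// => i _.
by rewrite -mulrBr normrM mulrC ler_wpM2r// H.
Qed.

(* The second-order part picked up along the coordinate path from [y] to [y + D]:
   each mixed derivative occurs once, so the symmetry of [H] is never used. *)
Definition taylor_mx n (H : 'M[R]_n) : 'M[R]_n :=
  \matrix_(i, j) (if (j < i)%N then H i j else if j == i then H i i / 2 else 0).

(** The remainder is measured by the oscillation [eta] of the second derivatives around a prescribed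
    [H], not by their size. Hence [H] may be the Hessian at another point, or 0 for a map close to
    the identity. *)
Lemma taylor2 n (f : 'rV[R]_n -> R) (y D : 'rV[R]_n) (H : 'M[R]_n) (eta : R) :
  (forall i z, derivable f z (ebasis R i)) ->
  (forall i j z, derivable (pd i f) z (ebasis R j)) ->
  (forall xi : 'rV[R]_n, (forall j, `|xi 0 j| <= `|D 0 j|) ->
    forall i j, `|pd j (pd i f) (y + xi) - H i j| <= eta) ->
  `|f (y + D) - f y - \sum_i D 0 i * pd i f y - qform (taylor_mx H) D| <= eta * nrm1 D ^+ 2.
Proof.
move=> df ddf HH.
rewrite telescope_path /qform -!sumrB expr2 mulrCA mulr_suml.
rewrite (le_trans (ler_norm_sum _ _ _))// ler_sum// => i _.
set p := y + truncrv i D.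
(* The value that [H] predicts for [pd i f] at the start of edge [i], after the earlier coordinates
   have moved. *)
pose c := pd i f y + \sum_(j < n | (j < i)%N) H i j * D 0 j.
pose h u := f (p + u *: ebasis R i) - (u * c + H i i / 2 * u ^+ 2).
have dh (u : R) : is_derive u 1 h (pd i f (p + u *: ebasis R i) - (c + H i i * u)).
  apply: is_deriveB; first exact: is_derive_line.
  have -> : c + H i i * u = c *: 1 + (H i i / 2) *: (2 * u ^+ 1).
    by rewrite /GRing.scale/= expr1 mulr1; field.
  apply: is_deriveD.
    rewrite (_ : (fun u => u * c) = c \*: (@id R)); first exact: is_deriveZ.
    by apply/funext => v /=; rewrite mulrC.
  by apply: is_deriveZ; exact: is_derive_pow.
have [th /andP[th0 th1]] := mvt01 (D 0 i) dh.
rewrite /h scale0r addr0 mul0r expr0n/= mulr0 add0r subr0 => E.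
have -> : f (p + D 0 i *: ebasis R i) - f p - D 0 i * pd i f y -
    \sum_j taylor_mx H i j * (D 0 i * D 0 j) =
    D 0 i * (pd i f (p + (th * D 0 i) *: ebasis R i) - (c + H i i * (th * D 0 i))).
  rewrite -E; suff -> : \sum_j taylor_mx H i j * (D 0 i * D 0 j) =
      D 0 i * (\sum_(j < n | (j < i)%N) H i j * D 0 j) + H i i / 2 * D 0 i ^+ 2.
    by rewrite /c; ring.
  rewrite (bigD1 i)//= mxE ltnn eqxx addrC; congr (_ + _).
  rewrite mulr_sumr [RHS]big_mkcond [LHS]big_mkcond; apply: eq_bigr => j _ /=.
  rewrite mxE; case: (eqVneq j i) => [->|ji] /=; first by rewrite ltnn.
  by case: ifP => _; ring.
rewrite normrM ler_wpM2l//.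
set xi := truncrv i D + (th * D 0 i) *: ebasis R i.
have xiD j : `|xi 0 j| <= `|D 0 j|.
  rewrite truncrvDE; case: (eqVneq i j) => [<-|ij].
    by rewrite ltnn add0r mulr1 normrM ler_piMl// ger0_norm.
  by rewrite mulr0 addr0; case: ifP => //; rewrite normr0.
have -> : pd i f (p + (th * D 0 i) *: ebasis R i) - (c + H i i * (th * D 0 i)) =
   pd i f (y + xi) - pd i f y - \sum_j xi 0 j * (row i H) 0 j.
  suff -> : \sum_j xi 0 j * (row i H) 0 j =
      \sum_(j < n | (j < i)%N) H i j * D 0 j + H i i * (th * D 0 i).
    by rewrite /c /p addrA; ring.
  rewrite (bigD1 i)//= [row _ _ _ _]mxE addrC truncrvDE ltnn eqxx add0r mulr1 mulrC; congr (_ + _).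
  rewrite [RHS]big_mkcond [LHS]big_mkcond; apply: eq_bigr => j _ /=.
  rewrite [row _ _ _ _]mxE truncrvDE (eq_sym i).
  case: (eqVneq j i) => [->|ji] /=; first by rewrite ltnn.
  by rewrite mulr0 addr0; case: ifP => _; ring.
apply: (le_trans (mv_path_le (eta := eta) (ddf i) _)).
  move=> z zxi j; rewrite [row _ _ _ _]mxE; apply: HH => l.
  exact: le_trans (zxi l) (xiD l).
rewrite ler_wpM2l//.
  apply: le_trans (HH 0 _ i i) => //; first by move=> j; rewrite mxE normr0.
by rewrite ler_sum.
Qed.

End calculus.

(** * Closure properties of C2 functions *)

Section c1.
Context {R : realType}.

Lemma cvg_sum_seq {T I : Type} (F : set_system T) {FF : Filter F} (s : seq I)
    (f : I -> T -> R) (l : I -> R) :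
  (forall i, f i x @[x --> F] --> l i) ->
  (\sum_(i <- s) f i x) @[x --> F] --> \sum_(i <- s) l i.
Proof.
move=> H; elim: s => [|i s IH].
  by rewrite big_nil; under eq_fun do rewrite big_nil; exact: cvg_cst.
rewrite big_cons; under eq_fun do rewrite big_cons.
by apply: cvgD.
Qed.

Lemma continuous_rVP n (f : 'rV[R]_n -> R) (y : 'rV[R]_n) :
  {for y, continuous f} <->
  forall e, 0 < e -> exists2 d, 0 < d & forall xi : 'rV[R]_n,
    (forall j, `|xi 0 j| < d) -> `|f (y + xi) - f y| < e.
Proof.
split=> [/cvgrPdist_lt H e /H /nbhs_ballP[d /= d0 Hd]|H].
  exists d => // xi xid; rewrite distrC; apply: Hd; split => // i j.
  by rewrite ord1 -ball_normE /= mxE opprD addrA subrr add0r normrN.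
apply/(cvgrPdist_lt (F := nbhs y) f (f y)) => e /H[d d0 Hd].
apply/nbhs_ballP; exists d => // z [_ zd].
rewrite /= distrC; have -> : f z = f (y + (z - y)) by rewrite addrC subrK.
apply: Hd => j.
by have := zd 0 j; rewrite -ball_normE /= !mxE distrC.
Qed.

Lemma cvg_rVP n {T : Type} (F : set_system T) {FF : Filter F} (g : T -> 'rV[R]_n) (y : 'rV[R]_n) :
  (forall j, g x 0 j @[x --> F] --> y 0 j) -> g x @[x --> F] --> y.
Proof.
move=> H; apply/cvg_ballP => e e0.
have : \forall x \near F, forall j, `|y 0 j - g x 0 j| < e.
  by apply: filter_forall => j; move/cvgrPdist_lt : (H j); exact.
by apply: filterS => x Hx; split=> // i j; rewrite ord1 -ball_normE; exact: Hx.
Qed.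

Definition C1fun n (f : 'rV[R]_n -> R) :=
  (forall i y, derivable f y (ebasis R i)) /\ (forall i, continuous (pd i f)).

Lemma cvg_pd_path n (K : 'rV[R]_n -> R) (i : 'I_n) (y : 'rV[R]_n) {T : Type}
    (F : set_system T) {FF : Filter F} (D xi : T -> 'rV[R]_n) :
  {for y, continuous (pd i K)} -> (forall j, D h 0 j @[h --> F] --> (0 : R)) ->
  (forall h j, `|xi h 0 j| <= `|D h 0 j|) ->
  pd i K (y + xi h) @[h --> F] --> pd i K y.
Proof.
move=> /continuous_rVP cK D0 xiD; apply/cvgrPdist_lt => e /cK[d d0 Hd].
have : \forall h \near F, forall j, `|D h 0 j| < d.
  apply: filter_forall => j; move/cvgrPdist_lt : (D0 j) => /(_ _ d0).
  by apply: filterS => h; rewrite sub0r normrN.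
apply: filterS => h Hh; rewrite distrC; apply: Hd => j.
exact: le_lt_trans (xiD h j) (Hh j).
Qed.

Lemma derivable_cvg (g : R -> R) (t : R) :
  derivable g t 1 -> g (h *: 1 + t) @[h --> (0 : R)^'] --> g t.
Proof.
move=> /derivable1_diffP/differentiable_continuous cg.
have : (h *: 1 + t) @[h --> (0 : R)^'] --> t.
  rewrite -[X in _ --> X](add0r t); apply: cvgD; last exact: cvg_cst.
  by under eq_fun do rewrite [_ *: _]mulr1; exact: cvg_within.
by move/(cvg_comp _ _); apply.
Qed.

(** By [mv_path] the difference quotient is a sum of coordinate quotients times partials at points
    that tend to [c t]; continuity of the partials there gives the limit. *)
Lemma chain_curve n (K : 'rV[R]_n -> R) (c : R -> 'rV[R]_n) (v : 'rV[R]_n) (t : R) :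
  (forall i y, derivable K y (ebasis R i)) ->
  (forall i, {for c t, continuous (pd i K)}) ->
  (forall j, is_derive t 1 (fun s => c s 0 j) (v 0 j)) ->
  is_derive t 1 (fun s => K (c s)) (\sum_j v 0 j * pd j K (c t)).
Proof.
move=> dK cK dc.
pose D (h : R) := c (h *: 1 + t) - c t.
have H h : exists xi : 'I_n -> 'rV[R]_n, (forall i j, `|xi i 0 j| <= `|D h 0 j|) /\
    K (c t + D h) - K (c t) = \sum_i D h 0 i * pd i K (c t + xi i).
  by have [xi] := mv_path (c t) (D h) dK; exists xi.
have [xi Hxi] := choice H.
have D0 j : D h 0 j @[h --> (0 : R)^'] --> (0 : R).
  have [dj _] := dc j; have := derivable_cvg dj.
  move=> /(@cvgB _ _ _ _ _ _ _ _ _)/(_ (cvg_cst (c t 0 j))).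
  by rewrite subrr; apply: cvg_trans; apply: near_eq_cvg; apply: nearW => h; rewrite !mxE.
suff L : h^-1 *: (K (c (h *: 1 + t)) - K (c t)) @[h --> (0 : R)^'] -->
    \sum_j v 0 j * pd j K (c t).
  apply: DeriveDef; first by apply/cvg_ex; eexists; exact: L.
  exact: (cvg_lim _ L).
rewrite (_ : (fun h => _) = (fun h => \sum_j (h^-1 *: D h 0 j) * pd j K (c t + xi h j))).
  apply: cvg_sum_seq => j; apply: cvgM; last first.
    by apply: cvg_pd_path => // h i; have [+ _] := Hxi h; exact.
  have [dj <-] := dc j; have {}dj : derivable (fun s => c s 0 j) t 1 by [].
  apply: cvg_trans dj; apply: near_eq_cvg; apply: nearW => h.
  by rewrite /D !mxE.
apply/funext => h; have [_ E] := Hxi h.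
have -> : c (h *: 1 + t) = c t + D h by rewrite /D [RHS]addrC subrK.
rewrite E scaler_sumr; apply: eq_bigr => j _; by rewrite -scalerAl.
Qed.

(** Near [y] each partial is at most its absolute value at [y] plus 1, and [mv_path] turns this into
    a local Lipschitz bound. *)
Lemma C1_continuous n (f : 'rV[R]_n -> R) : C1fun f -> continuous f.
Proof.
move=> [df cf] y; apply/continuous_rVP => e e0.
have : \forall z \near y, forall i, `|pd i f y - pd i f z| < 1.
  apply: (@filter_forall _ _ _ (nbhs y)) => i.
  by move/(cvgrPdist_lt (F := nbhs y)) : (cf i y); apply.
move=> /nbhs_ballP[d /= d0 Hd].
pose S := \sum_i (`|pd i f y| + 1).
have S0 : 0 <= S by apply: sumr_ge0 => i _; rewrite addr_ge0.
have S1 : 0 < S + 1 by rewrite ltr_wpDl.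
exists (Num.min d (e / (S + 1))); first by rewrite lt_min d0 divr_gt0.
move=> D DH.
have [xi xiD ->] := mv_path y D df.
rewrite (le_lt_trans (ler_norm_sum _ _ _))//.
apply: (@le_lt_trans _ _ (e / (S + 1) * S)); last first.
  by rewrite mulrAC ltr_pdivrMr// ltr_pM2l// ltrDl.
rewrite /S mulr_sumr ler_sum// => i _.
have := DH i; rewrite lt_min => /andP[_ /ltW Di].
rewrite normrM ler_pM//.
have /Hd/(_ i) : ball y d (y + xi i).
  split=> // k j; rewrite ord1 -ball_normE /= mxE opprD addrA subrr add0r normrN.
  by rewrite (le_lt_trans (xiD i j))//; have := DH j; rewrite lt_min => /andP[].
rewrite distrC => /ltW; have := ler_normD (pd i f (y + xi i) - pd i f y) (pd i f y).
by rewrite subrK; lra.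
Qed.

Lemma C1_comp n m (K : 'rV[R]_m -> R) (F : 'rV[R]_n -> 'rV[R]_m) :
  C1fun K -> (forall j, C1fun (fun z => F z 0 j)) ->
  C1fun (fun z => K (F z)) /\
  forall i, pd i (fun z => K (F z)) = fun z => \sum_j pd i (fun w => F w 0 j) z * pd j K (F z).
Proof.
move=> [dK cK] CF.
have D i z : derivable (fun z => K (F z)) z (ebasis R i) /\
    'D_(ebasis R i) (fun z => K (F z)) z =
    \sum_j pd i (fun w => F w 0 j) z * pd j K (F z).
  apply: derivable_lineP.
  have -> : \sum_j pd i (fun w => F w 0 j) z * pd j K (F z) =
      \sum_j (\row_j pd i (fun w => F w 0 j) z) 0 j * pd j K (F (z + 0 *: ebasis R i)).
    by rewrite scale0r addr0; apply: eq_bigr => j _; rewrite mxE.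
  apply: (chain_curve (c := fun u => F (z + u *: ebasis R i))) => //.
    by move=> j; exact: cK.
  move=> j; have [dFj _] := CF j; rewrite mxE /pd.
  have := is_derive_line (f := fun w => F w 0 j) (y := z) (t := 0) (dFj i (z + 0 *: ebasis R i)).
  by rewrite scale0r addr0.
have E i : pd i (fun z => K (F z)) = fun z => \sum_j pd i (fun w => F w 0 j) z * pd j K (F z).
  by apply/funext => z; have [_ <-] := D i z.
split; last exact: E.
split; first by move=> i y; have [] := D i y.
have cF : continuous F.
  by move=> y; apply: (cvg_rVP (F := nbhs y)) => j; exact: C1_continuous (CF j) y.
move=> i; rewrite E => y; apply: (cvg_sum_seq (F := nbhs y)) => j; apply: cvgM.
  by have [_ cj] := CF j; exact: cj.
exact: (cvg_comp _ _ (cF y) (cK j (F y))).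
Qed.

Lemma C1_cst n (c : R) : C1fun (fun _ : 'rV[R]_n => c) /\
  forall i, pd i (fun _ : 'rV[R]_n => c) = fun _ => 0.
Proof.
have E i : pd i (fun _ : 'rV[R]_n => c) = fun _ => 0.
  by apply/funext => y; exact: derive_cst.
split; last exact: E.
split; first by move=> i y; exact: derivable_cst.
by move=> i; rewrite E; exact: cst_continuous.
Qed.

Lemma C1_coor n (k : 'I_n) : C1fun (fun y : 'rV[R]_n => y 0 k) /\
  forall i, pd i (fun y : 'rV[R]_n => y 0 k) = fun _ => (i == k)%:R.
Proof.
have D i (y : 'rV[R]_n) : derivable (fun y : 'rV[R]_n => y 0 k) y (ebasis R i) /\
   'D_(ebasis R i) (fun y : 'rV[R]_n => y 0 k) y = (i == k)%:R.
  apply: derivable_lineP.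
  set c : R := (i == k)%:R.
  have L : is_derive (0 : R) 1 (cst (y 0 k) + (c \*: @id R)) c.
    by apply: is_derive_eq; rewrite add0r [c *: 1]mulr1.
  rewrite (_ : (fun u => _) = cst (y 0 k) + (c \*: @id R))//.
  by apply/funext => u /=; rewrite !mxE eqxx /= (eq_sym k) mulrC.
have E i : pd i (fun y : 'rV[R]_n => y 0 k) = fun _ => (i == k)%:R.
  by apply/funext => y; have [_ <-] := D i y.
split; last exact: E.
split; first by move=> i y; have [] := D i y.
by move=> i; rewrite E; exact: cst_continuous.
Qed.

Lemma C1_lin n (a b : R) (f g : 'rV[R]_n -> R) : C1fun f -> C1fun g ->
  C1fun (fun y => a * f y + b * g y) /\
  forall i, pd i (fun y => a * f y + b * g y) = fun y => a * pd i f y + b * pd i g y.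
Proof.
move=> [df cf] [dg cg].
have E0 : (fun y => a * f y + b * g y) = (a \*: f) + (b \*: g) by [].
have E i : pd i (fun y => a * f y + b * g y) = fun y => a * pd i f y + b * pd i g y.
  apply/funext => y.
  by rewrite /pd E0 (deriveD (derivableZ (df i y)) (derivableZ (dg i y))) !deriveZ.
split; last exact: E.
split=> [i y|i].
  by rewrite E0; exact: (derivableD (derivableZ (df i y)) (derivableZ (dg i y))).
rewrite E => y; apply: (cvgD (F := nbhs y)); apply: (cvgM (F := nbhs y)).
- exact: cst_continuous.
- exact: cf.
- exact: cst_continuous.
- exact: cg.
Qed.

Lemma C1_sum n (I : Type) (s : seq I) (f : I -> 'rV[R]_n -> R) :
  (forall i, C1fun (f i)) -> C1fun (fun y => \sum_(i <- s) f i y).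
Proof.
move=> Cf; elim: s => [|i s IH].
  by under eq_fun do rewrite big_nil; have [] := C1_cst n 0.
under eq_fun do rewrite big_cons -[f i _]mul1r -[\sum_(_ <- _) _]mul1r.
exact: (C1_lin 1 1 (Cf i) IH).1.
Qed.

Lemma C1_mul n (f g : 'rV[R]_n -> R) : C1fun f -> C1fun g -> C1fun (fun y => f y * g y).
Proof.
move=> Cf Cg; have cf := C1_continuous Cf; have cg := C1_continuous Cg.
case: Cf Cg => [df df'] [dg dg'].
have E0 : (fun y => f y * g y) = f * g by [].
split=> [i y|i]; first by rewrite E0; exact: derivableM.
have -> : pd i (fun y => f y * g y) = fun y => f y * pd i g y + g y * pd i f y.
  by apply/funext => y; rewrite /pd E0 deriveM.
move=> y; apply: (cvgD (F := nbhs y)); apply: (cvgM (F := nbhs y)).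
- exact: cf.
- exact: dg'.
- exact: cg.
- exact: df'.
Qed.

Lemma C1_inv n (f : 'rV[R]_n -> R) : C1fun f -> (forall y, f y != 0) ->
  C1fun (fun y => (f y)^-1).
Proof.
move=> Cf f0; have cf := C1_continuous Cf; case: Cf => [df df'].
split=> [i y|i]; first exact: derivableV.
have -> : pd i (fun y => (f y)^-1) = fun y => - (f y ^- 2) * pd i f y.
  by apply/funext => y; rewrite /pd deriveV.
move=> y; apply: (cvgM (F := nbhs y)); last exact: df'.
apply: (cvgN (F := nbhs y)); apply: (cvgV (F := nbhs y)); first by rewrite expf_neq0.
by apply: (cvgM (F := nbhs y)); exact: cf.
Qed.

Lemma C1_scalar n (h h' : R -> R) (f : 'rV[R]_n -> R) :
  (forall u : R, is_derive u 1 h (h' u)) -> continuous h' -> C1fun f ->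
  C1fun (fun y => h (f y)) /\ forall i, pd i (fun y => h (f y)) = fun y => h' (f y) * pd i f y.
Proof.
move=> dh ch' Cf; have cf := C1_continuous Cf; case: Cf => [df df'].
have D i y : derivable (fun y => h (f y)) y (ebasis R i) /\
    'D_(ebasis R i) (fun y => h (f y)) y = h' (f y) * pd i f y.
  apply: derivable_lineP; have := is_derive_line (y := y) (t := 0) (df i (y + 0 *: ebasis R i)).
  rewrite scale0r addr0 => L.
  have -> : h' (f y) = h' (f (y + 0 *: ebasis R i)) by rewrite scale0r addr0.
  exact: (is_derive1_comp (f := h) (g := fun u => f (y + u *: ebasis R i))).
have E i : pd i (fun y => h (f y)) = fun y => h' (f y) * pd i f y.
  by apply/funext => y; have [_ <-] := D i y.
split; last exact: E.
split; first by move=> i y; have [] := D i y.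
move=> i; rewrite E => y; apply: (cvgM (F := nbhs y)); last exact: df'.
exact: (cvg_comp _ _ (cf y) (ch' (f y))).
Qed.

(** Lets the C2 closure properties follow from applying the C1 ones to the formulas for the
    partials. *)
Lemma C2funP n (f : 'rV[R]_n -> R) : C2fun f <-> C1fun f /\ forall i, C1fun (pd i f).
Proof.
split=> [[cf [df [cdf [ddf cddf]]]]|[C1 C2]].
  by split; [split|move=> i; split=> [j y|j]; [exact: ddf|exact: cddf]].
split; first exact: C1_continuous.
case: (C1) => df cdf; split; first exact: df.
split; first exact: cdf.
by split=> [i j y|i j]; have [H1 H2] := C2 i; [exact: H1|exact: H2].
Qed.

Lemma C2_comp n m (K : 'rV[R]_m -> R) (F : 'rV[R]_n -> 'rV[R]_m) :
  C2fun K -> (forall j, C2fun (fun z => F z 0 j)) -> C2fun (fun z => K (F z)).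
Proof.
move=> /C2funP[K1 K2] CF; have F1 j : C1fun (fun z => F z 0 j) by have /C2funP[] := CF j.
have [C1 E] := C1_comp K1 F1.
apply/C2funP; split=> // i; rewrite E; apply: C1_sum => j.
apply: C1_mul; first by have /C2funP[_] := CF j.
by have [] := C1_comp (K2 j) F1.
Qed.

Lemma C2_lin n (a b : R) (f g : 'rV[R]_n -> R) : C2fun f -> C2fun g ->
  C2fun (fun y => a * f y + b * g y).
Proof.
move=> /C2funP[f1 f2] /C2funP[g1 g2]; have [C E] := C1_lin a b f1 g1.
apply/C2funP; split; first exact: C.
move=> i; rewrite E; exact: (C1_lin a b (f2 i) (g2 i)).1.
Qed.

Lemma C2_coor n (k : 'I_n) : C2fun (fun y : 'rV[R]_n => y 0 k).
Proof.
have [C E] := C1_coor k; apply/C2funP; split=> // i; rewrite E.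
by have [] := C1_cst n ((i == k)%:R).
Qed.

Lemma C2_cst n c : C2fun (fun y : 'rV[R]_n => c).
Proof.
have [C E] := C1_cst n c; apply/C2funP; split=> // i; rewrite E.
by have [] := C1_cst n 0.
Qed.

Lemma C2_scalar_coor n (k : 'I_n) (h h' h'' : R -> R) :
  (forall u : R, is_derive u 1 h (h' u)) -> (forall u : R, is_derive u 1 h' (h'' u)) ->
  continuous h'' -> C2fun (fun y : 'rV[R]_n => h (y 0 k)) /\
  forall i, pd i (fun y : 'rV[R]_n => h (y 0 k)) = fun y => h' (y 0 k) * (i == k)%:R.
Proof.
move=> dh dh' ch''; have [C E] := C1_coor k.
have ch' : continuous h'.
  by move=> u; apply: differentiable_continuous; apply/derivable1_diffP; have [] := dh' u.
have [C1 E1] := C1_scalar dh ch' C; have [C1' E1'] := C1_scalar dh' ch'' C.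
have E2 i : pd i (fun y : 'rV[R]_n => h (y 0 k)) = fun y => h' (y 0 k) * (i == k)%:R.
  by rewrite E1 E.
split; last exact: E2.
apply/C2funP; split; first exact: C1.
move=> i; rewrite E2; apply: C1_mul; first exact: C1'.
exact: (C1_cst n ((i == k)%:R)).1.
Qed.

End c1.

(** * Cutoff near a critical point *)

Section cutoff.
Context {R : realType}.

(** Meant for powers of [ppart]: a quadratic error bound is checked by cases on signs, with no
    one-sided limits at the knots. *)
Lemma is_derive_quad (f : R -> R) (t l C : R) :
  (forall h, `|h| <= 1 -> `|f (t + h) - f t - l * h| <= C * h ^+ 2) -> is_derive t 1 f l.
Proof.
move=> H.
suff L : h^-1 *: (f (h *: 1 + t) - f t) @[h --> (0 : R)^'] --> l.
  apply: DeriveDef; first by apply/cvg_ex; eexists; exact: L.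
  exact: (cvg_lim _ L).
apply/cvgrPdist_lt => e e0.
have C1 : 0 < `|C| + 1 by rewrite ltr_wpDl.
have d0 : 0 < Num.min 1 (e / (`|C| + 1)) by rewrite lt_min ltr01 divr_gt0.
exists (Num.min 1 (e / (`|C| + 1))) => // h hd hn0.
have {}hd : `|h| < Num.min 1 (e / (`|C| + 1)) by move: hd; rewrite /ball_ /= sub0r normrN.
move: hd; rewrite lt_min => /andP[h1 he].
have := H h (ltW h1); rewrite [h *: 1]mulr1 (addrC h) => Hh.
have -> : l - h^-1 *: (f (t + h) - f t) = - (h^-1 * (f (t + h) - f t - l * h)).
  by rewrite /GRing.scale/=; field.
rewrite normrN normrM normfV ltr_pdivrMl ?normr_gt0//.
apply: (le_lt_trans Hh); rewrite -real_normK ?num_real// expr2 mulrCA ltr_pM2l ?normr_gt0//.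
move: he; rewrite ltr_pdivlMr// => he.
have := ler_norm C; have := normr_ge0 h; nra.
Qed.

Definition ppart (t : R) : R := Num.max t 0.

Lemma is_derive_ppart2 (t : R) : is_derive t 1 (fun u => ppart u ^+ 2) (2 * ppart t).
Proof.
apply: (@is_derive_quad _ _ _ 3) => h _; rewrite /ppart ler_norml.
case: (leP (t + h) 0) => h1; case: (leP t 0) => h2; apply/andP; split; nra.
Qed.

Lemma is_derive_ppart3 (t : R) : is_derive t 1 (fun u => ppart u ^+ 3) (3 * ppart t ^+ 2).
Proof.
apply: (@is_derive_quad _ _ _ (1 + 6 * `|t|)) => h; rewrite /ppart !ler_norml => /andP[hl hr].
have t1 : t <= `|t| := ler_norm t.
have t0 := normr_ge0 t.
have hh : 0 <= h ^+ 2 := sqr_ge0 h.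
have ht : 0 <= `|t| * h ^+ 2 by rewrite mulr_ge0.
case: (leP (t + h) 0) => h1; case: (leP t 0) => h2.
- by rewrite !expr0n/= mulr0 mul0r !subr0 oppr_le0 andbb; nra.
- rewrite gtr0_norm// in ht *.
  have e1 : t * (- h) <= h ^+ 2 by nra.
  have e2 : 0 <= t * (h ^+ 2 - t * (- h)) by rewrite mulr_ge0 ?subr_ge0// ltW.
  have e3 : 0 <= t * (t * (- h - t)) by rewrite !mulr_ge0 ?(ltW h2)//; lra.
  by rewrite expr0n/=; apply/andP; split; nra.
- have u1 : t + h <= h by lra.
  have e1 : (t + h) ^+ 2 <= h ^+ 2 by nra.
  have e2 : 0 <= (t + h) ^+ 2 * (1 - (t + h)) by rewrite mulr_ge0 ?sqr_ge0//; lra.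
  have e3 : 0 <= (t + h) ^+ 3 by rewrite exprn_ge0// ltW.
  by rewrite !expr0n/= mulr0 mul0r !subr0; apply/andP; split; nra.
- have tt : `|t| = t by rewrite gtr0_norm.
  rewrite tt.
  have e1 : 0 <= h ^+ 2 * (1 - h) by rewrite mulr_ge0//; lra.
  have e2 : 0 <= h ^+ 2 * (1 + h) by rewrite mulr_ge0//; lra.
  have e3 : 0 <= t * h ^+ 2 by rewrite mulr_ge0// ltW.
  by apply/andP; split; nra.
Qed.

(** The second primitive of the hat function [spline2] supported on [[1, 3]]: it vanishes up to 1
    and equals [u - 2] from 3 on. *)
Definition spline (u : R) : R :=
  6^-1 * (ppart (u - 1) ^+ 3 - 2 * ppart (u - 2) ^+ 3 + ppart (u - 3) ^+ 3).
Definition spline1 (u : R) : R :=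
  2^-1 * (ppart (u - 1) ^+ 2 - 2 * ppart (u - 2) ^+ 2 + ppart (u - 3) ^+ 2).
Definition spline2 (u : R) : R := ppart (u - 1) - 2 * ppart (u - 2) + ppart (u - 3).

Lemma is_derive_shift_fun (f f' : R -> R) (k u : R) : (forall t : R, is_derive t 1 f (f' t)) ->
  is_derive u 1 (fun v => f (v - k)) (f' (u - k)).
Proof.
move=> df; rewrite -[f' _]mulr1.
apply: (is_derive1_comp (f := f) (g := fun v => v - k)) => //.
have -> : (fun v => v - k) = @id R + cst (- k) by [].
by apply: is_derive_eq; rewrite subr0.
Qed.

Lemma is_derive_spline (u : R) : is_derive u 1 spline (spline1 u).
Proof.
have d1 := is_derive_shift_fun 1 u is_derive_ppart3.
have d2 := is_derive_shift_fun 2 u is_derive_ppart3.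
have d3 := is_derive_shift_fun 3 u is_derive_ppart3.
rewrite /= in d1 d2 d3.
have -> : spline = 6^-1 \*: ((fun v => ppart (v - 1) ^+ 3) - 2 \*: (fun v => ppart (v - 2) ^+ 3)
   + (fun v => ppart (v - 3) ^+ 3)) by [].
by apply: is_derive_eq; rewrite /GRing.scale /= /spline1; field.
Qed.

Lemma is_derive_spline1 (u : R) : is_derive u 1 spline1 (spline2 u).
Proof.
have d1 := is_derive_shift_fun 1 u is_derive_ppart2.
have d2 := is_derive_shift_fun 2 u is_derive_ppart2.
have d3 := is_derive_shift_fun 3 u is_derive_ppart2.
rewrite /= in d1 d2 d3.
have -> : spline1 = 2^-1 \*: ((fun v => ppart (v - 1) ^+ 2) - 2 \*: (fun v => ppart (v - 2) ^+ 2)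
   + (fun v => ppart (v - 3) ^+ 2)) by [].
by apply: is_derive_eq; rewrite /GRing.scale /= /spline2; field.
Qed.

Lemma continuous_ppart : continuous ppart.
Proof. by move=> t; apply: continuous_max; [exact: cvg_id|exact: cvg_cst]. Qed.

Lemma continuous_spline2 : continuous spline2.
Proof.
have c k : continuous (fun u : R => ppart (u - k)).
  move=> t; apply: (cvg_comp (fun u => u - k) ppart); last exact: continuous_ppart.
  by apply: cvgB; [exact: cvg_id|exact: cvg_cst].
move=> t; apply: cvgD; last exact: c.
by apply: cvgB; [exact: c|apply: cvgM; [exact: cvg_cst|exact: c]].
Qed.

(* A C2 odd function equal to [u] for [|u| <= e] and constant for [|u| >= 3 e]. *)
Definition trunc3 (e u : R) : R := e * (u / e - spline (u / e) + spline (- (u / e))).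
Definition trunc3' (e u : R) : R := 1 - spline1 (u / e) - spline1 (- (u / e)).
Definition trunc3'' (e u : R) : R := e^-1 * (spline2 (- (u / e)) - spline2 (u / e)).

Lemma is_derive_lincomp (f f' : R -> R) (c u : R) : (forall t : R, is_derive t 1 f (f' t)) ->
  is_derive u 1 (fun v => f (c * v)) (c * f' (c * u)).
Proof.
move=> df; rewrite mulrC.
apply: (is_derive1_comp (f := f) (g := fun v => c * v)) => //.
have -> : (fun v => c * v) = c \*: @id R by [].
by apply: is_derive_eq; rewrite [_ *: _]mulr1.
Qed.

Lemma is_derive_trunc3 (e u : R) : e != 0 -> is_derive u 1 (trunc3 e) (trunc3' e u).
Proof.
move=> e0.
have d1 := is_derive_lincomp e^-1 u is_derive_spline.
have d2 := is_derive_lincomp (- e^-1) u is_derive_spline.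
rewrite /= in d1 d2.
have -> : trunc3 e = @id R - e \*: (fun v => spline (e^-1 * v)) +
    e \*: (fun v => spline (- e^-1 * v)).
  apply/funext => v; rewrite /trunc3 !fctE /= /GRing.scale /= (mulrC v) -(mulNr e^-1 v).
  by field.
by apply: is_derive_eq; rewrite /GRing.scale /= /trunc3' (mulrC u) -(mulNr e^-1 u); field.
Qed.

Lemma is_derive_trunc3' (e u : R) : e != 0 -> is_derive u 1 (trunc3' e) (trunc3'' e u).
Proof.
move=> e0.
have d1 := is_derive_lincomp e^-1 u is_derive_spline1.
have d2 := is_derive_lincomp (- e^-1) u is_derive_spline1.
rewrite /= in d1 d2.
have -> : trunc3' e = cst 1 - (fun v => spline1 (e^-1 * v)) - (fun v => spline1 (- e^-1 * v)).
  by apply/funext => v; rewrite /trunc3' !fctE /= (mulrC v) -(mulNr e^-1 v).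
by apply: is_derive_eq; rewrite /trunc3'' (mulrC u) -(mulNr e^-1 u); field.
Qed.

Lemma continuous_trunc3'' e : continuous (trunc3'' e).
Proof.
have c k : continuous (fun u : R => spline2 (u * k)).
  move=> t; apply: (cvg_comp (fun u => u * k) spline2); last exact: continuous_spline2.
  by apply: cvgM; [exact: cvg_id|exact: cvg_cst].
move=> t; apply: cvgM; first exact: cvg_cst.
apply: cvgB; last exact: c.
by under eq_fun do rewrite -mulrN; rewrite -mulrN; exact: c.
Qed.

Lemma trunc3_id e u : 0 < e -> `|u| <= e -> trunc3 e u = u.
Proof.
move=> e0 ue; have : `|u / e| <= 1 by rewrite normf_div (gtr0_norm e0) ler_pdivrMr// mul1r.
rewrite ler_norml => /andP[h1 h2].
rewrite /trunc3 /spline /ppart.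
have m k v : 1 <= k -> v <= 1 -> Num.max (v - k) 0 = 0 :> R.
  by move=> k1 v1; apply/max_idPr; lra.
rewrite !m; try lra.
by rewrite !expr0n /=; field; rewrite gt_eqF.
Qed.

Lemma trunc3_bound e u : 0 < e -> `|trunc3 e u| <= 2 * e.
Proof.
move=> e0; rewrite /trunc3 normrM (gtr0_norm e0) mulrC ler_pM2r//.
move: (u / e) => {u} u; rewrite /spline /ppart ler_norml.
wlog u0 : u / 0 <= u.
  move=> H; case: (leP 0 u) => u0; first exact: H.
  have := H (- u); rewrite opprK oppr_ge0 => /(_ (ltW u0)) /andP[a b].
  by apply/andP; split; lra.
have m k : 1 <= k -> Num.max (- u - k) 0 = 0 :> R.
  by move=> k1; apply/max_idPr; lra.
rewrite !m; try lra.
have z k : u <= k -> Num.max (u - k) 0 = 0 :> R by move=> uk; apply/max_idPr; lra.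
have p k : k <= u -> Num.max (u - k) 0 = u - k :> R by move=> uk; apply/max_idPl; lra.
have [h1|h1] := leP u 1.
  by rewrite !z; try lra; rewrite !expr0n /=; lra.
have [h2|h2] := leP u 2.
  rewrite (p 1); last lra.
  rewrite !z; try lra; rewrite !expr0n /=.
  have a0 : 0 <= (u - 1) ^+ 3 by rewrite exprn_ge0//; lra.
  have a1 : (u - 1) ^+ 3 <= 1 by rewrite exprn_ile1//; lra.
  by lra.
have [h3|h3] := leP u 3.
  rewrite (p 1); last lra.
  rewrite (p 2); last lra.
  rewrite z// !expr0n /=.
  have a0 : 0 <= (3 - u) ^+ 3 by rewrite exprn_ge0//; lra.
  have a1 : (3 - u) ^+ 3 <= 1 by rewrite exprn_ile1//; lra.
  have E : u - 6^-1 * ((u - 1) ^+ 3 - 2 * (u - 2) ^+ 3 + 0) + 6^-1 * (0 - 2 * 0 + 0) =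
      2 - 6^-1 * (3 - u) ^+ 3 by field.
  by rewrite E; lra.
by rewrite !p; lra.
Qed.

Lemma trunc3'_bound e u : `|trunc3' e u| <= 1.
Proof.
rewrite /trunc3'; move: (u / e) => {u} u; rewrite /spline1 /ppart ler_norml.
wlog u0 : u / 0 <= u.
  move=> H; case: (leP 0 u) => u0; first exact: H.
  have := H (- u); rewrite opprK oppr_ge0 => /(_ (ltW u0)) /andP[a b].
  by apply/andP; split; lra.
have m k : 1 <= k -> Num.max (- u - k) 0 = 0 :> R.
  by move=> k1; apply/max_idPr; lra.
rewrite !m; try lra.
have z k : u <= k -> Num.max (u - k) 0 = 0 :> R by move=> uk; apply/max_idPr; lra.
have p k : k <= u -> Num.max (u - k) 0 = u - k :> R by move=> uk; apply/max_idPl; lra.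
have [h1|h1] := leP u 1.
  by rewrite !z; try lra; rewrite !expr0n /=; lra.
have [h2|h2] := leP u 2.
  rewrite (p 1); last lra.
  rewrite !z; try lra; rewrite !expr0n /=.
  have a0 : 0 <= (u - 1) ^+ 2 by rewrite exprn_ge0//; lra.
  have a1 : (u - 1) ^+ 2 <= 1 by rewrite exprn_ile1//; lra.
  by lra.
have [h3|h3] := leP u 3.
  rewrite (p 1); last lra.
  rewrite (p 2); last lra.
  rewrite z// !expr0n /=.
  have a0 : 0 <= (3 - u) ^+ 2 by rewrite exprn_ge0//; lra.
  have a1 : (3 - u) ^+ 2 <= 1 by rewrite exprn_ile1//; lra.
  have E : 1 - 2^-1 * ((u - 1) ^+ 2 - 2 * (u - 2) ^+ 2 + 0) - 2^-1 * (0 - 2 * 0 + 0) =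
      2^-1 * (3 - u) ^+ 2 by field.
  by rewrite E; lra.
by rewrite !p; lra.
Qed.

(* [F] is [f] composed with [trunc3 e] in each coordinate: it only sees [f] near the
   critical point [0], where the gradient is small. *)
Lemma cutoff m (f : 'rV[R]_m -> R) (k : R) : C2fun f -> (forall i, pd i f 0 = 0) -> 0 < k ->
  exists (F : 'rV[R]_m -> R) (e : R), [/\ C2fun F, 0 < e,
    forall z : 'rV[R]_m, (forall j, `|z 0 j| <= e) -> F z = f z,
    forall i z, `|pd i F z| <= k & forall i, pd i F 0 = 0].
Proof.
move=> C2f f0 k0; have [C1f C1pf] := (C2funP f).1 C2f.
have cpf i : continuous (pd i f) by have [_] := C1f; exact.
have : \forall z \near (0 : 'rV[R]_m), forall i, `|pd i f 0 - pd i f z| < k.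
  apply: (@filter_forall _ _ _ (nbhs (0 : 'rV[R]_m))) => i.
  by move/(cvgrPdist_lt (F := nbhs (0 : 'rV[R]_m))) : (cpf i 0); apply.
move=> /nbhs_ballP[d /= d0 Hd].
(* The truncation takes values of size at most [2 e < d], hence stays in the ball where the gradient
   is small. *)
pose e := d / 3; have e0 : 0 < e by rewrite divr_gt0.
have en0 : e != 0 by rewrite gt_eqF.
pose T (z : 'rV[R]_m) : 'rV[R]_m := \row_j trunc3 e (z 0 j).
have HT (j : 'I_m) := C2_scalar_coor j (fun u => is_derive_trunc3 u en0)
  (fun u => is_derive_trunc3' u en0) (@continuous_trunc3'' e).
have TE j : (fun z => T z 0 j) = (fun z => trunc3 e (z 0 j)).
  by apply/funext => z; rewrite mxE.
have CT j : C2fun (fun z => T z 0 j) by rewrite TE; exact: (HT j).1.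
have [_ E] := C1_comp C1f (fun j => ((C2funP _).1 (CT j)).1).
have {}E i z : pd i (fun z => f (T z)) z = trunc3' e (z 0 i) * pd i f (T z).
  rewrite E (bigD1 i)//= big1 ?addr0.
    by rewrite TE; have [_ ->] := HT i; rewrite eqxx mulr1.
  by move=> j ji; rewrite TE; have [_ ->] := HT j; rewrite eq_sym (negbTE ji) mulr0 mul0r.
have Tb z : ball (0 : 'rV[R]_m) d (T z).
  split=> // i j; rewrite ord1 -ball_normE /= !mxE sub0r normrN.
  by rewrite (le_lt_trans (trunc3_bound _ e0))// /e; lra.
have fb i z : `|pd i f (T z)| < k.
  by have := Hd _ (Tb z) i; rewrite f0 sub0r normrN.
exists (fun z => f (T z)), e; split.
- exact: (C2_comp C2f CT).
- exact: e0.
- move=> z ze; congr f; apply/rowP => j; by rewrite mxE trunc3_id.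
- move=> i z; rewrite E normrM -[leRHS]mul1r ler_pM// ?trunc3'_bound//.
  exact: ltW.
- move=> i; rewrite E; have -> : T 0 = 0.
    by apply/rowP => j; rewrite !mxE trunc3_id// normr0 ltW.
  by rewrite f0 mulr0.
Qed.

End cutoff.

(** * Existence of adapted graph coordinates *)

Section implicit.
Context {R : realType}.

Definition rconsrv n (y : 'rV[R]_n) (t : R) : 'rV[R]_n.+1 :=
  \row_j oapp (fun i => y 0 i) t (unlift ord_max j).

Local Notation wid i := (widen_ord (leqnSn _) i).

Lemma wid_lift n (i : 'I_n) : widen_ord (leqnSn n) i = lift ord_max i.
Proof. by apply/val_inj; rewrite /= /bump leqNgt ltn_ord. Qed.

Lemma rconsrv_max n (y : 'rV[R]_n) t : rconsrv y t 0 ord_max = t.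
Proof. by rewrite mxE unlift_none. Qed.

Lemma rconsrv_wid n (y : 'rV[R]_n) t (i : 'I_n) : rconsrv y t 0 (wid i) = y 0 i.
Proof. by rewrite mxE wid_lift liftK. Qed.

Lemma eq_rV_last n (u v : 'rV[R]_n.+1) :
  (forall i : 'I_n, u 0 (wid i) = v 0 (wid i)) -> u 0 ord_max = v 0 ord_max -> u = v.
Proof.
move=> H Hm; apply/rowP => j; case: (unliftP ord_max j) => [i|] -> //.
by rewrite -wid_lift.
Qed.

Lemma rconsrv_eta n (z : 'rV[R]_n.+1) : rconsrv (yprime z) (ylast z) = z.
Proof.
by apply: eq_rV_last => [i|]; rewrite ?rconsrv_wid ?rconsrv_max ?yprimeE ?ylastE.
Qed.

Lemma rconsrvD n (y z : 'rV[R]_n) s t :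
  rconsrv y s + rconsrv z t = rconsrv (y + z) (s + t).
Proof. by apply: eq_rV_last => [i|]; rewrite mxE ?rconsrv_wid ?rconsrv_max// mxE. Qed.

Lemma rconsrv_ebasis n (s : R) : s *: ebasis R (ord_max : 'I_n.+1) = rconsrv 0 s.
Proof.
apply: eq_rV_last => [i|]; rewrite mxE ebasisE ?rconsrv_wid ?rconsrv_max ?eqxx ?mulr1//.
by rewrite mxE (_ : ord_max == _ = false) ?mulr0// wid_lift; exact/negbTE/neq_lift.
Qed.

Variables (n : nat) (G : 'rV[R]_n.+1 -> R) (c : R).
Hypothesis C2G : C2fun G.
Hypothesis c0 : 0 < c.
Hypothesis Gc : forall z, c <= pd ord_max G z.

Let C1G : C1fun G. Proof. exact: ((C2funP G).1 C2G).1. Qed.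
Let dG i z : derivable G z (ebasis R i). Proof. exact: C1G.1. Qed.

Let vertical y t u : u <= t -> c * (t - u) <= G (rconsrv y t) - G (rconsrv y u).
Proof.
move=> ut.
have [th _] := @mvt01 R (fun s => G (rconsrv y u + s *: ebasis R ord_max))
  (fun s => pd ord_max G (rconsrv y u + s *: ebasis R ord_max)) (t - u)
  (fun s => is_derive_line (@dG ord_max _)).
rewrite scale0r addr0 rconsrv_ebasis rconsrvD addr0 (addrC u) subrK => ->.
by rewrite mulrC ler_wpM2l ?subr_ge0.
Qed.

Let cG : continuous G. Proof. exact: C1_continuous. Qed.

Let zero_ex y : exists t, G (rconsrv y t) = 0.
Proof.
(* Moving vertically by [A] changes [G] by at least [|G (y, 0)|], so [G] changes sign between [-A]
   and [A]. *)
pose A := `|G (rconsrv y 0)| / c.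
have A0 : 0 <= A by rewrite divr_ge0// ltW.
have cA : c * A = `|G (rconsrv y 0)| by rewrite /A mulrC divfK// gt_eqF.
have := vertical y A0; rewrite subr0 cA => h1.
have := @vertical y 0 (- A); rewrite oppr_le0 => /(_ A0); rewrite sub0r opprK cA => h2.
have g1 := ler_norm (G (rconsrv y 0)).
have g2 : - G (rconsrv y 0) <= `|G (rconsrv y 0)| by rewrite -normrN ler_norm.
have ct : continuous (fun t => G (rconsrv y t)).
  move=> t; apply: (cvg_comp (rconsrv y) G); last exact: cG.
  apply: cvg_rVP => j; case: (unliftP ord_max j) => [i|] ->.
    by rewrite -wid_lift; under eq_fun do rewrite rconsrv_wid; rewrite rconsrv_wid; exact: cvg_cst.
  by under eq_fun do rewrite rconsrv_max; rewrite rconsrv_max; exact: cvg_id.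
have [|||t _ Ht] := @IVT R (fun t => G (rconsrv y t)) (- A) A 0.
- by rewrite (le_trans _ A0)// oppr_le0.
- by apply: continuous_subspaceT.
- by rewrite ge_min le_max; apply/andP; split; apply/orP; [left|right]; lra.
- by exists t.
Qed.

(** The uniform lower bound [Gc] on the vertical derivative makes the zero set a graph over the
    whole hyperplane, as required because [C2fun] is a global notion. *)
Lemma implicit_function : exists g : 'rV[R]_n -> R,
  [/\ C2fun g, forall y, G (rconsrv y (g y)) = 0,
      forall y t, G (rconsrv y t) = 0 -> t = g y,
      forall z, G z <= 0 <-> ylast z <= g (yprime z) &
      forall i y, pd i g y =
        - (pd (wid i) G (rconsrv y (g y)) / pd ord_max G (rconsrv y (g y)))].
Proof.
have [g Gg] := choice zero_ex.
have b0 z : pd ord_max G z != 0 by rewrite gt_eqF// (lt_le_trans c0 (Gc z)).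
have sgn z : G z <= 0 <-> ylast z <= g (yprime z).
  rewrite -{1}(rconsrv_eta z); set y := yprime z; set t := ylast z; split=> [Gz|tg].
    rewrite leNgt; apply/negP => gt; have := vertical y (ltW gt).
    by rewrite Gg subr0 leNgt => /negP; apply; rewrite (le_lt_trans Gz)// mulr_gt0// subr_gt0.
  by have := vertical y tg; rewrite Gg; have := mulr_ge0 (ltW c0); move=> /(_ (g y - t));
    rewrite subr_ge0 => /(_ tg); lra.
have cg : continuous g.
  move=> y; apply/continuous_rVP => e e0.
  have /continuous_rVP/(_ (c * e) (mulr_gt0 c0 e0))[d d0 Hd] := cG (x := rconsrv y (g y)).
  exists d => // xi xid.
  have /Hd : forall j, `|rconsrv xi 0 0 j| < d.
    move=> j; case: (unliftP ord_max j) => [i|] ->; first by rewrite -wid_lift rconsrv_wid.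
    by rewrite rconsrv_max normr0.
  rewrite rconsrvD addr0 Gg subr0 => H.
  rewrite -(ltr_pM2l c0); apply: le_lt_trans H.
  case: (leP (g y) (g (y + xi))) => hg.
    have := vertical (y + xi) hg; rewrite Gg sub0r => h.
    by rewrite ger0_norm ?subr_ge0// (le_trans h)// -normrN ler_norm.
  have := vertical (y + xi) (ltW hg); rewrite Gg subr0 => h.
  by rewrite ltr0_norm ?subr_lt0// opprB (le_trans h)// ler_norm.
(* [G] vanishes at both ends of the increment [DD h], so the expansion of [mv_path] can be solved
   for the increment of [g]. *)
have L i y : h^-1 *: (g (h *: ebasis R i + y) - g y) @[h --> (0 : R)^'] -->
    - (pd (wid i) G (rconsrv y (g y)) / pd ord_max G (rconsrv y (g y))).
  set p := rconsrv y (g y).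
  pose DD (h : R) := rconsrv (h *: ebasis R i) (g (h *: ebasis R i + y) - g y).
  have H h : exists xi : 'I_n.+1 -> 'rV[R]_n.+1, (forall k j, `|xi k 0 j| <= `|DD h 0 j|) /\
      G (p + DD h) - G p = \sum_k DD h 0 k * pd k G (p + xi k).
    by have [xi] := mv_path p (DD h) dG; exists xi.
  have [xi Hxi] := choice H.
  have ch (u : R) : h * u @[h --> (0 : R)^'] --> (0 : R).
    have hi : (h : R) @[h --> (0 : R)^'] --> (0 : R) by exact: cvg_within.
    have hu := cvgM hi (@cvg_cst _ u _ ((0 : R)^') _).
    rewrite mul0r in hu; exact: hu.
  have D0 j : DD h 0 j @[h --> (0 : R)^'] --> (0 : R).
    case: (unliftP ord_max j) => [k|] ->.
      by rewrite -wid_lift; under eq_fun do rewrite rconsrv_wid mxE; exact: ch.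
    under eq_fun do rewrite rconsrv_max.
    have cy : (h *: ebasis R i + y) @[h --> (0 : R)^'] --> y.
      apply: cvg_rVP => k; under eq_fun do rewrite 2!mxE.
      have hk := cvgD (ch (ebasis R i 0 k)) (@cvg_cst _ (y 0 k) _ ((0 : R)^') _).
      rewrite add0r in hk; exact: hk.
    have hg := cvgB (cvg_comp _ _ cy (cg y)) (@cvg_cst _ (g y) _ ((0 : R)^') _).
    rewrite subrr in hg; exact: hg.
  have P k : pd k G (p + xi h k) @[h --> (0 : R)^'] --> pd k G p.
    apply: cvg_pd_path => //; first exact: C1G.2.
    by move=> h j; have [+ _] := Hxi h; exact.
  suff E : {near (0 : R)^', (fun h : R => - (pd (wid i) G (p + xi h (wid i)) /
      pd ord_max G (p + xi h ord_max))) =1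
      (fun h : R => h^-1 *: (g (h *: ebasis R i + y) - g y))}.
    apply: cvg_trans (near_eq_cvg E) _.
    apply: cvgN; apply: cvgM; first exact: P.
    by apply: cvgV; [exact: b0|exact: P].
  exists 1 => //= h _ hn0.
  have [_] := Hxi h.
  have -> : p + DD h = rconsrv (h *: ebasis R i + y) (g (h *: ebasis R i + y)).
    by rewrite /p /DD rconsrvD addrC (addrC (g y)) subrK.
  rewrite {1}/p !Gg subrr big_ord_recr /= {2}/DD rconsrv_max.
  rewrite (bigD1 i)//= big1 ?addr0; last first.
    by move=> k ki; rewrite /DD rconsrv_wid mxE ebasisE eq_sym (negbTE ki) mulr0 mul0r.
  rewrite /DD rconsrv_wid mxE ebasisE eqxx mulr1.
  set A := pd _ _ _; set B := pd _ _ _; set dg := g _ - g y => E.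
  have B0 : B != 0 by exact: b0.
  have -> : dg = - (h * A) / B.
    have : dg * B = - (h * A) by lra.
    by move=> <-; rewrite mulfK.
  by rewrite /GRing.scale/=; field; rewrite hn0 B0.
have E i : pd i g = fun y =>
    - (pd (wid i) G (rconsrv y (g y)) / pd ord_max G (rconsrv y (g y))).
  by apply/funext => y; exact: (cvg_lim _ (L i y)).
have dg i y : derivable g y (ebasis R i).
  by apply/cvg_ex; eexists; exact: L.
have C1pG k : C1fun (pd k G) by exact: ((C2funP G).1 C2G).2.
have comps (Hg : C1fun g) j : C1fun (fun y => rconsrv y (g y) 0 j).
  case: (unliftP ord_max j) => [i|] ->.
    by rewrite -wid_lift; under eq_fun do rewrite rconsrv_wid; exact: (C1_coor i).1.
  by under eq_fun do rewrite rconsrv_max.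
have crc : continuous (fun y => rconsrv y (g y)).
  move=> y; apply: (cvg_rVP (F := nbhs y)) => j; case: (unliftP ord_max j) => [i|] ->.
    rewrite -wid_lift; under eq_fun do rewrite rconsrv_wid; rewrite rconsrv_wid.
    exact: (C1_continuous (C1_coor i).1).
  by under eq_fun do rewrite rconsrv_max; rewrite rconsrv_max; exact: cg.
have C1g : C1fun g.
  split; first exact: dg.
  move=> i; rewrite E => y.
  apply: (cvgN (F := nbhs y)); apply: (cvgM (F := nbhs y)).
    apply: (cvg_comp (fun y => rconsrv y (g y)) (pd (wid i) G)); first exact: crc.
    exact: C1G.2.
  apply: (cvgV (F := nbhs y)); first exact: b0.
  apply: (cvg_comp (fun y => rconsrv y (g y)) (pd ord_max G)); first exact: crc.
  exact: C1G.2.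
exists g; split.
- apply/C2funP; split; first exact: C1g.
  move=> i; rewrite E.
  (* Bootstrap: once [g] is C1, the formula for its partials is itself C1. *)
  have K k : C1fun (fun y => pd k G (rconsrv y (g y))).
    exact: (C1_comp (C1pG k) (comps C1g)).1.
  have Q : C1fun (fun y => pd (wid i) G (rconsrv y (g y)) * (pd ord_max G (rconsrv y (g y)))^-1).
    apply: C1_mul; first exact: K.
    by apply: C1_inv; [exact: K|move=> y; exact: b0].
  have := (C1_lin (-1) 0 Q Q).1.
  rewrite (_ : (fun y => -1 * _ + _) = (fun y =>
    - (pd (wid i) G (rconsrv y (g y)) / pd ord_max G (rconsrv y (g y)))))//.
  by apply/funext => y; rewrite mul0r addr0 mulN1r.
- exact: Gg.
- move=> y t Gt; case: (ltgtP t (g y)) => // h.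
    have := vertical y (ltW h); rewrite Gg Gt subrr pmulr_rle0// subr_le0 leNgt h//.
  by have := vertical y (ltW h); rewrite Gg Gt subrr pmulr_rle0// subr_le0 leNgt h.
- exact: sgn.
- by move=> i y; rewrite E.
Qed.

End implicit.

(** * Rotating a graph so that its gradient vanishes *)

Section mean_curvature_exists.
Context {R : realType}.

Lemma C2_linear n (a : 'rV[R]_n) : C2fun (fun z : 'rV[R]_n => dotrv a z) /\
  forall i z, pd i (dotrv a) z = a 0 i.
Proof.
have H (s : seq 'I_n) : C2fun (fun z : 'rV[R]_n => \sum_(k <- s) a 0 k * z 0 k) /\
    forall i z, pd i (fun z : 'rV[R]_n => \sum_(k <- s) a 0 k * z 0 k) z =
      \sum_(k <- s) a 0 k * (i == k)%:R.
  elim: s => [|k s [IH1 IH2]].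
    rewrite (_ : (fun z => _) = fun _ : 'rV[R]_n => 0); last first.
      by apply/funext => z; rewrite big_nil.
    split; first exact: C2_cst.
    by move=> i z; rewrite big_nil (C1_cst n 0).2.
  rewrite (_ : (fun z : 'rV[R]_n => _) = fun z : 'rV[R]_n => a 0 k * z 0 k + 1 *
      (\sum_(k <- s) a 0 k * z 0 k)); last first.
    by apply/funext => z; rewrite big_cons mul1r.
  split; first exact: C2_lin (C2_coor k) IH1.
  move=> i z; rewrite (C1_lin _ _ (C1_coor k).1 ((C2funP _).1 IH1).1).2.
  by rewrite (C1_coor k).2 IH2 big_cons mul1r.
have [H1 H2] := H (index_enum 'I_n); split; first exact: H1.
move=> i z; rewrite /dotrv H2 (bigD1 i)//= eqxx mulr1 big1 ?addr0// => k ki.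
by rewrite eq_sym (negbTE ki) mulr0.
Qed.

(** The reflection in the hyperplane orthogonal to [v = N - |N| e_last] exchanges [N] and
    [|N| e_last]. If [v = 0], the vector is already vertical and the identity serves. *)
Lemma householder n (N : 'rV[R]_n.+1) : N 0 ord_max = 1 ->
  exists (H : 'M[R]_n.+1) (c : R), [/\ orthogonal_mx H, 0 < c &
    forall i, \sum_j H i j * N 0 j = c * (i == ord_max)%:R].
Proof.
move=> N1; pose c := enorm N.
have c2 : c ^+ 2 = \sum_i N 0 i ^+ 2 by exact: enorm_sqr.
have c0 : 0 < c.
  rewrite lt_neqAle enorm_ge0 andbT eq_sym; apply/eqP => cE.
  have := coord_le_enorm N ord_max; rewrite N1 normr1 -/c cE; lra.
pose v (i : 'I_n.+1) : R := N 0 i - c * (i == ord_max)%:R.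
pose V := \sum_i v i ^+ 2.
have sumd (f : 'I_n.+1 -> R) : \sum_i (i == ord_max)%:R * f i = f ord_max.
  rewrite (bigD1 ord_max)//= eqxx mul1r big1 ?addr0// => i /negbTE->.
  by rewrite mul0r.
have VE : V = 2 * (c ^+ 2 - c).
  rewrite /V (eq_bigr (fun i => N 0 i ^+ 2 + (i == ord_max)%:R * (c ^+ 2 - 2 * c * N 0 i))).
    by rewrite big_split /= sumd -c2 N1; ring.
  by move=> i _; rewrite /v; case: (i == ord_max); rewrite /= ?mulr1n ?mulr0n; ring.
have vN : \sum_j v j * N 0 j = c ^+ 2 - c.
  rewrite (eq_bigr (fun j => N 0 j ^+ 2 + (j == ord_max)%:R * (- c * N 0 j))).
    by rewrite big_split /= sumd -c2 N1; ring.
  by move=> j _; rewrite /v; ring.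
have [V0|V0] := eqVneq V 0.
  have vz i : v i = 0.
    have /eqP : V = 0 by []; rewrite psumr_eq0; last by move=> j _; exact: sqr_ge0.
    by move=> /allP/(_ i (mem_index_enum _)); rewrite sqrf_eq0 => /eqP.
  exists 1%:M, c; split => //.
    by rewrite /orthogonal_mx trmx1 mul1mx.
  move=> i; rewrite (bigD1 i)//= mxE eqxx mul1r big1 ?addr0; last first.
    by move=> j ji; rewrite mxE eq_sym (negbTE ji) mul0r.
  by have := vz i; rewrite /v => /eqP; rewrite subr_eq0 => /eqP.
pose H : 'M[R]_n.+1 := \matrix_(i, j) ((i == j)%:R - 2 / V * (v i * v j)).
have HT : H^T = H by apply/matrixP => i j; rewrite !mxE eq_sym (mulrC (v i)).
exists H, c; split => //.
  rewrite /orthogonal_mx HT; apply/matrixP => i j; rewrite !mxE.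
  have sumk (k : 'I_n.+1) (f : 'I_n.+1 -> R) : \sum_l (k == l)%:R * f l = f k.
    rewrite (bigD1 k)//= eqxx mul1r big1 ?addr0// => l lk.
    by rewrite eq_sym (negbTE lk) mul0r.
  rewrite (eq_bigr (fun k => (i == k)%:R * (k == j)%:R - (i == k)%:R * (2 / V * (v k * v j))
    - (j == k)%:R * (2 / V * (v i * v k)) + (2 / V) ^+ 2 * (v i * v j) * v k ^+ 2)).
    rewrite big_split /= -mulr_sumr -/V !sumrB !sumk.
    by field.
  by move=> k _; rewrite !mxE (eq_sym j k); ring.
move=> i; rewrite (eq_bigr (fun j => (j == i)%:R * N 0 j - 2 / V * v i * (v j * N 0 j))).
  rewrite sumrB -mulr_sumr vN (bigD1 i)//= eqxx mul1r big1 ?addr0; last first.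
    by move=> j /negbTE->; rewrite mul0r.
  have cV : c ^+ 2 - c = V / 2 by rewrite VE; field.
  have -> : 2 / V * v i * (c ^+ 2 - c) = v i by rewrite cV; field.
  by rewrite /v; ring.
by move=> j _; rewrite !mxE (eq_sym i); ring.
Qed.

Local Notation wid i := (widen_ord (leqnSn _) i).

(** The graph supplied by [C2_boundary] may be tilted at 0. A Householder reflection makes its
    normal [(-Df(0), 1)] vertical, and the implicit function theorem rewrites the boundary as a
    graph in the new coordinates. *)
Lemma exists_mean_curv n (E : set 'rV[R]_n.+1) (x : 'rV[R]_n.+1) :
  C2_boundary E -> bdry E x -> exists k, is_mean_curv E x k.
Proof.
move=> CE /CE[Q [f [rho [oQ [C2f [f0 [rho0 EQ]]]]]]].
pose N := rconsrv (\row_i - pd i f 0) 1 : 'rV[R]_n.+1.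
have [H [c [oH c0 HN]]] := householder (rconsrv_max (\row_i - pd i f 0) 1 : N 0 ord_max = 1).
pose L (z : 'rV[R]_n.+1) : 'rV[R]_n := yprime (z *m H).
have LE j z : L z 0 j = dotrv (\row_k H k (wid j)) z.
  by rewrite /L yprimeE mxE; apply: eq_bigr => k _; rewrite mxE mulrC.
have LEf j : (fun z => L z 0 j) = dotrv (\row_k H k (wid j)).
  by apply/funext => z; exact: LE.
have CL j : C2fun (fun z => L z 0 j) by rewrite LEf; exact: (C2_linear _).1.
have C2K : C2fun (fun z => f (L z)) := C2_comp C2f CL.
have pdK i z : pd i (fun z => f (L z)) z = \sum_j H i (wid j) * pd j f (L z).
  rewrite (C1_comp ((C2funP _).1 C2f).1 (fun j => ((C2funP _).1 (CL j)).1)).2.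
  by apply: eq_bigr => j _; rewrite LEf (C2_linear _).2 mxE.
pose hm : 'rV[R]_n.+1 := \row_k H k ord_max.
have lastE z : ylast (z *m H) = dotrv hm z.
  by rewrite ylastE mxE; apply: eq_bigr => k _; rewrite mxE mulrC.
pose F0 z := 1 * dotrv hm z + -1 * f (L z).
have C2F0 : C2fun F0 := C2_lin 1 (-1) (C2_linear hm).1 C2K.
have C1F0 := ((C2funP _).1 C2F0).1.
(* The gradient of the defining function [F0] at 0 is [c] times the last basis vector. Subtracting
   that linear part makes 0 critical for [F1], so the cutoff applies; adding it back leaves a
   vertical derivative of at least [c / 2] everywhere. *)
pose F1 z := 1 * F0 z + (- c) * z 0 ord_max.
have C2F1 : C2fun F1 := C2_lin 1 (- c) C2F0 (C2_coor ord_max).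
have L0 : L 0 = 0 by apply/rowP => j; rewrite /L mul0mx yprimeE !mxE.
have pdF1 i : pd i F1 0 = 0.
  rewrite /F1 (C1_lin 1 (- c) C1F0 (C1_coor ord_max).1).2 (C1_coor ord_max).2 mul1r.
  rewrite /F0 (C1_lin 1 (-1) ((C2funP _).1 (C2_linear hm).1).1 ((C2funP _).1 C2K).1).2.
  rewrite (C2_linear hm).2 pdK L0 mul1r mulN1r mxE.
  have := HN i; rewrite big_ord_recr /= rconsrv_max mulr1.
  under eq_bigr do rewrite rconsrv_wid mxE mulrN.
  by rewrite sumrN; lra.
have c2 : 0 < c / 2 by rewrite divr_gt0.
have [F [e [C2F e0 FE Fb Fpd0]]] := cutoff C2F1 pdF1 c2.
pose G z := 1 * F z + c * z 0 ord_max.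
have C2G : C2fun G := C2_lin 1 c C2F (C2_coor ord_max).
have pdG i z : pd i G z = pd i F z + c * (i == ord_max)%:R.
  rewrite /G (C1_lin 1 c ((C2funP _).1 C2F).1 (C1_coor ord_max).1).2.
  by rewrite (C1_coor ord_max).2 mul1r.
have Gc z : c / 2 <= pd ord_max G z.
  by rewrite pdG eqxx mulr1; have := Fb ord_max z; rewrite ler_norml => /andP[]; lra.
have GE (z : 'rV[R]_n.+1) : (forall j, `|z 0 j| <= e) -> G z = F0 z.
  by move=> ze; rewrite /G FE// /F1; ring.
have [g [C2g Gg Guniq Gsgn Gpd]] := implicit_function C2G c2 Gc.
have r00 : rconsrv (0 : 'rV[R]_n) 0 = 0 :> 'rV[R]_n.+1.
  by rewrite -rconsrv_ebasis scale0r.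
have g0 : g 0 = 0.
  apply/esym/Guniq; rewrite r00 GE; last by move=> j; rewrite mxE normr0 ltW.
  rewrite /F0 L0 f0 mulr0 addr0 mul1r /dotrv big1// => j _.
  by rewrite [X in _ * X]mxE mulr0.
exists (- \sum_(i < n) pd i (pd i g) 0), (H *m Q), g, (Num.min rho e); split.
  rewrite /orthogonal_mx trmx_mul mulmxA -(mulmxA Q^T) (oH : H^T *m H = _) mulmx1.
  exact: oQ.
split; first exact: C2g.
split; first exact: g0.
split.
  move=> i; rewrite Gpd g0 r00 pdG Fpd0 add0r wid_lift.
  by rewrite eq_sym (negbTE (neq_lift _ _)) mulr0 mul0r oppr0.
split; first by rewrite lt_min rho0 e0.
split=> // y; rewrite lt_min => /andP[yrho ye].
rewrite -Gsgn GE; last by move=> j; rewrite (le_trans (coord_le_enorm y j))// ltW.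
rewrite mulmxA EQ ?enorm_orth// lastE /F0 -/(L y).
by split; lra.
Qed.

End mean_curvature_exists.

(** * Norm comparisons *)

Section norms.
Context {R : realType}.

Lemma nrm1D n (u v : 'rV[R]_n) : nrm1 (u + v) <= nrm1 u + nrm1 v.
Proof. by rewrite /nrm1 -big_split ler_sum// => i _; rewrite mxE ler_normD. Qed.

Lemma nrm1N n (u : 'rV[R]_n) : nrm1 (- u) = nrm1 u.
Proof. by apply: eq_bigr => i _; rewrite mxE normrN. Qed.

Lemma coord_le_nrm1 n (u : 'rV[R]_n) i : `|u 0 i| <= nrm1 u.
Proof. by rewrite /nrm1 (bigD1 i)//= lerDl sumr_ge0. Qed.

Lemma enorm_le_nrm1 n (u : 'rV[R]_n) : enorm u <= nrm1 u.
Proof.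
rewrite -(ler_pXn2r (isT : (0 < 2)%N)) ?nnegrE ?enorm_ge0 ?nrm1_ge0// enorm_sqr.
rewrite expr2 {1}/nrm1 mulr_suml ler_sum// => i _.
by rewrite -real_normK ?num_real// expr2 ler_wpM2l// coord_le_nrm1.
Qed.

Lemma nrm1_le n (u : 'rV[R]_n) (c : R) : (forall i, `|u 0 i| <= c) -> nrm1 u <= n%:R * c.
Proof.
move=> H; rewrite (@le_trans _ _ (\sum_(i < n) c))//; first exact: ler_sum.
by rewrite sumr_const card_ord mulr_natl.
Qed.

Lemma nrm1_le_enorm n (u : 'rV[R]_n) : nrm1 u <= n%:R * enorm u.
Proof. by apply: nrm1_le => i; exact: coord_le_enorm. Qed.

Lemma nrm1_last n (u : 'rV[R]_n.+1) : nrm1 u = nrm1 (yprime u) + `|ylast u|.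
Proof.
rewrite /nrm1 big_ord_recr ylastE; congr (_ + _).
by apply: eq_bigr => i _; rewrite yprimeE.
Qed.

Lemma nrm1_yprime n (u : 'rV[R]_n.+1) : nrm1 (yprime u) <= nrm1 u.
Proof. by rewrite nrm1_last lerDl. Qed.

Lemma dotrv_le n (a u : 'rV[R]_n) (c : R) : (forall i, `|a 0 i| <= c) ->
  `|dotrv a u| <= c * nrm1 u.
Proof.
move=> H; rewrite (le_trans (ler_norm_sum _ _ _))// mulr_sumr ler_sum// => i _.
by rewrite normrM ler_wpM2r.
Qed.

Definition mx1 n (B : 'M[R]_n) : R := \sum_i \sum_j `|B i j|.

Lemma mx1_ge0 n (B : 'M[R]_n) : 0 <= mx1 B.
Proof. by apply: sumr_ge0 => i _; exact: sumr_ge0. Qed.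

Lemma qform_diff n (B : 'M[R]_n) (u v : 'rV[R]_n) :
  `|qform B u - qform B v| <= mx1 B * (nrm1 (u - v) * (nrm1 u + nrm1 v)).
Proof.
rewrite /qform -sumrB (le_trans (ler_norm_sum _ _ _))// /mx1 mulr_suml ler_sum// => i _.
rewrite -sumrB (le_trans (ler_norm_sum _ _ _))// mulr_suml ler_sum// => j _.
rewrite -mulrBr normrM ler_wpM2l//.
have -> : u 0 i * u 0 j - v 0 i * v 0 j =
   (u - v) 0 i * u 0 j + v 0 i * (u - v) 0 j by rewrite !mxE; ring.
rewrite (le_trans (ler_normD _ _))// !normrM mulrDr (mulrC `|v 0 i|).
by apply: lerD; apply: ler_pM => //; exact: coord_le_nrm1.
Qed.

Lemma qform_le n (B : 'M[R]_n) (u : 'rV[R]_n) : `|qform B u| <= mx1 B * nrm1 u ^+ 2.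
Proof.
rewrite /qform (le_trans (ler_norm_sum _ _ _))// /mx1 mulr_suml ler_sum// => i _.
rewrite (le_trans (ler_norm_sum _ _ _))// mulr_suml ler_sum// => j _.
by rewrite normrM ler_wpM2l// normrM expr2 ler_pM// coord_le_nrm1.
Qed.

(** A vector [p] with [p A = 0] satisfies [|p|_1 <= n eta |p|_1], hence vanishes. *)
Lemma near_id_unit n (A : 'M[R]_n) (eta : R) : n%:R * eta < 1 ->
  (forall i k, `|A i k - (i == k)%:R| <= eta) -> A \in unitmx.
Proof.
move=> n1 HA; rewrite -row_free_unit -kermx_eq0; apply/eqP/row_matrixP => i.
rewrite row0; set p := row i _.
have pA : p *m A = 0 by rewrite -row_mul mulmx_ker row0.
have pk k : `|p 0 k| <= eta * nrm1 p.
  have : (p *m A) 0 k = 0 by rewrite pA mxE.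
  rewrite mxE => E.
  have -> : p 0 k = - \sum_j p 0 j * (A j k - (j == k)%:R).
    under eq_bigr do rewrite mulrBr.
    rewrite sumrB E sub0r opprK (bigD1 k)//= eqxx mulr1 big1 ?addr0// => j /negbTE->.
    by rewrite mulr0.
  rewrite normrN mulr_sumr (le_trans (ler_norm_sum _ _ _))// ler_sum// => j _.
  by rewrite normrM mulrC ler_wpM2r.
have := nrm1_le pk; rewrite mulrA => H.
have p0 : nrm1 p <= 0 by have := nrm1_ge0 p; nra.
apply/rowP => k; rewrite [RHS]mxE; apply/eqP.
by rewrite -normr_le0 (le_trans (coord_le_nrm1 p k)).
Qed.

End norms.

Section absorb.
Context {R : realType}.

(* [W] is the height above the tilted hyperplane, [u] the defining function and
   [N] the size of the point: a quadratic error in [N] is absorbed in [eps * y2]. *)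
Lemma absorb (W u s q N t y2 CB n eps k' sg dl : R) :
  0 <= CB -> 0 <= k' -> 0 < eps <= 1 -> 0 <= dl <= 1 -> 0 <= sg -> 0 <= t -> 0 <= y2 ->
  `|s - 1| <= sg -> sg <= 1 / 2 -> `|q| <= CB * t ^+ 2 -> t ^+ 2 <= n * y2 -> 0 <= n ->
  `|W| <= dl -> 0 <= N -> N <= 2 * t + `|W| -> `|u - (s * W - q)| <= k' * N ^+ 2 ->
  sg * CB * n + 8 * k' * n + 2 * k' * (CB * n + 1) <= eps / 2 -> k' <= 1 / 8 ->
  (W <= q - eps * y2 -> u <= 0) /\ (u <= 0 -> W <= q + eps * y2).
Proof.
move=> CB0 k0 /andP[e0 e1] /andP[d0 d1] sg0 t0 y0 /ler_normlP[s1 s2] sgh /ler_normlP[q1 q2]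
  ty n0 Wd N0 Nt /ler_normlP[u1 u2] small k8.
have W0 := normr_ge0 W.
(* Since [|W| <= 1], the square of [W] costs no more than [|W|], a linear term that [s W] can
   dominate. *)
have N2 : N ^+ 2 <= 8 * t ^+ 2 + 2 * `|W|.
  have a1 : N ^+ 2 <= (2 * t + `|W|) ^+ 2 by rewrite lerXn2r// nnegrE; lra.
  have a2 : `|W| ^+ 2 <= `|W| by rewrite expr2 ler_piMl//; lra.
  have a3 : 0 <= (2 * t - `|W|) ^+ 2 := sqr_ge0 _.
  nra.
have kN : k' * N ^+ 2 <= 8 * k' * n * y2 + 2 * k' * `|W|.
  have := ler_wpM2l k0 N2; have := ler_wpM2l k0 ty; nra.
have qy : CB * t ^+ 2 <= CB * n * y2 by have := ler_wpM2l CB0 ty; lra.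
have CBn : 0 <= CB * n by rewrite mulr_ge0.
have Q : `|q| <= CB * n * y2 by rewrite ler_norml; apply/andP; split; lra.
have sq : `|(s - 1) * q| <= sg * (CB * n * y2).
  by rewrite normrM; apply: ler_pM => //; rewrite ler_norml; apply/andP; split; lra.
have [sq1 sq2] := ler_normlP _ _ sq.
have key : y2 * (sg * CB * n + 8 * k' * n + 2 * k' * (CB * n + 1)) <= y2 * (eps / 2).
  exact: ler_wpM2l.
have sh : 2^-1 <= s by lra.
have k8' : k' <= 8^-1 by lra.
split=> H.
(* With [tau] the excess beyond the threshold, the error contains at most [2 k' tau <= tau / 4],
   beaten by [s tau >= tau / 2]. All its terms in [y2] add up to at most [eps y2 / 2], which
   [s eps y2] beats. *)
- have [tau tau0 WE] : exists2 tau, 0 <= tau & W = q - eps * y2 - tau.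
    by exists (q - eps * y2 - W); [rewrite subr_ge0 | ring].
  have ey : 0 <= eps * y2 by rewrite mulr_ge0// ltW.
  have ey1 : eps * y2 <= y2 by rewrite ler_piMl.
  have aW : `|W| <= CB * n * y2 + y2 + tau.
    by rewrite WE ler_norml; have [] := ler_normlP _ _ Q; move=> ? ?; apply/andP; split; lra.
  have kW := ler_wpM2l k0 aW.
  have st : 2^-1 * tau <= s * tau by exact: ler_wpM2r.
  have se : 2^-1 * (eps * y2) <= s * (eps * y2) by exact: ler_wpM2r.
  have kt : k' * tau <= 8^-1 * tau by exact: ler_wpM2r.
  have E : s * W - q = (s - 1) * q - s * (eps * y2) - s * tau by rewrite WE; ring.
  rewrite E in u1 u2; nra.
- rewrite leNgt; apply/negP => H2.
  have [tau tau0 WE] : exists2 tau, 0 < tau & W = q + eps * y2 + tau.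
    by exists (W - q - eps * y2); [lra | ring].
  have ey : 0 <= eps * y2 by rewrite mulr_ge0// ltW.
  have ey1 : eps * y2 <= y2 by rewrite ler_piMl.
  have aW : `|W| <= CB * n * y2 + y2 + tau.
    by rewrite WE ler_norml; have [] := ler_normlP _ _ Q; move=> ? ?; apply/andP; split; lra.
  have kW := ler_wpM2l k0 aW.
  have st : 2^-1 * tau <= s * tau by apply: ler_wpM2r => //; exact: ltW.
  have se : 2^-1 * (eps * y2) <= s * (eps * y2) by exact: ler_wpM2r.
  have kt : k' * tau <= 8^-1 * tau by apply: ler_wpM2r => //; exact: ltW.
  have E : s * W - q = (s - 1) * q + s * (eps * y2) + s * tau by rewrite WE; ring.
  rewrite E in u1 u2; nra.
Qed.

End absorb.

(** * Graphs under C2-small diffeomorphisms *)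

Section local_graph.
Context {R : realType}.
Local Notation wid i := (widen_ord (leqnSn _) i).

Definition close_to_id n (eta : R) (F : 'rV[R]_n -> 'rV[R]_n) := forall y,
  (forall k, `|F y 0 k - y 0 k| <= eta) /\
  (forall i k, `|pd i (fun z => F z 0 k) y - (i == k)%:R| <= eta) /\
  (forall i j k, `|pd j (pd i (fun z => F z 0 k)) y| <= eta).

Lemma nrm1_scale_le n (u v : 'rV[R]_n) (c : R) : (forall i, `|u 0 i| <= c * nrm1 v) ->
  nrm1 u <= n%:R * c * nrm1 v.
Proof. by move=> /nrm1_le; rewrite mulrA. Qed.

(** With [J] the derivative of the diffeomorphism and [e] the gradient of a defining function, [p]
    is a normal to the image set. Solving a linear system avoids differentiating the inverse, for
    which no closeness to the identity is assumed. *)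
Lemma near_id_solve n (J : 'M[R]_n) (e : 'rV[R]_n) (eta : R) : n%:R * eta <= 1 / 4 ->
  0 <= eta ->
  (forall i k, `|J i k - (i == k)%:R| <= eta) -> (forall i, `|e 0 i| <= 1) ->
  exists p : 'rV[R]_n, [/\ forall i, e 0 i = \sum_k J i k * p 0 k, nrm1 p <= 2 * n%:R &
    forall i, `|p 0 i - e 0 i| <= 2 * n%:R * eta].
Proof.
move=> ne eta0 HJ He.
have JU : J^T \in unitmx.
  apply: (@near_id_unit _ _ _ eta); first lra.
  by move=> i k; rewrite mxE eq_sym.
have [p pJ] : exists p, p *m J^T = e by exists (e *m invmx J^T); rewrite mulmxKV.
have pE i : e 0 i = \sum_k J i k * p 0 k.
  by rewrite -pJ mxE; apply: eq_bigr => k _; rewrite mxE mulrC.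
have pe i : `|p 0 i - e 0 i| <= eta * nrm1 p.
  rewrite pE distrC (_ : _ - _ = \sum_k (J i k - (i == k)%:R) * p 0 k); last first.
    under [RHS]eq_bigr do rewrite mulrBl.
    rewrite sumrB; congr (_ - _); rewrite (bigD1 i)//= eqxx mul1r big1 ?addr0//.
    by move=> k ki; rewrite eq_sym (negbTE ki) mul0r.
  rewrite mulr_sumr (le_trans (ler_norm_sum _ _ _))// ler_sum// => k _.
  by rewrite normrM ler_wpM2r.
have p2 : nrm1 p <= 2 * n%:R.
  have h1 : nrm1 p <= nrm1 (p - e) + nrm1 e by rewrite -{1}(subrK e p) nrm1D.
  have h2 := nrm1_le He; rewrite mulr1 in h2.
  have h3 : nrm1 (p - e) <= n%:R * eta * nrm1 p.
    by apply: nrm1_scale_le => i; rewrite !mxE.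
  have := nrm1_ge0 p; nra.
exists p; split => // i; rewrite (le_trans (pe i))// mulrC; exact: ler_wpM2r.
Qed.

(** Write [z = Phi (y0 + v)]. Taylor's formula for [f] at [y0], and for [Phi] at [y0] paired with
    the normal [p], gives [u = s W - q] up to a small multiple of [|z|_1^2], where [u] is the
    defining function of [E0] at the preimage of [z]. Then [absorb] converts this into the two
    inclusions. *)
Lemma local_graph0 n (f : 'rV[R]_n -> R) (rho eps : R) :
  C2fun f -> (forall i, pd i f 0 = 0) -> 0 < rho -> 0 < eps <= 1 ->
  exists2 delta, 0 < delta <= 1 & exists2 eta, 0 < eta <= 1 &
  forall (Phi : 'rV[R]_n.+1 -> 'rV[R]_n.+1) (E0 E1 : set 'rV[R]_n.+1) (y0 : 'rV[R]_n.+1),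
  (forall k, C2fun (fun y => Phi y 0 k)) -> close_to_id eta Phi ->
  Phi y0 = 0 -> (forall z, exists w, Phi w = z) ->
  (forall w, enorm w < rho -> (E0 w <-> ylast w <= f (yprime w))) ->
  (forall w, E1 (Phi w) <-> E0 w) ->
  (enorm y0 < rho -> ylast y0 = f (yprime y0)) ->
  exists a : 'rV[R]_n, (forall i, `|a 0 i| <= eps) /\
    forall z : 'rV[R]_n.+1, nrm1 z < delta ->
    let W := ylast z + dotrv a (yprime z) in
    let q := qform (taylor_mx (\matrix_(i, j) pd j (pd i f) 0)) (yprime z) in
    (W <= q - eps * enorm (yprime z) ^+ 2 -> E1 z) /\
    (E1 z -> W <= q + eps * enorm (yprime z) ^+ 2).
Proof.
move=> C2f f0 rho0 /andP[e0 e1].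
set H := \matrix_(i, j) _; set B := taylor_mx H.
pose m : R := n.+1%:R; have m1 : 1 <= m by rewrite /m ler1n.
pose CB := mx1 B; have CB0 : 0 <= CB by exact: mx1_ge0.
pose n2 : R := n%:R ^+ 2; have n20 : 0 <= n2 by exact: sqr_ge0.
(* The three terms come from the remainder of [f], the remainder of [Phi] paired with [p], and the
   replacement of [v] by [z] in the quadratic form (the bounds [b1], [b2], [b3] below). *)
pose D := 4 + 8 * m + 6 * (m * CB).
have mCB : 0 <= m * CB by rewrite mulr_ge0//; lra.
have D0 : 0 <= D by rewrite /D; lra.
have CBn : 0 <= CB * n2 by rewrite mulr_ge0.
pose T1 := 2 * m * CB * n2 + 8 * D * n2 + 2 * D * (CB * n2 + 1).
have T10 : 0 <= T1.
  have := mulr_ge0 mCB n20; have := mulr_ge0 D0 n20; have := mulr_ge0 D0 CBn.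
  by rewrite /T1; lra.
(* One summand per smallness condition: the inequality of [absorb], [k' <= 1/8], the size of the
   tilt, and the invertibility of [J]. A single [kap] then meets them all. *)
pose T := T1 + 8 * D + (2 + 4 * m) + 4 * m + 1.
have T0 : 0 < T by rewrite /T; lra.
have [kap kap0 kapT] : exists2 kap : R, 0 < kap & kap * T = eps / 2.
  exists (eps / 2 / T); first by rewrite !divr_gt0.
  by rewrite divfK// gt_eqF.
have kT1 : kap * T1 <= eps / 2.
  by rewrite -kapT ler_wpM2l ?(ltW kap0)// /T; lra.
have kD : kap * (8 * D) <= eps / 2.
  by rewrite -kapT ler_wpM2l ?(ltW kap0)// /T; lra.
have k2m : kap * (2 + 4 * m) <= eps / 2.
  by rewrite -kapT ler_wpM2l ?(ltW kap0)// /T; lra.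
have k4m : kap * (4 * m) <= eps / 2.
  by rewrite -kapT ler_wpM2l ?(ltW kap0)// /T; lra.
have [d1 d10 Hd1] : exists2 d1 : R, 0 < d1 & forall xi : 'rV[R]_n, (forall j, `|xi 0 j| < d1) ->
    (forall i, `|pd i f xi| <= kap) /\ forall i j, `|pd j (pd i f) xi - H i j| <= kap.
  have [_ [_ [c1 [_ c2]]]] := C2f.
  have N1 : \forall xi \near (0 : 'rV[R]_n), forall i, `|pd i f 0 - pd i f xi| < kap.
    apply: (@filter_forall _ _ _ (nbhs (0 : 'rV[R]_n))) => i.
    by move/(cvgrPdist_lt (F := nbhs (0 : 'rV[R]_n))) : (c1 i 0); apply.
  have N2 : \forall xi \near (0 : 'rV[R]_n), forall i j,
      `|pd j (pd i f) 0 - pd j (pd i f) xi| < kap.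
    apply: (@filter_forall _ _ _ (nbhs (0 : 'rV[R]_n))) => i.
    apply: (@filter_forall _ _ _ (nbhs (0 : 'rV[R]_n))) => j.
    by move/(cvgrPdist_lt (F := nbhs (0 : 'rV[R]_n))) : (c2 i j 0); apply.
  have : \forall xi \near (0 : 'rV[R]_n), (forall i, `|pd i f 0 - pd i f xi| < kap) /\
      forall i j, `|pd j (pd i f) 0 - pd j (pd i f) xi| < kap.
    exact: (@filterI _ (nbhs (0 : 'rV[R]_n)) _ _ _ N1 N2).
  move=> /nbhs_ballP[d /= d0 Hd].
  exists d => // xi xid; have [|h1 h2] := Hd xi.
    by split => // i j; rewrite ord1 -ball_normE /= mxE sub0r normrN.
  split=> [i|i j]; last by rewrite mxE distrC ltW.
  by rewrite ltW// -normrN -sub0r -(f0 i).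
(* As [Phi y0 = 0], the coordinates of [y0] are at most [eta]. Together with [|v|_1 < 2 delta] the
   last two bounds keep the points in use where [Hd1] and the graph description hold. *)
pose eta := Num.min kap (Num.min (d1 / 4) (rho / (4 * m))).
have m0 : 0 < m by lra.
have eta0 : 0 < eta by rewrite !lt_min kap0 !divr_gt0// mulr_gt0.
have eta_k : eta <= kap by rewrite ge_min lexx.
have eta_d : eta <= d1 / 4 by rewrite !ge_min lexx ?orbT.
have eta_r : m * eta <= rho / 4.
  have : eta <= rho / (4 * m) by rewrite !ge_min lexx ?orbT.
  by rewrite ler_pdivlMr ?mulr_gt0//; lra.
pose delta := Num.min 1 (Num.min (d1 / 8) (rho / 8)).
have delta0 : 0 < delta by rewrite !lt_min ltr01 !divr_gt0.
have delta_1 : delta <= 1 by rewrite ge_min lexx.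
have delta_d : delta <= d1 / 8 by rewrite !ge_min lexx ?orbT.
have delta_r : delta <= rho / 8 by rewrite !ge_min lexx ?orbT.
exists delta; first by rewrite delta0.
have kap1 : kap <= 1 by have := mulr_ge0 (ltW kap0) (ltW m0); nra.
exists eta; first by rewrite eta0/=; lra.
move=> Phi E0 E1 y0 C2P cl Py0 surj E0E E1E y0E.
have y0k k : `|y0 0 k| <= eta.
  by have [/(_ k)] := cl y0; rewrite Py0 mxE sub0r normrN.
have y0n : nrm1 y0 <= m * eta by exact: nrm1_le.
have meta : m * eta <= 1 / 4.
  by have := ler_wpM2l (ltW m0) eta_k; lra.
pose J : 'M[R]_n.+1 := \matrix_(i, k) pd i (fun z => Phi z 0 k) y0.
have JE i k : J i k = pd i (fun z => Phi z 0 k) y0 by rewrite mxE.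
(* The gradient of [ylast - f] at [y0]; its horizontal part is small because [Df(0) = 0]. *)
pose e := rconsrv (\row_i - pd i f (yprime y0)) 1.
have y0'k (j : 'I_n) : `|yprime y0 0 j| < d1.
  by rewrite yprimeE; have := y0k (wid j); clear -eta_d d10 eta0; lra.
have ek (i : 'I_n) : `|e 0 (wid i)| <= kap.
  by rewrite rconsrv_wid mxE normrN (Hd1 _ y0'k).1.
have e1i i : `|e 0 i| <= 1.
  case: (unliftP ord_max i) => [j|] ->; last by rewrite rconsrv_max normr1.
  by rewrite -wid_lift (le_trans (ek j)).
have Jcl i k : `|J i k - (i == k)%:R| <= eta by rewrite JE; exact: (cl y0).2.1.
have [p [pE p2 pe]] := near_id_solve meta (ltW eta0)
  Jcl e1i.
pose s := p 0 ord_max.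
pose sg := 2 * m * eta.
have sg0 : 0 <= sg by rewrite /sg !mulr_ge0// ltW.
have s1 : `|s - 1| <= sg by have := pe ord_max; rewrite rconsrv_max.
have sgh : sg <= 1 / 2 by rewrite /sg -mulrA; clear -meta; lra.
have sh : 1 / 2 <= s by have [] := ler_normlP _ _ s1; clear -sgh; lra.
have s0 : s != 0 by rewrite gt_eqF//; clear -sh; lra.
have sgk : sg <= kap * (2 * m).
  by rewrite /sg mulrC ler_wpM2r//; clear -m0; lra.
(* The normal divided by its vertical component, so that pairing it with [z] gives [s W]. *)
pose a : 'rV[R]_n := \row_i (p 0 (wid i) / s).
have aE i : `|a 0 i| <= eps.
  rewrite mxE normrM normfV ler_pdivrMr ?normr_gt0//.
  have h1 : `|p 0 (wid i)| <= kap + sg.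
    rewrite -(subrK (e 0 (wid i)) (p 0 (wid i))) (le_trans (ler_normD _ _))// addrC.
    by apply: lerD.
  have h2 : `|s| = s by rewrite ger0_norm//; clear -sh; lra.
  have h3 : eps * (1 / 2) <= eps * s by rewrite ler_wpM2l// ltW.
  rewrite h2; clear -h1 h3 sgk k2m e0; lra.
exists a; split=> // z zd.
move=> W q.
have [w wE] := surj z.
have [v wv] : exists v, w = y0 + v by exists (w - y0); rewrite addrC subrK.
pose N := nrm1 z; pose t := nrm1 (yprime z).
have zv k : `|z 0 k - v 0 k| <= eta * nrm1 v.
  have dP : forall i y, derivable (fun y => Phi y 0 k) y (ebasis R i).
    exact: ((C2funP _).1 (C2P k)).1.1.
  have Hc (xi : 'rV[R]_n.+1) : (forall j, `|xi 0 j| <= `|v 0 j|) -> forall i,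
      `|pd i (fun y => Phi y 0 k) (y0 + xi) - ebasis R k 0 i| <= eta.
    by move=> _ i; rewrite ebasisE eq_sym; exact: (cl _).2.1.
  have := mv_path_le dP Hc.
  rewrite -wv wE Py0 mxE subr0 (bigD1 k)//= ebasisE eqxx mulr1 big1 ?addr0//.
  by move=> i ik; rewrite ebasisE eq_sym (negbTE ik) mulr0.
have zvn : nrm1 (z - v) <= m * eta * nrm1 v.
  by apply: nrm1_scale_le => i; rewrite mxE [(- v) _ _]mxE.
have v0 := nrm1_ge0 v.
have vN : nrm1 v <= 2 * N.
  have h1 : nrm1 v <= nrm1 (z - v) + N.
    rewrite -(nrm1N (z - v)) -{1}(subrK z v) (le_trans (nrm1D _ _))//.
    by rewrite opprB.
  by have := ler_wpM2r v0 meta; clear -h1 zvn v0; lra.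
have N0 : 0 <= N := nrm1_ge0 z.
have vd : nrm1 v < 2 * delta by have := zd; rewrite -/N; clear -vN; lra.
have y0r : enorm y0 < rho by rewrite (le_lt_trans (enorm_le_nrm1 _))//; clear -y0n eta_r rho0; lra.
have wr : enorm w < rho.
  rewrite (le_lt_trans (enorm_le_nrm1 _))// wv (le_lt_trans (nrm1D _ _))//.
  by clear -y0n eta_r vd delta_r rho0; lra.
have yw : yprime w = yprime y0 + yprime v.
  by rewrite wv; apply/rowP => i; rewrite !(yprimeE, mxE).
have lw : ylast w = ylast y0 + ylast v by rewrite wv !ylastE mxE.
have t1 : `|f (yprime w) - f (yprime y0) - \sum_i yprime v 0 i * pd i f (yprime y0) -
    qform B (yprime v)| <= kap * nrm1 (yprime v) ^+ 2.
  rewrite yw; apply: taylor2.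
  - exact: ((C2funP _).1 C2f).1.1.
  - by move=> i j y; exact: (((C2funP _).1 C2f).2 i).1.
  - move=> xi xiv i j; apply: (Hd1 _ _).2 => l.
    have h1 := xiv l; have h2 := coord_le_nrm1 (yprime v) l; have h3 := nrm1_yprime v.
    rewrite mxE (le_lt_trans (ler_normD _ _))//.
    have h4 := y0k (wid l); rewrite yprimeE; clear -h1 h2 h3 h4 vd delta_d eta_d d10; lra.
have t2 k : `|z 0 k - \sum_i v 0 i * J i k| <= eta * nrm1 v ^+ 2.
  have dP : forall i y, derivable (fun y => Phi y 0 k) y (ebasis R i).
    exact: ((C2funP _).1 (C2P k)).1.1.
  have ddP : forall i j y, derivable (pd i (fun y => Phi y 0 k)) y (ebasis R j).
    by move=> i j y; exact: (((C2funP _).1 (C2P k)).2 i).1.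
  have Hc (xi : 'rV[R]_n.+1) : (forall j, `|xi 0 j| <= `|v 0 j|) -> forall i j,
      `|pd j (pd i (fun y => Phi y 0 k)) (y0 + xi) - (0 : 'M[R]_n.+1) i j| <= eta.
    by move=> _ i j; rewrite mxE subr0; exact: (cl _).2.2.
  have := taylor2 dP ddP Hc.
  rewrite -wv wE Py0 mxE subr0.
  have -> : qform (taylor_mx (0 : 'M[R]_n.+1)) v = 0.
    rewrite /qform big1// => i _; rewrite big1// => j _.
    have Z (h l : 'I_n.+1) : (0 : 'M[R]_n.+1) h l = 0 by rewrite mxE.
    by rewrite [taylor_mx _ _ _]mxE !Z mul0r !if_same mul0r.
  by rewrite subr0; under eq_bigr do rewrite -JE.
pose ev := \sum_i v 0 i * e 0 i.
pose pz := \sum_k z 0 k * p 0 k.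
have evE : ev = ylast v - \sum_i yprime v 0 i * pd i f (yprime y0).
  rewrite /ev big_ord_recr /= rconsrv_max mulr1 ylastE addrC -sumrN; congr (_ + _).
  by apply: eq_bigr => i _; rewrite rconsrv_wid mxE yprimeE mulrN.
have pze : `|pz - ev| <= eta * nrm1 v ^+ 2 * (2 * m).
  have -> : pz - ev = \sum_k (z 0 k - \sum_i v 0 i * J i k) * p 0 k.
    under [RHS]eq_bigr do rewrite mulrBl.
    rewrite sumrB; congr (_ - _); rewrite /ev.
    under eq_bigr do rewrite pE mulr_sumr.
    rewrite exchange_big; apply: eq_bigr => k _.
    by rewrite mulr_suml; apply: eq_bigr => i _; rewrite mulrA.
  have h0 : 0 <= eta * nrm1 v ^+ 2 by rewrite mulr_ge0 ?sqr_ge0// ltW.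
  apply: le_trans (ler_wpM2l h0 p2).
  rewrite mulr_sumr (le_trans (ler_norm_sum _ _ _))// ler_sum// => k _.
  by rewrite normrM ler_wpM2r.
have pzE : pz = s * W.
  rewrite /pz big_ord_recr /= /W -/s mulrDr addrC ylastE mulrC; congr (_ + _).
  rewrite /dotrv mulr_sumr; apply: eq_bigr => i _.
  by rewrite mxE yprimeE; field.
have qd : `|qform B (yprime z) - qform B (yprime v)| <= CB * (m * eta * nrm1 v * (N + nrm1 v)).
  apply: le_trans (qform_diff _ _ _) _; apply: ler_wpM2l => //; apply: ler_pM.
  - exact: nrm1_ge0.
  - by rewrite addr_ge0// nrm1_ge0.
  - have -> : yprime z - yprime v = yprime (z - v).
      by apply/rowP => i; rewrite !(yprimeE, mxE).
    exact: le_trans (nrm1_yprime _) zvn.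
  - by apply: lerD; exact: nrm1_yprime.
pose u := ylast w - f (yprime w).
pose k' := kap * D.
have uE : `|u - (s * W - q)| <= k' * N ^+ 2.
  have -> : u - (s * W - q) = - (f (yprime w) - f (yprime y0) -
      \sum_i yprime v 0 i * pd i f (yprime y0) - qform B (yprime v)) - (pz - ev) +
      (qform B (yprime z) - qform B (yprime v)).
    by rewrite /u lw (y0E y0r) evE pzE /q; ring.
  rewrite (le_trans (ler_normD _ _))//.
  have h1 := ler_normD (- (f (yprime w) - f (yprime y0) -
      \sum_i yprime v 0 i * pd i f (yprime y0) - qform B (yprime v))) (- (pz - ev)).
  rewrite !normrN in h1.
  have v2 : nrm1 v ^+ 2 <= 4 * N ^+ 2.
    have : nrm1 v ^+ 2 <= (2 * N) ^+ 2 by rewrite lerXn2r ?nnegrE//; clear -N0 vN; lra.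
    by rewrite exprMn; clear -N0; lra.
  have v'2 : nrm1 (yprime v) ^+ 2 <= 4 * N ^+ 2.
    apply: le_trans v2; rewrite lerXn2r ?nnegrE ?nrm1_ge0//; exact: nrm1_yprime.
  have N2 := sqr_ge0 N.
  have b1 : kap * nrm1 (yprime v) ^+ 2 <= kap * (4 * N ^+ 2) by rewrite ler_wpM2l// ltW.
  have b2 : eta * nrm1 v ^+ 2 * (2 * m) <= kap * (4 * N ^+ 2) * (2 * m).
    apply: ler_wpM2r; first by clear -m0; lra.
    by apply: ler_pM => //; [exact: ltW|exact: sqr_ge0].
  have b3 : CB * (m * eta * nrm1 v * (N + nrm1 v)) <= CB * (m * kap * (2 * N) * (3 * N)).
    apply: ler_wpM2l => //; apply: ler_pM; [|by clear -N0 v0; lra| |by clear -vN; lra].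
      by rewrite !mulr_ge0// ltW.
    apply: ler_pM => //; first by rewrite mulr_ge0// ltW.
    by apply: ler_wpM2l => //; exact: ltW.
  have -> : k' * N ^+ 2 = kap * (4 * N ^+ 2) + kap * (4 * N ^+ 2) * (2 * m) +
    CB * (m * kap * (2 * N) * (3 * N)) by rewrite /k' /D; ring.
  clear -h1 t1 pze qd b1 b2 b3; lra.
have t0 : 0 <= t := nrm1_ge0 _.
have az : `|dotrv a (yprime z)| <= t.
  by apply: le_trans (dotrv_le _ aE) _; rewrite ler_piMl.
have NE : N = t + `|ylast z| := nrm1_last z.
have Wle : `|W| <= delta.
  by rewrite (le_trans (ler_normD _ _))//; have := zd; rewrite -/N; clear -NE az; lra.
have NW : N <= 2 * t + `|W|.
  have -> : N = t + `|W - dotrv a (yprime z)| by rewrite NE /W addrK.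
  by have := ler_normB W (dotrv a (yprime z)); clear -az; lra.
have k'0 : 0 <= k' by rewrite mulr_ge0// ltW.
have small : sg * CB * n2 + 8 * k' * n2 + 2 * k' * (CB * n2 + 1) <= eps / 2.
  have T1E : kap * T1 = kap * (2 * m) * (CB * n2) + 8 * k' * n2 + 2 * k' * (CB * n2 + 1).
    by rewrite /T1 /k'; ring.
  rewrite T1E in kT1.
  apply: le_trans kT1; rewrite !lerD2r -mulrA; exact: ler_wpM2r.
have k'8 : k' <= 1 / 8 by rewrite /k'; clear -kD e1; lra.
have ty : t ^+ 2 <= n2 * enorm (yprime z) ^+ 2.
  rewrite -exprMn lerXn2r ?nnegrE//; first by rewrite mulr_ge0// enorm_ge0.
  exact: nrm1_le_enorm.
have [r1 r2] := @absorb R W u s q N t (enorm (yprime z) ^+ 2) CB n2 eps k' sg delta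
  CB0 k'0 (introT andP (conj e0 e1)) (introT andP (conj (ltW delta0) delta_1)) sg0 t0
  (sqr_ge0 _) s1 sgh (qform_le B (yprime z)) ty n20 Wle N0 NW uE small k'8.
have Eu : E1 z <-> u <= 0.
  by rewrite -wE E1E (E0E _ wr) /u subr_le0.
by split=> [/r1 /Eu.2|/Eu.1 /r2].
Qed.

End local_graph.

(** * Conjugation by rigid motions *)

Section rigid_motion.
Context {R : realType} {n : nat}.
Implicit Types (Q : 'M[R]_n) (x y z : 'rV[R]_n) (F : 'rV[R]_n -> 'rV[R]_n).

Lemma orthogonal_entry Q i j : orthogonal_mx Q -> `|Q i j| <= 1.
Proof.
move=> /matrixP/(_ j j); rewrite !mxE eqxx => E.
rewrite -(ler_pXn2r (isT : (0 < 2)%N)) ?nnegrE// expr1n -[leRHS]E (bigD1 i)//= mxE.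
rewrite real_normK ?num_real// expr2 lerDl sumr_ge0// => k _.
by rewrite mxE -expr2 sqr_ge0.
Qed.

Lemma orthogonal_sum_le Q k (c : 'I_n -> R) (b : R) : orthogonal_mx Q ->
  (forall l, `|c l| <= b) -> `|\sum_l Q k l * c l| <= n%:R * b.
Proof.
move=> oQ cb; rewrite (le_trans (ler_norm_sum _ _ _))//.
rewrite mulr_natl -[X in _ *+ X]card_ord -sumr_const ler_sum// => l _.
by rewrite normrM (le_trans _ (cb l))// ler_piMl// orthogonal_entry.
Qed.

Lemma C2_affine (q : 'rV[R]_n) (c : R) : C2fun (fun y => 1 * dotrv q y + 1 * c) /\
  forall i y, pd i (fun y => 1 * dotrv q y + 1 * c) y = q 0 i.
Proof.
have [C E] := C2_linear q; split; first exact: (C2_lin 1 1 C (C2_cst n c)).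
move=> i y; rewrite (C1_lin 1 1 ((C2funP _).1 C).1 (C1_cst n c).1).2.
by rewrite E (C1_cst n c).2 mul1r mulr0 addr0.
Qed.

Lemma rigidE Q x y j : (x + y *m Q) 0 j = 1 * dotrv (\row_i Q i j) y + 1 * x 0 j.
Proof.
rewrite !mxE !mul1r addrC; congr (_ + _); apply: eq_bigr => i _.
by rewrite mxE mulrC.
Qed.

Lemma C2_rigid Q x (K : 'rV[R]_n -> R) : C2fun K ->
  C2fun (fun y => K (x + y *m Q)) /\
  forall i, pd i (fun y => K (x + y *m Q)) = fun y => \sum_j Q i j * pd j K (x + y *m Q).
Proof.
move=> CK.
have LE j : (fun y => (x + y *m Q) 0 j) = fun y => 1 * dotrv (\row_i Q i j) y + 1 * x 0 j.
  by apply/funext => y; exact: rigidE.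
have CL j : C2fun (fun y => (x + y *m Q) 0 j) by rewrite LE; exact: (C2_affine _ _).1.
split; first exact: (@C2_comp R n n K (fun y => x + y *m Q)).
move=> i; rewrite (@C1_comp R n n K (fun y => x + y *m Q) ((C2funP _).1 CK).1
  (fun j => ((C2funP _).1 (CL j)).1)).2.
apply/funext => y; apply: eq_bigr => j _.
by rewrite LE (C2_affine _ _).2 mxE.
Qed.

Definition unrigid Q x z : 'rV[R]_n := (z - x) *m Q^T.

Lemma unrigidE Q x z k :
  unrigid Q x z 0 k = 1 * dotrv (row k Q) z + 1 * - dotrv (row k Q) x.
Proof.
rewrite /unrigid mxE !mul1r /dotrv -sumrN -big_split; apply: eq_bigr => l _ /=.
by rewrite !mxE; ring.
Qed.

Lemma C2_unrigid Q x F : (forall k, C2fun (fun y => F y 0 k)) ->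
  forall k, C2fun (fun y => unrigid Q x (F y) 0 k) /\
  forall i, pd i (fun y => unrigid Q x (F y) 0 k) =
    fun y => \sum_l Q k l * pd i (fun w => F w 0 l) y.
Proof.
move=> CF k.
have E : (fun y => unrigid Q x (F y) 0 k) =
    fun y => (fun z => 1 * dotrv (row k Q) z + 1 * - dotrv (row k Q) x) (F y).
  by apply/funext => y; exact: unrigidE.
have [CA EA] := C2_affine (row k Q) (- dotrv (row k Q) x).
rewrite E; split; first exact: (C2_comp CA CF).
move=> i; rewrite (C1_comp ((C2funP _).1 CA).1 (fun j => ((C2funP _).1 (CF j)).1)).2.
by apply/funext => y; apply: eq_bigr => l _; rewrite EA mxE mulrC.
Qed.

Lemma rigidK Q x : orthogonal_mx Q -> cancel (unrigid Q x) (fun y => x + y *m Q).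
Proof.
by move=> oQ z; rewrite /unrigid -mulmxA (oQ : Q^T *m Q = _) mulmx1 addrC subrK.
Qed.

Lemma unrigidK Q x : orthogonal_mx Q -> cancel (fun y => x + y *m Q) (unrigid Q x).
Proof.
move=> oQ y; rewrite /unrigid addrAC subrr add0r -mulmxA.
by rewrite (mulmx1C (oQ : Q^T *m Q = _)) mulmx1.
Qed.

Lemma conj_C2 Q x F : (forall k, C2fun (fun y => F y 0 k)) ->
  forall k, C2fun (fun y => unrigid Q x (F (x + y *m Q)) 0 k).
Proof.
move=> CF k; apply: (C2_unrigid _ _ _ _).1 => l.
exact: (@C2_rigid Q x (fun y => F y 0 l) (CF l)).1.
Qed.

(** Entries of an orthogonal matrix are at most 1, so each sum against one costs a factor [n]; the
    second derivatives involve three such sums, whence the cube. *)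
Lemma conj_close Q x F (eta : R) : orthogonal_mx Q -> (forall k, C2fun (fun y => F y 0 k)) ->
  close_to_id eta F ->
  close_to_id ((n%:R ^+ 3) * eta) (fun y => unrigid Q x (F (x + y *m Q))).
Proof.
move=> oQ CF cl y.
have QQ : Q *m Q^T = 1%:M := mulmx1C oQ.
have QQE i k : \sum_l Q k l * Q i l = (i == k)%:R.
  have /matrixP/(_ i k) := QQ; rewrite !mxE => <-.
  by apply: eq_bigr => l _; rewrite mxE mulrC.
have CFL l : C2fun (fun y => F (x + y *m Q) 0 l) by exact: (C2_rigid Q x (CF l)).1.
have dE k i : pd i (fun y => unrigid Q x (F (x + y *m Q)) 0 k) =
    fun y => \sum_l Q k l * \sum_j Q i j * pd j (fun w => F w 0 l) (x + y *m Q).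
  rewrite (C2_unrigid Q x CFL k).2; apply/funext => z; apply: eq_bigr => l _.
  by rewrite (C2_rigid Q x (CF l)).2.
split; last split.
- move=> k.
  have n1 : 1 <= n%:R :> R by case: n k => [[]//|p _]; rewrite ler1n.
  rewrite -[in X in _ - X](unrigidK x oQ y).
  have -> : unrigid Q x (F (x + y *m Q)) 0 k - unrigid Q x (x + y *m Q) 0 k =
      \sum_l Q k l * (F (x + y *m Q) 0 l - (x + y *m Q) 0 l).
    rewrite !unrigidE /dotrv !mul1r opprD opprK addrACA addNr addr0 -sumrB.
    by apply: eq_bigr => l _; rewrite mxE mulrBr.
  apply: le_trans (orthogonal_sum_le k oQ (cl _).1) _.
  have eta0 : 0 <= eta by apply: le_trans ((cl y).1 k).
  rewrite ler_wpM2r// -[X in X <= _]expr1; exact: ler_weXn2l.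
- move=> i k; rewrite dE -QQE -sumrB.
  have n1 : 1 <= n%:R :> R by case: n k {dE QQE} => [[]//|p _]; rewrite ler1n.
  have eta0 : 0 <= eta by apply: le_trans ((cl y).1 k).
  have -> : \sum_l (Q k l * (\sum_j Q i j * pd j (fun w => F w 0 l) (x + y *m Q)) -
      Q k l * Q i l) =
      \sum_l Q k l * \sum_j Q i j * (pd j (fun w => F w 0 l) (x + y *m Q) - (j == l)%:R).
    apply: eq_bigr => l _; rewrite -mulrBr; congr (_ * _).
    under [RHS]eq_bigr do rewrite mulrBr.
    rewrite sumrB; congr (_ - _); rewrite (bigD1 l)//= eqxx mulr1 big1 ?addr0//.
    by move=> j /negbTE->; rewrite mulr0.
  apply: le_trans (orthogonal_sum_le k oQ (fun l => orthogonal_sum_le i oQ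
    (fun j => (cl (x + y *m Q)).2.1 j l))) _.
  rewrite mulrA -expr2 ler_wpM2r//; exact: ler_weXn2l.
- move=> i j k.
  have n1 : 1 <= n%:R :> R by case: n k {dE QQE} => [[]//|p _]; rewrite ler1n.
  have C1L l j' : C1fun (fun y => pd j' (fun w => F w 0 l) (x + y *m Q)) /\
    forall i, pd i (fun y => pd j' (fun w => F w 0 l) (x + y *m Q)) =
      fun y => \sum_j Q i j * pd j (pd j' (fun w => F w 0 l)) (x + y *m Q).
    have C1K := ((C2funP _).1 (CF l)).2 j'.
    have LE m : (fun y => (x + y *m Q) 0 m) = fun y => 1 * dotrv (\row_i Q i m) y + 1 * x 0 m.
      by apply/funext => z; exact: rigidE.
    have CL m : C1fun (fun y => (x + y *m Q) 0 m).
      by rewrite LE; exact: ((C2funP _).1 (C2_affine _ _).1).1.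
    have [A B] := @C1_comp R n n (pd j' (fun w => F w 0 l)) (fun y => x + y *m Q) C1K CL.
    split; first exact: A.
    move=> i'; rewrite B; apply/funext => z; apply: eq_bigr => m _.
    by rewrite LE (C2_affine _ _).2 mxE.
  pose A l j' := fun y => pd j' (fun w => F w 0 l) (x + y *m Q).
  have C1dot (q : 'rV[R]_n) (g : 'I_n -> 'rV[R]_n -> R) : (forall l, C1fun (g l)) ->
      C1fun (fun y => \sum_l q 0 l * g l y) /\
      forall i, pd i (fun y => \sum_l q 0 l * g l y) = fun y => \sum_l q 0 l * pd i (g l) y.
    move=> Cg.
    have gE l : (fun y => (\row_l g l y) 0 l) = g l by apply/funext => z; rewrite mxE.
    have [H1 H2] := @C1_comp R n n (dotrv q) (fun y => \row_l g l y)
      ((C2funP _).1 (C2_linear q).1).1 (fun l => eq_rect _ (@C1fun R n) (Cg l) _ (esym (gE l))).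
    have E : (fun y => dotrv q (\row_l g l y)) = fun y => \sum_l q 0 l * g l y.
      by apply/funext => z; apply: eq_bigr => l _; rewrite mxE.
    rewrite -E; split; first exact: H1.
    move=> i'; rewrite H2; apply/funext => z; apply: eq_bigr => l _.
    by rewrite gE (C2_linear q).2 mulrC.
  have C1in l := C1dot (row i Q) (A l) (fun j' => (C1L l j').1).
  have ddE : pd j (pd i (fun y => unrigid Q x (F (x + y *m Q)) 0 k)) y =
      \sum_l Q k l * \sum_j' Q i j' * \sum_m Q j m *
         pd m (pd j' (fun w => F w 0 l)) (x + y *m Q).
    have -> : pd i (fun y => unrigid Q x (F (x + y *m Q)) 0 k) =
        fun y => \sum_l row k Q 0 l * (fun y => \sum_j' row i Q 0 j' * A l j' y) y.
      rewrite dE; apply/funext => z; apply: eq_bigr => l _; rewrite mxE; congr (_ * _).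
      by apply: eq_bigr => j' _; rewrite mxE.
    rewrite (C1dot (row k Q) _ (fun l => (C1in l).1)).2; apply: eq_bigr => l _.
    rewrite mxE (C1in l).2; congr (_ * _); apply: eq_bigr => j' _.
    by rewrite mxE (C1L l j').2.
  rewrite ddE; apply: le_trans (orthogonal_sum_le k oQ (fun l => orthogonal_sum_le i oQ
    (fun j' => orthogonal_sum_le j oQ (fun m => (cl (x + y *m Q)).2.2 j' m l)))) _.
  by rewrite exprS expr2 !mulrA.
Qed.

End rigid_motion.

(** * Image boundaries in the original coordinates *)

Section image_graph.
Context {R : realType}.

Lemma C2_yprime n (f : 'rV[R]_n -> R) : C2fun f -> C2fun (fun y : 'rV[R]_n.+1 => f (yprime y)).
Proof.
move=> Cf; apply: (C2_comp Cf) => j.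
have -> : (fun z : 'rV[R]_n.+1 => yprime z 0 j) = fun z => z 0 (widen_ord (leqnSn n) j).
  by apply/funext => z; exact: yprimeE.
exact: C2_coor.
Qed.

(* A homeomorphism maps boundary points to boundary points, and near [x] the
   set [E] is bounded by the zero set of the defining function [ylast - f]. *)
Lemma boundary_on_graph n (Psi : 'rV[R]_n.+1 -> 'rV[R]_n.+1) (E E1 : set 'rV[R]_n.+1)
    (x : 'rV[R]_n.+1) (Q : 'M[R]_n.+1) (f : 'rV[R]_n -> R) (rho : R) :
  orthogonal_mx Q -> C2fun f -> 0 < rho ->
  (forall y : 'rV[R]_n.+1, enorm y < rho -> (E (x + y *m Q) <-> ylast y <= f (yprime y))) ->
  C2map Psi -> (forall z, E1 z <-> E (Psi z)) -> bdry E1 x ->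
  let y0 := unrigid Q x (Psi x) in enorm y0 < rho -> ylast y0 = f (yprime y0).
Proof.
move=> oQ Cf rho0 EQ CPsi E1E [clx nix] y0 y0r.
pose c z := unrigid Q x (Psi z).
have Cc k : C2fun (fun z => c z 0 k) by exact: (C2_unrigid Q x CPsi k).1.
pose g (y : 'rV[R]_n.+1) := 1 * y 0 ord_max + -1 * f (yprime y).
have Cg : C2fun g := C2_lin 1 (-1) (C2_coor ord_max) (C2_yprime Cf).
have gc : continuous (fun z => g (c z)) := (C2_comp Cg Cc).1.
have ec : continuous (fun z => \sum_i c z 0 i * c z 0 i).
  apply: C1_continuous; apply: C1_sum => i.
  by apply: C1_mul; exact: ((C2funP _).1 (Cc i)).1.
have near_r : \forall z \near x, \sum_i c z 0 i * c z 0 i < rho ^+ 2.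
  have e0 : \sum_i c x 0 i * c x 0 i < rho ^+ 2.
    rewrite (_ : \sum_i _ = enorm y0 ^+ 2); last by rewrite enorm_sqr.
    by rewrite ltrXn2r ?nnegrE ?enorm_ge0// ltW.
  have h := ec x (fun t => t < rho ^+ 2); apply: h; exact: lt_nbhsl.
have E1g z : \sum_i c z 0 i * c z 0 i < rho ^+ 2 -> (E1 z <-> g (c z) <= 0).
  rewrite (_ : \sum_i _ = enorm (c z) ^+ 2); last by rewrite enorm_sqr.
  move=> cr; have {}cr : enorm (c z) < rho.
    by rewrite -(ltr_pXn2r (isT : (0 < 2)%N)) ?nnegrE ?enorm_ge0// ltW.
  rewrite E1E -[Psi z](rigidK x oQ) -/(c z) (EQ _ cr) /g mul1r mulN1r subr_le0.
  by rewrite ylastE.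
suff g0 : g y0 = 0 by move: g0; rewrite /g mul1r mulN1r -ylastE => /eqP; rewrite subr_eq0 => /eqP.
apply/eqP; rewrite eq_le; apply/andP; split; rewrite leNgt; apply/negP => gy.
- have near_g : \forall z \near x, 0 < g (c z).
    by have h := gc x (fun t => 0 < t); apply: h; exact: lt_nbhsr.
  have [z [zE [z1 z2]]] := clx _ (@filterI _ (nbhs x) _ _ _ near_r near_g).
  by have := (E1g z z1).1 zE; rewrite leNgt z2.
- have near_g : \forall z \near x, g (c z) < 0.
    by have h := gc x (fun t => t < 0); apply: h; exact: lt_nbhsl.
  apply: nix; apply: (@filterS _ (nbhs x) _ _ _ _ (@filterI _ (nbhs x) _ _ _ near_r near_g)).
  by move=> z [z1 z2]; apply/(E1g z z1); exact: ltW.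
Qed.

(** Conjugation by the rigid motion puts [x] at 0. The preimage of [x] lies on the graph by
    [boundary_on_graph], which is the anchor condition of [local_graph0]. *)
Lemma local_graph n (E : set 'rV[R]_n.+1) (x : 'rV[R]_n.+1) (Q : 'M[R]_n.+1)
    (f : 'rV[R]_n -> R) (rho eps : R) :
  orthogonal_mx Q -> C2fun f -> (forall i, pd i f 0 = 0) -> 0 < rho ->
  (forall y : 'rV[R]_n.+1, enorm y < rho -> (E (x + y *m Q) <-> ylast y <= f (yprime y))) ->
  0 < eps <= 1 ->
  exists2 delta : R, 0 < delta <= 1 & exists2 eta : R, 0 < eta &
  forall (Phi : 'rV[R]_n.+1 -> 'rV[R]_n.+1) (E1 : set 'rV[R]_n.+1),
  C2diffeo Phi -> close_to_id eta Phi -> Phi @` E = E1 -> bdry E1 x ->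
  exists a : 'rV[R]_n, (forall i, `|a 0 i| <= eps) /\
    forall z : 'rV[R]_n.+1, nrm1 z < delta ->
    let W := ylast z + dotrv a (yprime z) in
    let q := qform (taylor_mx (\matrix_(i, j) pd j (pd i f) 0)) (yprime z) in
    (W <= q - eps * enorm (yprime z) ^+ 2 -> E1 (x + z *m Q)) /\
    (E1 (x + z *m Q) -> W <= q + eps * enorm (yprime z) ^+ 2).
Proof.
move=> oQ Cf df0 rho0 EQ eps01.
have [delta d01 [eta /andP[eta0 _] H]] := local_graph0 Cf df0 rho0 eps01.
have m0 : 0 < n.+1%:R ^+ 3 :> R by rewrite exprn_gt0.
exists delta => //; exists (eta / n.+1%:R ^+ 3); first by rewrite divr_gt0.
move=> Phi E1 [Psi [PsiK [PhiK [CPhi CPsi]]]] cl PhiE bx.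
pose Phi' y := unrigid Q x (Phi (x + y *m Q)).
have E1E z : E1 z <-> E (Psi z).
  rewrite -PhiE; split=> [[w Ew <-]|Ez]; first by rewrite PsiK.
  by exists (Psi z) => //; rewrite PhiK.
apply: (H Phi' (fun y => E (x + y *m Q)) (fun y => E1 (x + y *m Q)) (unrigid Q x (Psi x))).
- by move=> k; apply: (conj_C2 Q x CPhi).
- have := conj_close x oQ CPhi cl; rewrite mulrC divfK//; exact/lt0r_neq0.
- by rewrite /Phi' rigidK// PhiK /unrigid subrr mul0mx.
- move=> z; exists (unrigid Q x (Psi (x + z *m Q))).
  by rewrite /Phi' rigidK// PhiK unrigidK.
- exact: EQ.
- by move=> w; rewrite /Phi' rigidK// E1E PsiK.
- exact: (boundary_on_graph oQ Cf rho0 EQ CPsi E1E bx).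
Qed.

End image_graph.

(** * The curvature integral at one scale *)

Section rigid_integral.
Context {R : realType} {n : nat}.
Variables (Q : 'M[R]_n) (x : 'rV[R]_n).
Hypothesis oQ : orthogonal_mx Q.

Let oQT : orthogonal_mx Q^T.
Proof. by rewrite /orthogonal_mx trmxK; exact: mulmx1C. Qed.

Lemma measurable_unrigid : measurable_fun setT (unrigid Q x).
Proof.
apply: measurable_mulrV; apply: measurable_addrV; [exact: measurable_id|exact: measurable_cst].
Qed.

Lemma leb_unrigid (F : 'rV[R]_n -> \bar R) : measurable_fun setT F -> (forall y, 0 <= F y)%E ->
  (\int[leb n]_y F (unrigid Q x y) = \int[leb n]_y F y)%E.
Proof.
move=> mF F0.
have mFQ : measurable_fun setT (fun y => F (y *m Q^T)).
  by apply: (measurableT_comp mF); apply: measurable_mulrV; exact: measurable_id.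
apply: eq_trans (leb_shift (- x) mFQ (fun y => F0 _)) _.
exact: leb_orth.
Qed.

Lemma integrable_unrigid (f : 'rV[R]_n -> R) : (leb n).-integrable setT (EFin \o f) ->
  (leb n).-integrable setT (EFin \o (fun y => f (unrigid Q x y))) /\
  (\int[leb n]_y (f (unrigid Q x y))%:E = \int[leb n]_y (f y)%:E)%E.
Proof.
move=> fi; have mf : measurable_fun setT (EFin \o f) := measurable_int _ fi.
have /integrableP[_ fy] := fi.
have mfu : measurable_fun setT (EFin \o (fun y => f (unrigid Q x y))).
  exact: (measurableT_comp mf measurable_unrigid).
split.
  apply/integrableP; split => //.
  have ma : measurable_fun setT (fun y => `|(f y)%:E|%E) by exact: measurableT_comp.
  have h := leb_unrigid ma (fun y => abse_ge0 _).
  by apply: le_lt_trans fy; rewrite le_eqVlt; apply/orP; left; apply/eqP; exact: h.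
rewrite integralE [RHS]integralE.
have h1 := leb_unrigid (measurable_funepos mf) (fun y => funepos_ge0 _ y).
have h2 := leb_unrigid (measurable_funeneg mf) (fun y => funeneg_ge0 _ y).
congr (_ - _)%E.
  by apply: eq_trans h1; apply: eq_integral => y _; rewrite !funeposE.
by apply: eq_trans h2; apply: eq_integral => y _; rewrite !funenegE.
Qed.

Variables (s r : R) (E1 : set 'rV[R]_n).

Let dens (z : 'rV[R]_n) : R :=
  (\1_(~` E1) (x + z *m Q) - \1_E1 (x + z *m Q)) * kker n s r (enorm z).

Let KrE : Kr s r x E1 = iint (fun y => (dens (unrigid Q x y))%:E).
Proof.
apply: (congr1 (@iint R n)); apply/funext => y.
have -> : enorm (x - y) = enorm (unrigid Q x y).
  by rewrite /unrigid enorm_orth// -enormN opprB.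
by rewrite /dens (rigidK x oQ y).
Qed.

Lemma Kr_le (g : 'rV[R]_n -> R) : (leb n).-integrable setT (EFin \o g) ->
  (forall z, (\1_(~` E1) (x + z *m Q) - \1_E1 (x + z *m Q)) * kker n s r (enorm z) <= g z) ->
  (Kr s r x E1 <= (\int[leb n]_z g z)%:E)%E.
Proof.
move=> gi gE; have [gui guE] := integrable_unrigid gi.
rewrite KrE (_ : (\int[leb n]_z g z)%:E = iint (fun y => (g (unrigid Q x y))%:E)).
  by apply: le_iint => y; rewrite lee_fin; exact: gE.
by rewrite (iintE gui) guE fineK//; exact: integrable_fin_num.
Qed.

Lemma Kr_ge (g : 'rV[R]_n -> R) : (leb n).-integrable setT (EFin \o g) ->
  (forall z, g z <= (\1_(~` E1) (x + z *m Q) - \1_E1 (x + z *m Q)) * kker n s r (enorm z)) ->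
  ((\int[leb n]_z g z)%:E <= Kr s r x E1)%E.
Proof.
move=> gi gE; have [gui guE] := integrable_unrigid gi.
rewrite KrE (_ : (\int[leb n]_z g z)%:E = iint (fun y => (g (unrigid Q x y))%:E)).
  by apply: le_iint => y; rewrite lee_fin; exact: gE.
by rewrite (iintE gui) guE fineK//; exact: integrable_fin_num.
Qed.

End rigid_integral.

(** * Comparison with the two model regions *)

Section one_scale.
Context {R : realType}.
Variables (n : nat) (s r b alpha C l eps M C2 : R) (a : 'rV[R]_n) (B : 'M[R]_n).
Variables (Q : 'M[R]_n.+1) (x : 'rV[R]_n.+1) (E1 : set 'rV[R]_n.+1).
Hypothesis n0 : (0 < n)%N.
Hypothesis s1 : 1 <= s.
Hypothesis r0 : 0 < r.
Hypothesis b0 : 0 < b.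
Hypothesis C0 : 0 <= C.
Hypothesis Cb : C * b < 1.
Hypothesis l1 : 1 <= l.
Hypothesis lE : 1 + (C * b + alpha) ^+ 2 <= l ^+ 2.
Hypothesis ha : forall y, `|dotrv a y| <= alpha * enorm y.
Hypothesis alpha1 : alpha <= 1.
Hypothesis eps0 : 0 <= eps.
Hypothesis BC : forall y, `|qform B y| + eps * enorm y ^+ 2 <= C * enorm y ^+ 2.
Hypothesis oQ : orthogonal_mx Q.
Let phi (y : 'rV[R]_n) := ind R (enorm y < b) * kker n.+1 s r (enorm y).
Hypothesis phiM : (\int[leb n]_y (enorm y ^+ 2 * phi y)%:E = M%:E)%E.
Hypothesis tailC : (\int[leb n.+1]_y
  (ind R (b / 2 <= enorm (y : 'rV[R]_n.+1)) * kker n.+1 s r (enorm y))%:E <= C2%:E)%E.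
Let W (z : 'rV[R]_n.+1) := ylast z + dotrv a (yprime z).
Hypothesis sandwich : forall z, cyl b a z ->
  (W z <= qform B (yprime z) - eps * enorm (yprime z) ^+ 2 -> E1 (x + z *m Q)) /\
  (E1 (x + z *m Q) -> W z <= qform B (yprime z) + eps * enorm (yprime z) ^+ 2).

Let k (z : 'rV[R]_n.+1) := kker n.+1 s r (enorm z).
Let k0 z : 0 <= k z. Proof. by apply: kker_ge0. Qed.

Let phi0 y : 0 <= phi y. Proof. by rewrite mulr_ge0// kker_ge0. Qed.

Let mphi : measurable_fun setT phi.
Proof. by apply: measurable_funM; [exact: measurable_eball|exact: measurable_kker_enorm]. Qed.

Let phi_orth (O : 'M[R]_n) (y : 'rV[R]_n) : orthogonal_mx O -> phi (y *m O) = phi y.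
Proof. by move=> oO; rewrite /phi enorm_orth. Qed.

Let outer (z : 'rV[R]_n.+1) := ind R (~~ cyl b a z) * k z.

(** The radius is halved because [|a.y'| <= |y'|]: if [|z| < b/2], the sheared height is below [b],
    so [z] is in the cylinder. *)
Let outer_bound z : outer z <= ind R (b / 2 <= enorm z) * k z.
Proof.
apply: ler_wpM2r; first exact: k0.
rewrite /ind; case: (leP (b / 2) (enorm z)) => zb; first by case: cyl; rewrite ?ler01.
have h1 : enorm (yprime z) <= enorm z.
  rewrite [leRHS]enorm_last -[leLHS]ger0_norm ?enorm_ge0// -sqrtr_sqr ler_wsqrtr//.
  by rewrite lerDl sqr_ge0.
have h2 : `|ylast z| <= enorm z by rewrite ylastE coord_le_enorm.
have h3 := ha (yprime z); have h4 := enorm_ge0 (yprime z).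
have h5 : `|dotrv a (yprime z)| <= enorm (yprime z).
  by apply: le_trans h3 _; rewrite ler_piMl.
have -> : cyl b a z = true.
  apply/andP; split; first lra.
  by apply: le_lt_trans (ler_normD _ _) _; lra.
by rewrite lexx.
Qed.

Let mouter : measurable_fun setT outer.
Proof.
apply: measurable_funM; last exact: measurable_kker_enorm.
by apply: measurable_boolR; apply: measurable_neg; exact: measurable_cyl.
Qed.

Let outer0 z : 0 <= outer z. Proof. by rewrite mulr_ge0. Qed.

Let outer_le : (\int[leb n.+1]_z (outer z)%:E <= C2%:E)%E.
Proof.
apply: le_trans tailC; apply: ge0_le_integral => //.
- by move=> z _; rewrite lee_fin.
- exact/measurable_EFinP.
- apply/measurable_EFinP/measurable_funM; last exact: measurable_kker_enorm.
  by apply: measurable_boolR; apply: measurable_fun_ler => //; exact: measurable_enorm.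
- by move=> z _; rewrite lee_fin.
Qed.

Let iouter : (leb n.+1).-integrable setT (EFin \o outer).
Proof.
apply/integrableP; split; first exact/measurable_EFinP.
apply: le_lt_trans (ltry C2); apply: le_trans outer_le.
rewrite (eq_integral (fun z => (outer z)%:E))// => z _.
by rewrite /= ger0_norm.
Qed.

Let outer_R : 0 <= \int[leb n.+1]_z outer z <= C2.
Proof.
rewrite Rintegral_ge0//= -lee_fin fineK//; exact: integrable_fin_num.
Qed.

Let q_int (e : R) : \int[leb n]_y ((qform B y + e * enorm y ^+ 2) * phi y) =
  \tr B * M / n%:R + e * M.
Proof.
have [iq _] := Rintegral_sum_monom phi0 mphi phiM B.
have im := integrable_moment phi0 mphi phiM.
have -> : (fun y => (qform B y + e * enorm y ^+ 2) * phi y) =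
    fun y => qform B y * phi y + e * (enorm y ^+ 2 * phi y).
  by apply/funext => y; ring.
rewrite RintegralD//; last exact: (integrableZl measurableT e im).
rewrite RintegralZl//; congr (_ + e * _); last by rewrite /Rintegral phiM.
have nn0 : n%:R != 0 :> R by rewrite pnatr_eq0 -lt0n.
rewrite -(Rintegral_qform phi0 mphi phi_orth phiM B); field.
exact: nn0.
Qed.

Let strip (e : R) : `|e| <= eps ->
  let g z := ind R (cyl b a z) *
    (1 - 2 * ind R (W z <= qform B (yprime z) + e * enorm (yprime z) ^+ 2)) * k z in
  (leb n.+1).-integrable setT (EFin \o g) /\
  `| \int[leb n.+1]_z g z + 2 * (\tr B * M / n%:R + e * M) | <=
    (1 - l `^ (- (n.+1%:R + s))) * (2 * C * M).
Proof.
move=> ee.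
have mP : measurable_fun setT (fun y : 'rV[R]_n => qform B y + e * enorm y ^+ 2).
  apply: measurable_funD.
    apply: measurable_sum => i; apply: measurable_sum => j.
    apply: measurable_funM => //; exact: measurable_monom.
  by apply: measurable_funM => //; apply: measurable_funX; exact: measurable_enorm.
have Pe y : qform B (- y) + e * enorm (- y) ^+ 2 = qform B y + e * enorm y ^+ 2.
  rewrite enormN; congr (_ + _); apply: eq_bigr => i _; apply: eq_bigr => j _.
  by rewrite !mxE mulrNN.
have PC y : `|qform B y + e * enorm y ^+ 2| <= C * enorm y ^+ 2.
  apply: le_trans (ler_normD _ _) _; apply: le_trans (BC y); rewrite lerD2l normrM.
  by rewrite (ger0_norm (sqr_ge0 _)) ler_wpM2r// sqr_ge0.
rewrite -(q_int e).
exact: (strip_estimate s1 r0 b0 C0 Cb l1 lE ha mP Pe PC phiM).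
Qed.

(** The three errors are the sandwich width [eps |y'|^2], the kernel replaced by its value at
    [|y'|], and the tail. Finiteness of [Kr] follows from the two bounds themselves. *)
Lemma Kr_one_scale : exists2 K : R, Kr s r x E1 = K%:E &
  `|K + 2 * (\tr B * M / n%:R)| <=
    2 * eps * M + (1 - l `^ (- (n.+1%:R + s))) * (2 * C * M) + C2.
Proof.
have epN : `|- eps| <= eps by rewrite normrN ger0_norm.
have epP : `|eps| <= eps by rewrite ger0_norm.
have [iU EU] := strip epN.
have [iL EL] := strip epP.
set gU := (X in \int[leb n.+1]_z X z) in EU; set gL := (X in \int[leb n.+1]_z X z) in EL.
set th := 1 - _ in EU EL *.
have chi z : (E1 (x + z *m Q) -> \1_(~` E1) (x + z *m Q) - \1_E1 (x + z *m Q) = -1 :> R) /\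
    (~ E1 (x + z *m Q) -> \1_(~` E1) (x + z *m Q) - \1_E1 (x + z *m Q) = 1 :> R).
  by split=> h; rewrite !indicE in_setC; [rewrite mem_set// sub0r|rewrite memNset// subr0].
have chi1 z : `|\1_(~` E1) (x + z *m Q) - \1_E1 (x + z *m Q)| <= 1 :> R.
  by have [/(chi z).1->|/(chi z).2->] := pselect (E1 (x + z *m Q)); rewrite ?normrN normr1.
(* A smaller set has a larger curvature integral, so the upper bound uses the inner model, with
   [-eps]. *)
have UB : (Kr s r x E1 <= (\int[leb n.+1]_z (gU z + outer z))%:E)%E.
  apply: (Kr_le oQ); first exact: (integrableD measurableT iU iouter).
  move=> z; rewrite /gU /outer -mulrDl; apply: ler_wpM2r; first exact: k0.
  have := chi z; have := chi1 z.
  set X := \1_(~` E1) (x + z *m Q) - \1_E1 (x + z *m Q) => /ler_normlP[c1 c2] [ch1 ch2].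
  case: (boolP (cyl b a z)) => cz; rewrite /ind /= ?mul1r ?mul0r ?addr0 ?add0r//.
  case: (leP (W z) _) => Wz; rewrite /= ?mulr1 ?mulr0 ?subr0//.
  have /(sandwich cz).1/ch1 -> : W z <= qform B (yprime z) - eps * enorm (yprime z) ^+ 2.
    by rewrite -mulNr.
  lra.
have LB : ((\int[leb n.+1]_z (gL z - outer z))%:E <= Kr s r x E1)%E.
  apply: (Kr_ge oQ); first exact: (integrableB measurableT iL iouter).
  move=> z; rewrite /gL /outer -mulrBl; apply: ler_wpM2r; first exact: k0.
  have := chi z; have := chi1 z.
  set X := \1_(~` E1) (x + z *m Q) - \1_E1 (x + z *m Q) => /ler_normlP[c1 c2] [ch1 ch2].
  case: (boolP (cyl b a z)) => cz; rewrite /ind /= ?mul1r ?mul0r ?subr0 ?sub0r; last lra.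
  case: (leP (W z) _) => Wz; rewrite /= ?mulr1 ?mulr0 ?subr0; first lra.
  rewrite ch2// => /(sandwich cz).2; rewrite leNgt Wz//.
rewrite RintegralD// in UB; rewrite RintegralB// in LB.
have Kfin : Kr s r x E1 \is a fin_num.
  by rewrite fin_numE -ltey -ltNye (le_lt_trans UB (ltry _)) (lt_le_trans (ltNyr _) LB).
exists (fine (Kr s r x E1)); first by rewrite fineK.
rewrite -(fineK Kfin) !lee_fin in UB LB.
have [w1 w2] := andP outer_R.
have [u1 u2] := ler_normlP _ _ EU; have [v1 v2] := ler_normlP _ _ EL.
by rewrite ler_norml; apply/andP; split; lra.
Qed.

End one_scale.

(** * The limit *)

Section limit.
Context {R : realType}.

Lemma powR_expR (x p : R) : 0 < x -> x `^ p = expR (p * ln x).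
Proof. by move=> x0; rewrite /powR gt_eqF. Qed.

(** With [h = th / p], [(1 + h)^(-p) >= 1 - p ln (1 + h) >= 1 - p h = 1 - th]. *)
Lemma powR_near1 (p th : R) : 0 < p -> 0 < th ->
  exists2 h : R, 0 < h & 1 - (1 + h) `^ (- p) <= th.
Proof.
move=> p0 th0; exists (th / p); first by rewrite divr_gt0.
have h0 : 0 < th / p by rewrite divr_gt0.
rewrite powR_expR; last lra.
have h1 : ln (1 + th / p) <= th / p by rewrite le_ln1Dx//; lra.
have h2 := expR_ge1Dx (- p * ln (1 + th / p)).
have h3 : p * ln (1 + th / p) <= th.
  by rewrite (le_trans (ler_wpM2l (ltW p0) h1))// mulrC divfK// gt_eqF.
lra.
Qed.

Lemma sigma_large (d : nat) (s A : R) : 1 <= s -> \forall r \near 0^'+, A <= sigma d s r.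
Proof.
(* For s > 1, [r^(1-s) >= 1 + (s - 1) (- ln r)], so [ln r <= -B] suffices in both cases. *)
move=> s1; pose B := if s == 1 then `|A| else `|A| * ((d%:R + 1) / (d%:R + s)).
near=> r.
have r0 : 0 < r by near: r; exact: nbhs_right_gt.
have lnr : ln r <= - B.
  rewrite -(expRK (- B)) ler_ln ?posrE ?expR_gt0//.
  by apply/ltW; near: r; apply: nbhs_right_lt; exact: expR_gt0.
rewrite /sigma; move: lnr; rewrite /B; case: eqP => [_|/eqP s1'] lnr.
  by rewrite ler0_norm; have := ler_norm A; have := normr_ge0 A; lra.
have s10 : 0 < s - 1 by rewrite subr_gt0 lt_neqAle eq_sym s1'.
have d0 : 0 <= d%:R :> R by [].
have ds : 0 < (d%:R + s) / (d%:R + 1) by rewrite divr_gt0//; lra.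
have B0 : 0 <= `|A| * ((d%:R + 1) / (d%:R + s)) by rewrite mulr_ge0// divr_ge0//; lra.
apply: (le_trans (ler_norm A)).
have -> : `|A| = (d%:R + s) / (d%:R + 1) * (`|A| * ((d%:R + 1) / (d%:R + s))).
  by field; apply/andP; split; rewrite gt_eqF//; lra.
apply: ler_wpM2l; first exact: ltW.
rewrite ler_pdivlMr// powR_expR//.
have := expR_ge1Dx ((1 - s) * ln r).
have : (s - 1) * (`|A| * ((d%:R + 1) / (d%:R + s))) <= (s - 1) * - ln r.
  by rewrite ler_wpM2l//; lra.
lra.
Unshelve. all: by end_near.
Qed.

(** Only the trace survives integration, so the triangular [taylor_mx] serves as well as half the
    Hessian. *)
Lemma trace_taylor_mx n (H : 'M[R]_n) : \tr (taylor_mx H) = (\sum_i H i i) / 2.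
Proof.
rewrite /mxtrace mulr_suml; apply: eq_bigr => i _.
by rewrite mxE ltnn eqxx.
Qed.

Lemma cyl_nrm1 n (b alpha : R) (a : 'rV[R]_n) (z : 'rV[R]_n.+1) :
  (forall y, `|dotrv a y| <= alpha * enorm y) -> alpha <= 1 -> cyl b a z ->
  nrm1 z < (n%:R + 2) * b.
Proof.
move=> ha alpha1 /andP[z1 z2]; rewrite nrm1_last.
have h1 := nrm1_le_enorm (yprime z).
have h2 : n%:R * enorm (yprime z) <= n%:R * b by rewrite ler_wpM2l// ltW.
have h3 := ha (yprime z).
have h4 : alpha * enorm (yprime z) <= enorm (yprime z) by rewrite ler_piMl// enorm_ge0.
have h5 : `|ylast z| <= `|ylast z + dotrv a (yprime z)| + `|dotrv a (yprime z)|.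
  have := ler_normB (ylast z + dotrv a (yprime z)) (dotrv a (yprime z)).
  by rewrite addrK.
lra.
Qed.

(** The parameters are fixed in the order [h], [eps], [delta] and [eta], [b], and last [r]. The
    second moment is [V S] with [S <= 2 sigma], so two relative errors of [e / 8] cost at most
    [e sigma / 2]; the bounded remainder [D0] is below [e sigma / 4]. *)
Lemma Kr_asymptotics n (s : R) (E : set 'rV[R]_n.+1) (Er : R -> set 'rV[R]_n.+1)
    (x : 'rV[R]_n.+1) (k e : R) :
  (0 < n)%N -> 1 <= s -> is_mean_curv E x k -> convCfrak Er E ->
  (forall r : R, 0 < r -> bdry (Er r) x) -> 0 < e ->
  \forall r \near 0^'+, exists2 K : R, Kr s r x (Er r) = K%:E &
    `|K / sigma n.+1 s r - omega R n * k| < e.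
Proof.
move=> n0 s1 [Q [f [rho [oQ [Cf [f0 [df0 [rho0 [EQ kE]]]]]]]]] [Phi [PhiE Phicl]] bx e0.
set H := \matrix_(i, j) pd j (pd i f) 0 : 'M[R]_n; pose B := taylor_mx H.
have kB : k = - (2 * \tr B).
  rewrite kE trace_taylor_mx mulrC divfK//; congr (- _).
  by apply: eq_bigr => i _; rewrite mxE.
pose nn : R := n%:R; have nn1 : 1 <= nn by rewrite ler1n.
have nn0 : 0 < nn by lra.
pose om := omega R n; have om0 : 0 <= om := omega_ge0 n.
pose V := nn * om; have V0 : 0 <= V by rewrite mulr_ge0// ltW.
pose C := mx1 B * nn ^+ 2 + 1.
have CB0 : 0 <= mx1 B * nn ^+ 2 by rewrite mulr_ge0 ?mx1_ge0// sqr_ge0.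
have C0 : 0 < C by rewrite /C; lra.
have CV0 : 0 <= C * V by exact: mulr_ge0 (ltW C0) V0.
have p0 : 0 < n.+1%:R + s by rewrite ltr_wpDl//; lra.
(* The added 1 keeps the denominator positive, [V] being known only to be nonnegative. *)
have th0 : 0 < e / (8 * (2 * C * V + 1)).
  by rewrite divr_gt0// mulr_gt0//; lra.
have [h h0 hth] := powR_near1 p0 th0.
set l := 1 + h in hth; set th := 1 - _ in hth.
have thV : th * (2 * C * V) <= e / 8.
  have X0 : 0 <= 2 * C * V by lra.
  apply: le_trans (ler_wpM2r X0 hth) _; move: X0 {hth th0}; set X := 2 * C * V => X0.
  have -> : e / (8 * (X + 1)) * X = e / 8 * (X / (X + 1)) by field; rewrite gt_eqF//; lra.
  by rewrite ler_piMr ?divr_ge0 ?(ltW e0)// ler_pdivrMr; lra.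
(* In order: the range of [local_graph], the tilt bound [n eps <= 1], half of the slope allowed by
   [lE], and the [e / 8] budget. *)
pose eps := Num.min (Num.min 1 nn^-1) (Num.min (h / (2 * nn)) (e / (8 * (2 * V + 1)))).
have eps0 : 0 < eps.
  by rewrite /eps !lt_min ltr01 invr_gt0 nn0 !divr_gt0// ?mulr_gt0//; lra.
have eps1 : eps <= 1 by rewrite /eps !ge_min lexx.
have eps2 : nn * eps <= 1.
  by rewrite mulrC -ler_pdivlMr// div1r /eps !ge_min lexx ?orbT.
have eps3 : nn * eps <= h / 2.
  have : eps <= h / (2 * nn) by rewrite /eps !ge_min lexx ?orbT.
  by rewrite ler_pdivlMr ?mulr_gt0//; clear -nn0; lra.
have eps4 : 2 * eps * V <= e / 8.
  have : eps <= e / (8 * (2 * V + 1)) by rewrite /eps !ge_min lexx ?orbT.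
  by rewrite ler_pdivlMr ?mulr_gt0//; [nra|lra].
have eps01 : 0 < eps <= 1 by rewrite eps0.
have [delta /andP[delta0 delta1] [eta eta0 LG]] := local_graph oQ Cf df0 rho0 EQ eps01.
(* The first bound puts the cylinder in the domain of [local_graph]. The second is the other half of
   the slope, so that [lE] becomes [1 + h^2 <= (1 + h)^2]. The third keeps the strip in the
   cylinder. *)
pose b := Num.min (delta / (nn + 2)) (Num.min (h / (2 * C)) (1 / (2 * C))).
have b0 : 0 < b by rewrite /b !lt_min !divr_gt0// ?mulr_gt0//; clear -delta0 nn0 h0 C0; lra.
have b1 : (nn + 2) * b <= delta.
  by rewrite mulrC -ler_pdivlMr /b ?ge_min ?lexx//; clear -delta0 nn0; lra.
have b2 : C * b <= h / 2.
  have : b <= h / (2 * C) by rewrite /b !ge_min lexx ?orbT.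
  by rewrite ler_pdivlMr ?mulr_gt0//; clear -C0; lra.
have b3 : C * b < 1.
  have : b <= 1 / (2 * C) by rewrite /b !ge_min lexx ?orbT.
  by rewrite ler_pdivlMr ?mulr_gt0//; clear -C0; lra.
have b20 : 0 < b / 2 by lra.
have [c Hc] := moment_sigma n0 s1 b0.
have [C2 C20 HC2] := tail_bound (ltn0Sn n) s1 b20.
pose D0 := `|2 * \tr B * om * c| + C2.
have D00 : 0 <= D0 by rewrite /D0 addr_ge0.
near=> r.
have r0 : 0 < r by near: r; exact: nbhs_right_gt.
have rb : r < b / 2 by near: r; exact: nbhs_right_lt.
have r1 : r < 1 by near: r; exact: nbhs_right_lt.
have cl : close_to_id eta (Phi r) by near: r; exact: Phicl.
(* The summands give [0 <= S <= 2 sigma], [4 D0 < e sigma], and strict positivity of [sigma]. *)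
have sA : `|c| + 4 * D0 / e + 1 <= sigma n.+1 s r by near: r; exact: sigma_large.
have [CPhi PhiEr] := PhiE r r0.
have [a [aE aG]] := LG (Phi r) (Er r) CPhi cl PhiEr (bx r r0).
have ha y : `|dotrv a y| <= (nn * eps) * enorm y.
  apply: le_trans (dotrv_le y aE) _.
  by rewrite (mulrC nn) -mulrA ler_wpM2l ?(ltW eps0)// nrm1_le_enorm.
pose S := sigma n.+1 s r + c.
have rb' : r < b by clear -rb b0; lra.
have phiM : (\int[leb n]_y (enorm (y : 'rV[R]_n) ^+ 2 *
    (ind R (enorm y < b) * kker n.+1 s r (enorm y)))%:E = (V * S)%:E)%E.
  apply: eq_trans (Hc r r0 rb' r1).
  by apply: eq_integral => y _; congr (_%:E); ring.
have BC (y : 'rV[R]_n) : `|qform B y| + eps * enorm y ^+ 2 <= C * enorm y ^+ 2.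
  rewrite /C mulrDl mul1r; apply: lerD; last by rewrite ler_piMl// sqr_ge0.
  apply: le_trans (qform_le B y) _.
  rewrite -mulrA ler_wpM2l ?mx1_ge0// -exprMn lerXn2r ?nnegrE ?nrm1_ge0//.
    by rewrite mulr_ge0 ?enorm_ge0// ltW.
  exact: nrm1_le_enorm.
have l1 : 1 <= l by rewrite /l; clear -h0; lra.
have lE : 1 + (C * b + nn * eps) ^+ 2 <= l ^+ 2.
  have h1 : 0 <= C * b by rewrite mulr_ge0// ltW.
  have h2 : 0 <= nn * eps by rewrite mulr_ge0// ltW.
  have h3 : (C * b + nn * eps) ^+ 2 <= h ^+ 2.
    by rewrite lerXn2r ?nnegrE; clear -h1 h2 h0 b2 eps3; lra.
  by rewrite /l; clear -h3 h0; nra.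
have sand z : cyl b a z -> _ := fun zc => aG z (lt_le_trans (cyl_nrm1 ha eps2 zc) b1).
have [K KE KB] := Kr_one_scale n0 s1 r0 b0 (ltW C0) b3 l1 lE ha eps2 (ltW eps0) BC oQ phiM
  (HC2 r r0 rb) sand.
exists K => //.
have D0e : 0 <= 4 * D0 / e by rewrite divr_ge0 ?mulr_ge0// ltW.
have sg0 : 0 < sigma n.+1 s r by have := normr_ge0 c; clear -sA D0e; lra.
have [c1 c2] := ler_normlP _ _ (lexx `|c|).
have S0 : 0 <= S by rewrite /S; clear -c1 sA D0e; lra.
have S2 : S <= 2 * sigma n.+1 s r by rewrite /S; clear -c2 sA D0e; lra.
have De : 4 * D0 < e * sigma n.+1 s r.
  rewrite (mulrC e) -ltr_pdivrMr//; apply: lt_le_trans sA.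
  by rewrite -addrA addrCA ltrDl ltr_wpDl.
have t1 : 2 * eps * (V * S) <= e / 8 * S by rewrite mulrA ler_wpM2r.
have t2 : th * (2 * C * (V * S)) <= e / 8 * S.
  by rewrite !mulrA ler_wpM2r// -!mulrA; rewrite !mulrA in thV *.
have KE' : K + 2 * (\tr B * (V * S) / nn) =
    (K - om * k * sigma n.+1 s r) + 2 * \tr B * om * c.
  by rewrite kB /S /V; field; rewrite gt_eqF.
rewrite KE' -/th in KB.
have key : `|K - om * k * sigma n.+1 s r| < e * sigma n.+1 s r.
  rewrite -[X in `|X|](addrK (2 * \tr B * om * c)).
  apply: le_lt_trans (ler_normB _ _) _.
  have eS : e * S <= e * (2 * sigma n.+1 s r) by rewrite ler_wpM2l// ltW.
  have {KB t1 t2} KB := le_trans KB (lerD (lerD t1 t2) (lexx C2)).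
  rewrite /D0 in De D00; apply: le_lt_trans (lerD KB (lexx _)) _.
  by clear -De eS D00; lra.
have -> : K / sigma n.+1 s r - om * k = (K - om * k * sigma n.+1 s r) / sigma n.+1 s r.
  by field; rewrite gt_eqF.
by rewrite normrM normfV (gtr0_norm sg0) ltr_pdivrMr.
Unshelve. all: by end_near.
Qed.

End limit.

Theorem theorem4p6 (R : realType) (d : nat) (s : R)
    (E : set 'rV[R]_d) (Er : R -> set 'rV[R]_d) (x : 'rV[R]_d) :
  (2 <= d)%N -> 1 <= s ->
  classCfrak E -> (forall r : R, 0 < r -> classCfrak (Er r)) ->
  convCfrak Er E ->
  bdry E x -> (forall r : R, 0 < r -> bdry (Er r) x) ->
  (fun r : R => (Kr s r x (Er r) * ((sigma d s r)^-1)%:E)%E) @ 0^'+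
    --> ((omega R d.-1 * mean_curv E x)%:E)%E.
Proof.
case: d E Er x => [//|n] E Er x n0 s1 [_ [_ CE]] _ cv bE bEr.
have [k kE] := exists_mean_curv CE bE.
(* Existence rules out the default value 0 of [xget]. *)
have mcE : is_mean_curv E x (mean_curv E x).
  exact: (@xgetPex _ 0 [set k | is_mean_curv E x k]) (ex_intro _ k kE).
have A e (e0 : 0 < e) := Kr_asymptotics n0 s1 mcE cv bEr e0.
(* [Kr] is extended-valued but finite for small [r], so the limit can be taken in the reals. *)
apply: cvg_EFin.
  by apply: filterS (A 1 ltr01) => r [K -> _].
apply/cvgrPdist_lt => e e0; apply: filterS (A e e0) => r [K KE].
by rewrite /= KE -EFinM /= distrC.
Qed.
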